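(* Suppose that $(\mathcal{A},\mathcal{B},E,E')$ is an operator-valued infinitesimal probability space (where $\mathcal{A}$ and $\mathcal{B}$ are Banach algebras), and $\{a_i\}_{i=1}^\infty$ is a sequence of centered ($E(a_i)=0$), infinitesimally centered ($E'(a_i)=0$), identically distributed, infinitesimally freely independent (respectively Boolean, monotone) elements. Let $\eta,\eta':\mathcal{B}\to\mathcal{B}$, $\eta(b)=E(a_iba_i)$, $\eta'(b)=E'(a_iba_i)$ be the common variance and infinitesimal variance of the $a_i$, and let $S_N=\frac{1}{\sqrt N}(a_1+\cdots+a_N)$. Then for all $b_0,\dots,b_k\in\mathcal{B}$, as $N\to\infty$, $$E(b_0S_Nb_1S_Nb_2\cdots b_{k-1}S_Nb_k)\longrightarrow\nu_\eta(b_0Xb_1Xb_2\cdots b_{k-1}Xb_k),$$ $$E'(b_0S_Nb_1S_Nb_2\cdots b_{k-1}S_Nb_k)\longrightarrow\nu'_{\eta,\eta'}(b_0Xb_1Xb_2\cdots b_{k-1}Xb_k),$$ where $\nu_\eta$ is the $\mathcal{B}$-valued semi-circle law (respectively Bernoulli law, arcsine law) and $\nu'_{\eta,\eta'}$ is the $\mathcal{B}$-valued infinitesimal semi-circle law (respectively infinitesimal Bernoulli law, infinitesimal arcsine law), with variances $\eta,\eta'$.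
   Context: Operator-valued infinitesimal probability space: a unital algebra $\mathcal{A}$, a unital subalgebra $\mathcal{B}$, linear maps $E,E':\mathcal{A}\to\mathcal{B}$ with $E(b)=b$, $E(bab')=bE(a)b'$, $E'(1)=0$, $E'(bab')=bE'(a)b'$. Identically distributed means that $E(a_ib_1a_ib_2\cdots b_{k-1}a_i)$ and $E'(a_ib_1a_ib_2\cdots b_{k-1}a_i)$ do not depend on $i$, for all $k$ and $b_j\in\mathcal{B}$. Independence. Let $(\mathcal{A}_i)_{i\in I}$ be unital subalgebras of $\mathcal{A}$ containing $\mathcal{B}$. They are infinitesimally independent over $\mathcal{B}$ in the following senses. (Free) For all $i_1\ne i_2\ne\cdots\ne i_n$ (consecutive indices distinct) and $c_j\in\mathcal{A}_{i_j}$ with $E(c_j)=0$: $E(c_1\cdots c_n)=0$ and $E'(c_1\cdots c_n)=\sum_{j=1}^nE(c_1\cdots c_{j-1}E'(c_j)c_{j+1}\cdots c_n)$. (Boolean) For all $i_1\ne\cdots\ne i_n$ and $c_j\in\mathcal{A}_{i_j}$: $E(c_1\cdots c_n)=E(c_1)\cdots E(c_n)$ and $E'(c_1\cdots c_n)=\sum_{j=1}^nE(c_1)\cdots E(c_{j-1})E'(c_j)E(c_{j+1})\cdots E(c_n)$. (Monotone; $I$ linearly ordered) For all $c_k\in\mathcal{A}_{i_k}$ and $j$ with $i_{j-1}<i_j>i_{j+1}$ (one inequality eliminated if $j=1$ or $j=n$): $E(c_1\cdots c_n)=E(c_1\cdots c_{j-1}E(c_j)c_{j+1}\cdots c_n)$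 and $E'(c_1\cdots c_n)=E(c_1\cdots c_{j-1}E'(c_j)c_{j+1}\cdots c_n)+E'(c_1\cdots c_{j-1}E(c_j)c_{j+1}\cdots c_n)$. Elements $a_i$ are infinitesimally independent over $\mathcal{B}$ in one of these senses if the unital algebras they generate (as subalgebras containing $\mathcal{B}$) are. Partitioned maps. $\mathcal{NC}_2(k)$ is the set of non-crossing pair partitions of $\{1,\dots,k\}$. For $\pi\in\mathcal{NC}_2(k)$, $E_\pi:\mathcal{A}^k\to\mathcal{B}$ is defined recursively: if $\pi$ has one block, $E_\pi(x_1,x_2)=E(x_1x_2)$; otherwise pick a block $V=\{l+1,l+2\}\in\pi$ and set $E_\pi(x_1,\dots,x_k)=E_{\pi\setminus V}(x_1,\dots,x_lE(x_{l+1}x_{l+2}),x_{l+3},\dots,x_k)$ (for $l=0$ the factor multiplies $x_3$ from the left). $\partial E_\pi=\sum_{V\in\pi}\partial E_{\pi,V}$, where $\partial E_{\pi,V}$ is obtained from $E_\pi$ by using $E'$ instead of $E$ for the block $V$. For $a$ any of the $a_i$, put $\eta_\pi(b_1,\dots,b_{k-1})=E_\pi(ab_1,\dots,ab_{k-1},a)$ and $\partial\eta_\pi(b_1,\dots,b_{k-1})=\partial E_\pi(ab_1,\dots,ab_{k-1},a)$. Let $\tau(\pi)!=\prod_{V\in\pi}|\{W\in\pi:W\subset[\min V,\max V]\}|$. Laws. $\mathcal{B}\langle X\rangle$ is the free algebra generated by an indeterminate $X$ over $\mathcal{B}$; $\nu_\eta,\nu'_{\eta,\eta'}:\mathcal{B}\langle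 X\rangle\to\mathcal{B}$ are linear, vanish on $b_0Xb_1\cdots Xb_k$ for odd $k$, and for even $k$ take on $b_0Xb_1X\cdots b_{k-1}Xb_k$ the values: - semi-circle: $\nu_\eta=\sum_{\pi\in\mathcal{NC}_2(k)}b_0\eta_\pi(b_1,\dots,b_{k-1})b_k$; infinitesimal semi-circle: $\nu'_{\eta,\eta'}=\sum_{\pi\in\mathcal{NC}_2(k)}b_0\,\partial\eta_\pi(b_1,\dots,b_{k-1})b_k$; - Bernoulli: $\nu_\eta=b_0\eta(b_1)b_2\eta(b_3)b_4\cdots\eta(b_{k-1})b_k$; infinitesimal Bernoulli: $\nu'_{\eta,\eta'}=\sum_{j=0}^{k/2-1}b_0\eta(b_1)b_2\cdots\eta'(b_{2j+1})\cdots\eta(b_{k-1})b_k$ (the same product with $\eta(b_{2j+1})$ replaced by $\eta'(b_{2j+1})$); - arcsine: $\nu_\eta=\sum_{\pi\in\mathcal{NC}_2(k)}\frac{1}{\tau(\pi)!}b_0\eta_\pi(b_1,\dots,b_{k-1})b_k$; infinitesimal arcsine: $\nu'_{\eta,\eta'}=\sum_{\pi\in\mathcal{NC}_2(k)}\frac{1}{\tau(\pi)!}b_0\,\partial\eta_\pi(b_1,\dots,b_{k-1})b_k$. *)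

(* Defs.v *)
From HB Require Import structures.
From mathcomp Require Import all_boot all_order all_algebra generic_quotient.
From mathcomp Require Import all_classical all_reals.
From mathcomp Require Import topology normedtype sequences.
From mathcomp Require Import complex.
Set Implicit Arguments.
Unset Strict Implicit.
Unset Printing Implicit Defensive.
Import Order.TTheory GRing.Theory Num.Theory.
Import numFieldNormedType.Exports.
Local Open Scope set_scope.
Local Open Scope ring_scope.

(* The multiplication is introduced on top of the complete normed module and
   only then turned into a ring structure: Hierarchy Builder refuses a direct
   join of GRing.Algebra and CompleteNormedModule because NumDomain, which
   also joins rings and norms, does not inherit from it.
   No normalisation [`|1| = 1] is imposed. *)
HB.mixin Record isBanachAlgebra (K : numFieldType) A
    of CompleteNormedModule K A := {
  bone : A;
  bmul : A -> A -> A;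
  bmulA : associative bmul;
  bmul1l : left_id bone bmul;
  bmul1r : right_id bone bmul;
  bmulDl : left_distributive bmul +%R;
  bmulDr : right_distributive bmul +%R;
  bone_neq0 : bone != 0;
  bscaleAl : forall (k : K) (x y : A), k *: bmul x y = bmul (k *: x) y;
  bscaleAr : forall (k : K) (x y : A), k *: bmul x y = bmul x (k *: y);
  bnormM_le : forall x y : A, `|bmul x y| <= `|x| * `|y| }.

#[short(type="banachAlgType")]
HB.structure Definition BanachAlgebra (K : numFieldType) :=
  {A of isBanachAlgebra K A & CompleteNormedModule K A}.

HB.instance Definition _ (K : numFieldType) (A : banachAlgType K) :=
  GRing.Zmodule_isNzRing.Build (BanachAlgebra.sort A)
    (@bmulA K A) bmul1l bmul1r bmulDl bmulDr bone_neq0.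
HB.instance Definition _ (K : numFieldType) (A : banachAlgType K) :=
  GRing.Lmodule_isLalgebra.Build K (BanachAlgebra.sort A) (@bscaleAl K A).
HB.instance Definition _ (K : numFieldType) (A : banachAlgType K) :=
  GRing.Lalgebra_isAlgebra.Build K (BanachAlgebra.sort A) (@bscaleAr K A).

(* The free algebra B<X> generated by an indeterminate X over B.
   As a vector space it is the direct sum over k of the (k+1)-fold tensor powers
   of B, a monomial b0 X b1 ... X bk being the tensor of b0, ..., bk.  It is
   built as formal linear combinations of words, two combinations being
   identified when no multilinear map distinguishes them. *)

Section FreeAlgebra.
Context {K : fieldType} {B : algType K}.

(* (b0, [:: b1; ...; bk]) stands for b0 X b1 ... X bk *)
Definition ncword : Type := (B * seq B)%type.

Definition multilinear (V : lmodType K) (f : seq B -> V) : Prop :=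
  forall (p q : seq B) (k : K) (u v : B),
    f (p ++ (k *: u + v) :: q) = k *: f (p ++ u :: q) + f (p ++ v :: q).

Definition sumw (V : lmodType K) (f : seq B -> V) (s : seq (K * ncword)) : V :=
  \sum_(t <- s) t.1 *: f (t.2.1 :: t.2.2).

Definition nc_equiv (s t : seq (K * ncword)) : bool :=
  `[< forall (V : lmodType K) (f : seq B -> V),
        multilinear f -> sumw f s = sumw f t >].

Lemma nc_equivP s t : reflect (forall (V : lmodType K) (f : seq B -> V),
  multilinear f -> sumw f s = sumw f t) (nc_equiv s t).
Proof. exact: asboolP. Qed.

Lemma nc_equiv_is_equiv : equiv_class_of nc_equiv.
Proof.
split=> [s|s t|t s u].
- exact/nc_equivP.
- by apply/nc_equivP/nc_equivP => st V f mf; rewrite (st V f mf).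
- move=> /nc_equivP st /nc_equivP tu.
  by apply/nc_equivP => V f mf; rewrite (st V f mf) (tu V f mf).
Qed.

Canonical nc_equiv_equiv := EquivRelPack nc_equiv_is_equiv.
Canonical nc_equiv_encModRel := defaultEncModRel nc_equiv.

Definition ncpoly := {eq_quot nc_equiv}%qT.
HB.instance Definition _ : EqQuotient _ nc_equiv ncpoly := EqQuotient.on ncpoly.
HB.instance Definition _ := Choice.on ncpoly.

Definition to_nc (s : seq (K * ncword)) : ncpoly := \pi_ncpoly%qT s.

Definition nc_lift (V : lmodType K) (f : seq B -> V) (P : ncpoly) : V :=
  sumw f (repr P).

Lemma to_ncP s t : (forall (V : lmodType K) (f : seq B -> V),
  multilinear f -> sumw f s = sumw f t) -> to_nc s = to_nc t.
Proof. by move=> st; apply/eqmodP/nc_equivP. Qed.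

Lemma nc_lift_to_nc (V : lmodType K) (f : seq B -> V) s :
  multilinear f -> nc_lift f (to_nc s) = sumw f s.
Proof.
move=> mf; rewrite /nc_lift /to_nc.
have /eqmodP/nc_equivP -> // : (repr (\pi_ncpoly s) = s %[mod ncpoly])%qT.
by rewrite reprK.
Qed.

Lemma nc_ext (P Q : ncpoly) : (forall (V : lmodType K) (f : seq B -> V),
  multilinear f -> nc_lift f P = nc_lift f Q) -> P = Q.
Proof.
by move=> PQ; rewrite -[P]reprK -[Q]reprK; apply: to_ncP.
Qed.

Fixpoint mulw_ (b : B) (s : seq B) (v : ncword) : ncword :=
  if s is b' :: s' then let r := mulw_ b' s' v in (b, r.1 :: r.2)
  else (b * v.1, v.2).
Definition mulw (u v : ncword) : ncword := mulw_ u.1 u.2 v.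

Definition nc_opp_seq (s : seq (K * ncword)) := [seq (- t.1, t.2) | t <- s].
Definition nc_scale_seq (k : K) (s : seq (K * ncword)) :=
  [seq (k * t.1, t.2) | t <- s].
Definition nc_mul_seq (s t : seq (K * ncword)) :=
  [seq (x.1 * y.1, mulw x.2 y.2) | x <- s, y <- t].

Definition nc_zero := to_nc [::].
Definition nc_add (P Q : ncpoly) := to_nc (repr P ++ repr Q).
Definition nc_opp (P : ncpoly) := to_nc (nc_opp_seq (repr P)).
Definition nc_scale (k : K) (P : ncpoly) := to_nc (nc_scale_seq k (repr P)).
Definition nc_mul (P Q : ncpoly) := to_nc (nc_mul_seq (repr P) (repr Q)).
Definition nc_one := to_nc [:: (1, (1, [::]))].

Lemma sumw_cat (V : lmodType K) (f : seq B -> V) s t :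
  sumw f (s ++ t) = sumw f s + sumw f t.
Proof. by rewrite /sumw big_cat. Qed.

Lemma sumw_opp (V : lmodType K) (f : seq B -> V) s :
  sumw f (nc_opp_seq s) = - sumw f s.
Proof.
by rewrite /sumw big_map -sumrN; apply: eq_bigr => t _; rewrite scaleNr.
Qed.

Lemma sumw_scale (V : lmodType K) (f : seq B -> V) k s :
  sumw f (nc_scale_seq k s) = k *: sumw f s.
Proof.
by rewrite /sumw big_map scaler_sumr; apply: eq_bigr => t _; rewrite scalerA.
Qed.

Definition mulw_fun (V : lmodType K) (f : seq B -> V) (p q : seq B) : V :=
  if p is a :: p' then if q is b :: q' then
    let r := mulw (a, p') (b, q') in f (r.1 :: r.2) else 0 else 0.

Lemma mulw_nil a b q : mulw (a, [::]) (b, q) = (a * b, q).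
Proof. by []. Qed.

Lemma mulw_seq p x q a v :
  let r := mulw_ a (p ++ x :: q) v in let r' := mulw_ x q v in
  r.1 :: r.2 = (a :: p) ++ (r'.1 :: r'.2).
Proof. by elim: p a => [|b p IH] a //=; congr cons; rewrite (IH b). Qed.

Lemma mulw_fun_seqE (V : lmodType K) (f : seq B -> V) p x q b q' :
  mulw_fun f (p ++ x :: q) (b :: q') =
  f (p ++ (mulw_ x q (b, q')).1 :: (mulw_ x q (b, q')).2).
Proof. by case: p => [|a p] //=; rewrite mulw_seq. Qed.

Lemma mulw_fun_multil (V : lmodType K) (f : seq B -> V) q :
  multilinear f -> multilinear (mulw_fun f ^~ q).
Proof.
move=> mf p r k u v /=; case: q => [|b q].
  by case: p => [|? ?]; rewrite /= scaler0 addr0.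
rewrite !mulw_fun_seqE; case: r => [|c r] /=; last exact: mf.
by rewrite mulrDl -scalerAl mf.
Qed.

Lemma mulw_funr_seqE (V : lmodType K) (f : seq B -> V) a q :
  exists p z, forall b q', mulw_fun f (a :: q) (b :: q') = f (p ++ z * b :: q').
Proof.
case/lastP: q => [|q z]; first by exists [::], a.
exists (a :: q), z => b q'.
by rewrite -cats1 -cat_cons mulw_fun_seqE.
Qed.

Lemma mulw_fun_multir (V : lmodType K) (f : seq B -> V) p :
  multilinear f -> multilinear (mulw_fun f p).
Proof.
move=> mf q r k u v; case: p => [|a p]; first by rewrite /= scaler0 addr0.
have [p' [z E]] := mulw_funr_seqE f a p.
case: q => [|c q]; first by rewrite !E mulrDr -scalerAr mf.
by rewrite !cat_cons !E -!cat_cons !catA mf.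
Qed.

Lemma sumw_mulE (V : lmodType K) (f : seq B -> V) s t :
  sumw f (nc_mul_seq s t) =
  sumw (fun p => sumw (mulw_fun f p) t) s.
Proof.
rewrite /sumw /nc_mul_seq big_allpairs_dep; apply: eq_bigr => x _.
rewrite scaler_sumr; apply: eq_bigr => y _.
by rewrite scalerA; case: x.2 => ? ?; case: y.2.
Qed.

Lemma sumw_mulEr (V : lmodType K) (f : seq B -> V) s t :
  sumw f (nc_mul_seq s t) =
  sumw (fun q => sumw (mulw_fun f ^~ q) s) t.
Proof.
rewrite sumw_mulE /sumw; under eq_bigr do rewrite scaler_sumr.
rewrite exchange_big /=; apply: eq_bigr => y _.
rewrite scaler_sumr; apply: eq_bigr => x _.
by rewrite !scalerA mulrC.
Qed.

Lemma sumw_multil (V : lmodType K) (g : seq B -> seq B -> V) s :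
  (forall q, multilinear (g ^~ q)) -> multilinear (fun p => sumw (g p) s).
Proof.
move=> mg p q k u v; rewrite /sumw scaler_sumr -big_split /=.
by apply: eq_bigr => t _; rewrite mg scalerDr !scalerA mulrC.
Qed.

Lemma nc_lift_add (V : lmodType K) (f : seq B -> V) P Q : multilinear f ->
  nc_lift f (nc_add P Q) = nc_lift f P + nc_lift f Q.
Proof. by move=> mf; rewrite nc_lift_to_nc // sumw_cat. Qed.

Lemma nc_lift_opp (V : lmodType K) (f : seq B -> V) P : multilinear f ->
  nc_lift f (nc_opp P) = - nc_lift f P.
Proof. by move=> mf; rewrite nc_lift_to_nc // sumw_opp. Qed.

Lemma nc_lift_scale (V : lmodType K) (f : seq B -> V) k P : multilinear f ->
  nc_lift f (nc_scale k P) = k *: nc_lift f P.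
Proof. by move=> mf; rewrite nc_lift_to_nc // sumw_scale. Qed.

Lemma nc_lift_zero (V : lmodType K) (f : seq B -> V) : multilinear f ->
  nc_lift f nc_zero = 0.
Proof. by move=> mf; rewrite nc_lift_to_nc // /sumw big_nil. Qed.

Lemma nc_lift_mul (V : lmodType K) (f : seq B -> V) P Q : multilinear f ->
  nc_lift f (nc_mul P Q) = nc_lift (fun p => nc_lift (mulw_fun f p) Q) P.
Proof. by move=> mf; rewrite nc_lift_to_nc // sumw_mulE. Qed.

Lemma to_nc_cat s t : to_nc (s ++ t) = nc_add (to_nc s) (to_nc t).
Proof.
apply: nc_ext => V f mf.
by rewrite nc_lift_add // !nc_lift_to_nc // sumw_cat.
Qed.

Lemma to_nc_mul s t : to_nc (nc_mul_seq s t) = nc_mul (to_nc s) (to_nc t).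
Proof.
apply: nc_ext => V f mf; rewrite nc_lift_mul // nc_lift_to_nc //.
have mt p : multilinear (mulw_fun f p) by exact: mulw_fun_multir.
rewrite sumw_mulE nc_lift_to_nc.
  by apply: eq_bigr => x _; rewrite nc_lift_to_nc.
by apply: sumw_multil => q; exact: mulw_fun_multil.
Qed.

Lemma nc_addA : associative nc_add.
Proof. by move=> P Q S; apply: nc_ext => V f mf; rewrite !nc_lift_add // addrA. Qed.

Lemma nc_addC : commutative nc_add.
Proof. by move=> P Q; apply: nc_ext => V f mf; rewrite !nc_lift_add // addrC. Qed.

Lemma nc_add0 : left_id nc_zero nc_add.
Proof.
by move=> P; apply: nc_ext => V f mf; rewrite nc_lift_add // nc_lift_zero // add0r.
Qed.

Lemma nc_addN : left_inverse nc_zero nc_opp nc_add.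
Proof.
move=> P; apply: nc_ext => V f mf.
by rewrite nc_lift_add // nc_lift_opp // nc_lift_zero // addNr.
Qed.

HB.instance Definition _ := GRing.isZmodule.Build ncpoly nc_addA nc_addC nc_add0 nc_addN.

Lemma nc_scaleA k l P : nc_scale k (nc_scale l P) = nc_scale (k * l) P.
Proof. by apply: nc_ext => V f mf; rewrite !nc_lift_scale // scalerA. Qed.

Lemma nc_scale1 : left_id 1 nc_scale.
Proof. by move=> P; apply: nc_ext => V f mf; rewrite nc_lift_scale // scale1r. Qed.

Lemma nc_scaleDr : right_distributive nc_scale +%R.
Proof.
move=> k P Q; apply: nc_ext => V f mf.
by rewrite nc_lift_add // !nc_lift_scale // nc_lift_add // scalerDr.
Qed.

Lemma nc_scaleDl P : {morph nc_scale^~ P : k l / k + l}.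
Proof.
move=> k l; apply: nc_ext => V f mf.
by rewrite nc_lift_add // !nc_lift_scale // scalerDl.
Qed.

HB.instance Definition _ := GRing.Zmodule_isLmodule.Build K ncpoly
  nc_scaleA nc_scale1 nc_scaleDr nc_scaleDl.

Lemma mulwA (u v w : ncword) : mulw u (mulw v w) = mulw (mulw u v) w.
Proof.
rewrite /mulw; case: u => a s; elim: s a => [|b s IH] a /=.
  by case: v => c [|d t] //=; rewrite mulrA.
by rewrite IH.
Qed.

Lemma mul1w (v : ncword) : mulw (1, [::]) v = v.
Proof. by case: v => b s; rewrite mulw_nil mul1r. Qed.

Lemma mulw1 (v : ncword) : mulw v (1, [::]) = v.
Proof.
rewrite /mulw; case: v => b s; elim: s b => [|c s IH] b /=; first by rewrite mulr1.
by rewrite IH.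
Qed.

Lemma to_nc_repr P : to_nc (repr P) = P.
Proof. exact: reprK. Qed.

Lemma nc_mulA : associative nc_mul.
Proof.
move=> P Q S; rewrite -[P]to_nc_repr -[Q]to_nc_repr -[S]to_nc_repr -!to_nc_mul.
apply: to_ncP => V f mf; rewrite /sumw /nc_mul_seq !big_allpairs_dep.
apply: eq_bigr => x _; rewrite !big_allpairs_dep.
apply: eq_bigr => y _.
by apply: eq_bigr => z _ /=; rewrite mulrA mulwA.
Qed.

Lemma nc_mul1 : left_id nc_one nc_mul.
Proof.
move=> P; rewrite -[P]to_nc_repr /nc_one -to_nc_mul.
congr to_nc; rewrite /nc_mul_seq /= cats0 -[RHS]map_id.
by apply: eq_map => -[k v] /=; rewrite mul1r mul1w.
Qed.

Lemma nc_mulr1 : right_id nc_one nc_mul.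
Proof.
move=> P; rewrite -[P]to_nc_repr /nc_one -to_nc_mul; congr to_nc.
elim: (repr P) => [|[k v] s IH] //.
by rewrite /nc_mul_seq /= mulr1 mulw1; congr cons.
Qed.

Lemma nc_lift_mulfun_multil (V : lmodType K) (f : seq B -> V) Q :
  multilinear f -> multilinear (fun p => nc_lift (mulw_fun f p) Q).
Proof. by move=> mf; apply: sumw_multil => q; exact: mulw_fun_multil. Qed.

Lemma nc_mulDl : left_distributive nc_mul +%R.
Proof.
move=> P Q S; apply: nc_ext => V f mf.
rewrite nc_lift_add // !nc_lift_mul //.
by rewrite nc_lift_add //; exact: nc_lift_mulfun_multil.
Qed.

Lemma nc_mulDr : right_distributive nc_mul +%R.
Proof.
move=> P Q S; apply: nc_ext => V f mf.
rewrite nc_lift_add // !nc_lift_mul //.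
pose g p T := nc_lift (mulw_fun f p) T.
have gD p : g p (Q + S) = g p Q + g p S.
  by apply: nc_lift_add; exact: mulw_fun_multir.
rewrite -[LHS]/(\sum_(t <- repr P) t.1 *: g (t.2.1 :: t.2.2) (Q + S)).
by under eq_bigr do rewrite gD scalerDr; rewrite big_split.
Qed.

Definition const_part (p : seq B) : B := if p is [:: b] then b else 0.

Lemma const_part_multilinear : multilinear const_part.
Proof.
move=> [|a [|b p]] [|c q] k u v //=; by rewrite ?scaler0 ?addr0.
Qed.

Lemma nc_one_neq0 : nc_one != 0.
Proof.
apply/eqP => /(congr1 (nc_lift const_part)).
rewrite (nc_lift_zero const_part_multilinear) nc_lift_to_nc; last exact: const_part_multilinear.
by rewrite /sumw big_seq1 scale1r; apply/eqP/oner_neq0.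
Qed.

HB.instance Definition _ := GRing.Zmodule_isNzRing.Build ncpoly
  nc_mulA nc_mul1 nc_mulr1 nc_mulDl nc_mulDr nc_one_neq0.

Lemma nc_scaleAl (k : K) (P Q : ncpoly) : k *: (P * Q) = k *: P * Q.
Proof.
apply: nc_ext => V f mf; rewrite nc_lift_scale // !nc_lift_mul //.
by rewrite nc_lift_scale //; exact: nc_lift_mulfun_multil.
Qed.

Lemma nc_scaleAr (k : K) (P Q : ncpoly) : k *: (P * Q) = P * (k *: Q).
Proof.
apply: nc_ext => V f mf; rewrite nc_lift_scale // !nc_lift_mul //.
pose g p T := nc_lift (mulw_fun f p) T.
have gZ p : g p (k *: Q) = k *: g p Q.
  by apply: nc_lift_scale; exact: mulw_fun_multir.
rewrite -[RHS]/(\sum_(t <- repr P) t.1 *: g (t.2.1 :: t.2.2) (k *: Q)).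
rewrite [LHS]scaler_sumr; apply: eq_bigr => t _.
by rewrite gZ !scalerA mulrC.
Qed.

HB.instance Definition _ := GRing.Lmodule_isLalgebra.Build K ncpoly nc_scaleAl.
HB.instance Definition _ := GRing.Lalgebra_isAlgebra.Build K ncpoly nc_scaleAr.

Definition ncC (b : B) : ncpoly := to_nc [:: (1, (b, [::]))].
Definition ncX : ncpoly := to_nc [:: (1, (1, [:: 1]))].

Lemma ncC_is_linear : linear ncC.
Proof.
move=> k u v; apply: nc_ext => V f mf.
rewrite nc_lift_add // nc_lift_scale // !nc_lift_to_nc // /sumw !big_seq1 /=.
by rewrite !scale1r (mf [::] [::]).
Qed.
HB.instance Definition _ := GRing.isLinear.Build K B ncpoly *:%R ncC ncC_is_linear.

Lemma ncC_is_monoid_morphism : monoid_morphism ncC.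
Proof.
split=> // b c; rewrite -[RHS]to_nc_mul /nc_mul_seq /=.
by rewrite /mulw /= mulr1.
Qed.
HB.instance Definition _ := GRing.isMonoidMorphism.Build B ncpoly ncC
  ncC_is_monoid_morphism.

Lemma nc_lift_linear (V : lmodType K) (f : seq B -> V) :
  multilinear f -> linear (nc_lift f).
Proof. by move=> mf k P Q; rewrite nc_lift_add // nc_lift_scale. Qed.

End FreeAlgebra.
Arguments ncpoly {K} B.
Arguments ncX {K B}.

(* b0 x b1 x ... x bk for bs = [:: b1; ...; bk], where j embeds B in C *)
Definition sandwich (B : Type) (C : nzRingType) (j : B -> C) (x : C)
  (b0 : B) (bs : seq B) : C := j b0 * \prod_(b <- bs) (x * j b).

Section FreeAlgebraMonomials.
Context {K : fieldType} {B : algType K}.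

Lemma sandwich_ncX (b0 : B) bs :
  sandwich ncC ncX b0 bs = to_nc [:: (1, (b0, bs))].
Proof.
rewrite /sandwich; elim: bs b0 => [|b bs IH] b0; first by rewrite big_nil mulr1.
rewrite big_cons -[ncX * _ * _]mulrA [ncC b * _]IH.
rewrite -[X in _ * X]to_nc_mul -[LHS]to_nc_mul /nc_mul_seq /=.
by rewrite /mulw /= !mulr1 mul1r.
Qed.

Lemma nc_lift_sandwich (V : lmodType K) (f : seq B -> V) b0 bs :
  multilinear f -> nc_lift f (sandwich ncC ncX b0 bs) = f (b0 :: bs).
Proof.
by move=> mf; rewrite sandwich_ncX nc_lift_to_nc // /sumw big_seq1 scale1r.
Qed.

End FreeAlgebraMonomials.

(* The inclusion of B in A is the unital algebra morphism iota; it is injective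
   because E is a retraction of it. *)

Section Spaces.
Context {K : fieldType} {A B : algType K}.
Variables (iota : {lrmorphism B -> A}) (E E' : {linear A -> B}).

Record infinitesimal_prob_space : Prop := InfinitesimalProbSpace {
  ips_unit : forall b, E (iota b) = b;
  ips_bimod : forall b x b', E (iota b * x * iota b') = b * E x * b';
  ips_unit' : E' 1 = 0;
  ips_bimod' : forall b x b', E' (iota b * x * iota b') = b * E' x * b' }.

Definition identically_distributed (I : Type) (a : I -> A) : Prop :=
  forall (i j : I) (bs : seq B),
    E (a i * \prod_(b <- bs) (iota b * a i)) =
      E (a j * \prod_(b <- bs) (iota b * a j)) /\
    E' (a i * \prod_(b <- bs) (iota b * a i)) =
      E' (a j * \prod_(b <- bs) (iota b * a j)).

Definition is_subalgebra_over (S : set A) : Prop :=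
  [/\ forall b, S (iota b),
      forall (k : K) x y, S x -> S y -> S (k *: x + y) &
      forall x y, S x -> S y -> S (x * y)].

Definition is_nonunital_subalgebra_over (S : set A) : Prop :=
  [/\ S 0,
      forall (k : K) x y, S x -> S y -> S (k *: x + y),
      forall x y, S x -> S y -> S (x * y) &
      forall b x b', S x -> S (iota b * x * iota b')].

Definition alg_gen (x : A) : set A := smallest is_subalgebra_over [set x]%classic.

(* Boolean or monotone independence of unital subalgebras containing B forces
   E (x y) = E x E y within one of them (insert the unit of another subalgebra
   between x and y), hence zero variance for centered elements.  The generated
   algebras that are merely stable under multiplication by B give a weaker
   independence hypothesis without this degeneracy. *)
Definition nonunital_alg_gen (x : A) : set A :=
  smallest is_nonunital_subalgebra_over [set x]%classic.

Definition subst_at (n : nat) (c : 'I_n -> A) (j : 'I_n) (x : A) (l : 'I_n) : A :=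
  if l == j then x else c l.

Definition alternating (I : Type) (n : nat) (i : 'I_n -> I) : Prop :=
  forall j l : 'I_n, l = j.+1 :> nat -> i j <> i l.

Definition infinitesimally_free (I : Type) (S : I -> set A) : Prop :=
  forall (n : nat) (i : 'I_n.+1 -> I) (c : 'I_n.+1 -> A),
    alternating i -> (forall j, S (i j) (c j)) -> (forall j, E (c j) = 0) ->
    E (\prod_j c j) = 0 /\
    E' (\prod_j c j) =
      \sum_j E (\prod_l subst_at c j (iota (E' (c j))) l).

Definition infinitesimally_boolean (I : Type) (S : I -> set A) : Prop :=
  forall (n : nat) (i : 'I_n.+1 -> I) (c : 'I_n.+1 -> A),
    alternating i -> (forall j, S (i j) (c j)) ->
    E (\prod_j c j) = \prod_j E (c j) /\
    E' (\prod_j c j) =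
      \sum_j \prod_l (if l == j then E' (c l) else E (c l)).

Definition is_peak (d : Order.disp_t) (I : orderType d) (n : nat)
    (i : 'I_n -> I) (j : 'I_n) : Prop :=
  forall l : 'I_n, (l.+1 = j :> nat \/ l = j.+1 :> nat) -> (i l < i j)%O.

Definition infinitesimally_monotone (d : Order.disp_t) (I : orderType d)
    (S : I -> set A) : Prop :=
  forall (n : nat) (i : 'I_n.+1 -> I) (c : 'I_n.+1 -> A) (j : 'I_n.+1),
    (forall l, S (i l) (c l)) -> is_peak i j ->
    E (\prod_l c l) = E (\prod_l subst_at c j (iota (E (c j))) l) /\
    E' (\prod_l c l) = E (\prod_l subst_at c j (iota (E' (c j))) l) +
                       E' (\prod_l subst_at c j (iota (E (c j))) l).

End Spaces.

Definition noncrossing (k : nat) (pi : {set {set 'I_k}}) : bool :=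
  [forall V in pi, forall W in pi, (V != W) ==>
    ~~ [exists p1 in V, exists q1 in W, exists p2 in V, exists q2 in W,
        [&& p1 < q1, q1 < p2 & p2 < q2]%N]].

Definition NC2 (k : nat) : {set {set {set 'I_k}}} :=
  [set pi | [&& finset.partition pi [set: 'I_k],
                [forall V in pi, #|V| == 2] & noncrossing pi]].

Definition hull (k : nat) (V : {set 'I_k}) : {set 'I_k} :=
  [set i : 'I_k | [exists u in V, exists v in V, (u <= i <= v)%N]].

(* the tree factorial of the nesting forest of pi *)
Definition tau_fact (k : nat) (pi : {set {set 'I_k}}) : nat :=
  \prod_(V in pi) #|[set W in pi | W \subset hull V]|.

Section PartitionedMaps.
Context {K : fieldType} {A B : algType K}.
Variable iota : {lrmorphism B -> A}.

(* The entries of a word (x_1, ..., x_k) carry their position as a label, so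
   that the blocks of pi keep their meaning while the word shrinks.  Functional
   [phi V] is applied to block V.  [contract] removes the leftmost pair of
   neighbours forming a block (the value of E_pi does not depend on which such
   block is picked). *)
Section Contraction.
Variables (k : nat) (pi : {set {set 'I_k}}) (phi : {set 'I_k} -> {linear A -> B}).

Fixpoint contract_inner (s : seq ('I_k * A)) : seq ('I_k * A) :=
  if s is u :: ((v :: w :: t) as s') then
    if [set v.1; w.1] \in pi
    then (u.1, u.2 * iota (phi [set v.1; w.1] (v.2 * w.2))) :: t
    else u :: contract_inner s'
  else s.

Definition contract (s : seq ('I_k * A)) : seq ('I_k * A) :=
  if s is v :: w :: u :: t then
    if [set v.1; w.1] \in pi
    then (u.1, iota (phi [set v.1; w.1] (v.2 * w.2)) * u.2) :: t
    else contract_inner s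
  else s.

(* n is the number of remaining blocks *)
Fixpoint part_rec (n : nat) (s : seq ('I_k * A)) : B :=
  match n with
  | 0%N => 1
  | 1%N => if s is [:: v; w] then phi [set v.1; w.1] (v.2 * w.2) else 0
  | n'.+1 => part_rec n' (contract s)
  end.

Definition part_map (x : 'I_k -> A) : B :=
  part_rec #|pi| [seq (i, x i) | i <- enum 'I_k].

End Contraction.

Variables (E E' : {linear A -> B}).

Definition E_part k (pi : {set {set 'I_k}}) (x : 'I_k -> A) : B :=
  part_map pi (fun=> E) x.

Definition dE_part_block k (pi : {set {set 'I_k}}) (V : {set 'I_k})
    (x : 'I_k -> A) : B :=
  part_map pi (fun W => if W == V then E' else E) x.

Definition dE_part k (pi : {set {set 'I_k}}) (x : 'I_k -> A) : B :=
  \sum_(V in pi) dE_part_block pi V x.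

(* (a b_1, ..., a b_(k-1), a); only b 1, ..., b k.-1 are used *)
Definition eta_args (a : A) k (b : nat -> B) (i : 'I_k) : A :=
  if i.+1 == k then a else a * iota (b i.+1).

Definition eta_part (a : A) k (pi : {set {set 'I_k}}) (b : nat -> B) : B :=
  E_part pi (eta_args a b).

Definition deta_part (a : A) k (pi : {set {set 'I_k}}) (b : nat -> B) : B :=
  dE_part pi (eta_args a b).

End PartitionedMaps.

(* [*_moment k b] is the value of the law on b_0 X b_1 ... X b_k with
   b_i = b i; [law] extends it linearly to B<X>.  The case k = 0, where the
   sum over pair partitions would give b_0 twice, is b_0 (a law is a
   B-bimodule map and is unital); the infinitesimal laws vanish on B, as the
   sum over the blocks of the empty partition is empty. *)

Section Laws.
Context {K : fieldType} {A B : algType K}.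
Variables (iota : {lrmorphism B -> A}) (E E' : {linear A -> B}) (a : A).
Variables (eta eta' : B -> B).

Definition law (m : nat -> (nat -> B) -> B) : ncpoly B -> B :=
  nc_lift (fun w : seq B => m (size w).-1 (nth 0 w)).

Definition semicircle_moment (k : nat) (b : nat -> B) : B :=
  if odd k then 0 else if k == 0%N then b 0%N else
  \sum_(pi in NC2 k) b 0%N * eta_part iota E a pi b * b k.

Definition inf_semicircle_moment (k : nat) (b : nat -> B) : B :=
  if odd k then 0 else
  \sum_(pi in NC2 k) b 0%N * deta_part iota E E' a pi b * b k.

Definition bernoulli_moment (k : nat) (b : nat -> B) : B :=
  if odd k then 0 else
  b 0%N * \prod_(l < k./2) (eta (b l.*2.+1) * b l.*2.+2).

Definition inf_bernoulli_moment (k : nat) (b : nat -> B) : B :=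
  if odd k then 0 else
  \sum_(j < k./2)
    b 0%N * \prod_(l < k./2) ((if l == j then eta' else eta) (b l.*2.+1) * b l.*2.+2).

Definition arcsine_moment (k : nat) (b : nat -> B) : B :=
  if odd k then 0 else if k == 0%N then b 0%N else
  \sum_(pi in NC2 k)
    (tau_fact pi)%:R^-1 *: (b 0%N * eta_part iota E a pi b * b k).

Definition inf_arcsine_moment (k : nat) (b : nat -> B) : B :=
  if odd k then 0 else
  \sum_(pi in NC2 k)
    (tau_fact pi)%:R^-1 *: (b 0%N * deta_part iota E E' a pi b * b k).

Definition semicircle_law : ncpoly B -> B := law semicircle_moment.
Definition inf_semicircle_law : ncpoly B -> B := law inf_semicircle_moment.
Definition bernoulli_law : ncpoly B -> B := law bernoulli_moment.
Definition inf_bernoulli_law : ncpoly B -> B := law inf_bernoulli_moment.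
Definition arcsine_law : ncpoly B -> B := law arcsine_moment.
Definition inf_arcsine_law : ncpoly B -> B := law inf_arcsine_moment.

End Laws.

(* The moments above are multilinear in b_0, ..., b_k, so that the laws are
   linear maps ([law_linear]) with the prescribed values on monomials
   ([law_sandwich]). *)

Section Multilinearity.
Context {K : fieldType} {A B : algType K}.

Inductive lin3 (L : Type) (M : lmodType K) (c : K) :
    seq (L * M) -> seq (L * M) -> seq (L * M) -> Prop :=
| lin3_head i u v q : lin3 c ((i, u) :: q) ((i, v) :: q) ((i, c *: u + v) :: q)
| lin3_tail x s s' s'' : lin3 c s s' s'' -> lin3 c (x :: s) (x :: s') (x :: s'').

Section Part.
Variables (iota : {lrmorphism B -> A}) (k : nat) (pi : {set {set 'I_k}}).
Variable (phi : {set 'I_k} -> {linear A -> B}).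

Lemma contract_inner_lin3 (c : K) s s' s'' : lin3 c s s' s'' ->
  lin3 c (contract_inner iota pi phi s) (contract_inner iota pi phi s')
    (contract_inner iota pi phi s'').
Proof.
elim=> {s s' s''} [i u v [|x [|y q]]|x s s' s'' l IH]; try exact: lin3_head.
  rewrite /=; case: ifP => _ /=; last exact: lin3_head.
  by rewrite mulrDl -scalerAl; exact: lin3_head.
case: l IH => [i u v [|y q]|y t t' t'' [i u v q|z r r' r'' l]] /= IH.
- by apply: lin3_tail; exact: lin3_head.
- case: ifP => _ /=; last exact: lin3_tail.
  rewrite mulrDl -scalerAl linearP linearP mulrDr -scalerAr.
  exact: lin3_head.
- case: ifP => _ /=; last exact: lin3_tail.
  rewrite mulrDr -scalerAr linearP linearP mulrDr -scalerAr.
  exact: lin3_head.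
- by case: ifP => _ /=; exact: lin3_tail.
Qed.

Lemma contract_lin3 (c : K) s s' s'' : lin3 c s s' s'' ->
  lin3 c (contract iota pi phi s) (contract iota pi phi s')
    (contract iota pi phi s'').
Proof.
move=> l; have := contract_inner_lin3 l; rewrite /contract; case: l => {s s' s''}
  [i u v [|x [|y q]]|x s s' s'' [i u v [|y q]|y t t' t'' [i u v q|z r r' r'' l]]] // H.
- case: ifP => _ //=.
  by rewrite mulrDl -scalerAl linearP linearP mulrDl -scalerAl; exact: lin3_head.
- case: ifP => _ //=.
  by rewrite mulrDr -scalerAr linearP linearP mulrDl -scalerAl; exact: lin3_head.
- case: ifP => _ //=.
  by rewrite mulrDr -scalerAr; exact: lin3_head.
- by case: ifP => _ //=; exact: lin3_tail.
Qed.

Lemma part_rec_lin3 n (c : K) s s' s'' : lin3 c s s' s'' ->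
  part_rec iota pi phi n.+1 s'' =
  c *: part_rec iota pi phi n.+1 s + part_rec iota pi phi n.+1 s'.
Proof.
elim: n s s' s'' => [|n IH] s s' s'' l; last exact: (IH _ _ _ (contract_lin3 l)).
case: l => {s s' s''}
  [i u v [|x [|y q]]|x s s' s'' [i u v [|y q]|y t t' t'' [i u v q|z r r' r'' l]]] /=;
  rewrite ?scaler0 ?addr0 //.
- by rewrite mulrDl -scalerAl linearP.
- by rewrite mulrDr -scalerAr linearP.
Qed.

Lemma part_map_linear (j : 'I_k) (c : K) (x x' x'' : 'I_k -> A) :
  (0 < #|pi|)%N ->
  (forall i, i != j -> x i = x'' i /\ x' i = x'' i) ->
  x'' j = c *: x j + x' j ->
  part_map iota pi phi x'' =
  c *: part_map iota pi phi x + part_map iota pi phi x'.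
Proof.
rewrite /part_map; case: #|pi| => [//|n] _ off at_j; apply: part_rec_lin3.
have : j \in enum 'I_k by rewrite mem_enum.
have : uniq (enum 'I_k) by exact: enum_uniq.
elim: (enum 'I_k) => [//|i s IH] /= /andP[iNs us]; rewrite inE.
have [ji _|ji /= js] := eqVneq j i.
  have E (y : 'I_k -> A) : (forall l, l != i -> y l = x'' l) ->
      [seq (l, y l) | l <- s] = [seq (l, x'' l) | l <- s].
    move=> yE; apply/eq_in_map => l ls; rewrite yE //.
    by apply: contraNneq iNs => <-.
  move: off at_j; rewrite ji => off ->; rewrite (E x) ?(E x').
  - exact: lin3_head.
  - by move=> l /off[].
  - by move=> l /off[].
have [-> ->] : x i = x'' i /\ x' i = x'' i by apply: off; rewrite eq_sym.
by apply: lin3_tail; exact: IH.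
Qed.

End Part.
Section Moments.
Variables (iota : {lrmorphism B -> A}) (E E' : {linear A -> B}) (a : A).

(* b'' agrees with b and b' except at i, where it is c *: b i + b' i *)
Definition lin_at (c : K) (i : nat) (b b' b'' : nat -> B) : Prop :=
  (forall l, l != i -> b l = b'' l /\ b' l = b'' l) /\ b'' i = c *: b i + b' i.

Definition moment_multilinear (m : nat -> (nat -> B) -> B) : Prop :=
  forall k c i b b' b'', (i <= k)%N -> lin_at c i b b' b'' ->
    m k b'' = c *: m k b + m k b'.

Lemma lin_at_nth c (p q : seq B) u v :
  lin_at c (size p) (nth 0 (p ++ u :: q)) (nth 0 (p ++ v :: q))
    (nth 0 (p ++ (c *: u + v) :: q)).
Proof.
split=> [l lp|]; last by rewrite !nth_cat ltnn subnn.
rewrite !nth_cat; case: ltnP => // pl.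
by case: (l - size p)%N (subn_eq0 l (size p)) => [|n] //; rewrite eqxx leqNgt ltn_neqAle eq_sym lp pl.
Qed.

Lemma moment_multilinearP m : moment_multilinear m ->
  multilinear (fun w : seq B => m (size w).-1 (nth 0 w)).
Proof.
move=> mm p q c u v; rewrite !size_cat /= addnS /=.
by apply: mm (lin_at_nth c p q u v); rewrite leq_addr.
Qed.

Lemma law_linear m : moment_multilinear m -> linear (law m).
Proof. by move=> /moment_multilinearP; exact: nc_lift_linear. Qed.

Lemma law_sandwich m b0 bs : moment_multilinear m ->
  law m (sandwich ncC ncX b0 bs) = m (size bs) (nth 0 (b0 :: bs)).
Proof. by move=> /moment_multilinearP; exact: nc_lift_sandwich. Qed.

Lemma NC2_card_gt0 k (pi : {set {set 'I_k}}) :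
  (0 < k)%N -> pi \in NC2 k -> (0 < #|pi|)%N.
Proof.
move=> k0; rewrite inE => /and3P[+ _ _]; rewrite card_gt0.
apply: contraTneq => ->; apply/negP => /and3P[+ _ _].
rewrite /finset.cover big_set0 => /eqP/setP/(_ (Ordinal k0)).
by rewrite !inE.
Qed.

Lemma sandwiched_multilinear k (pi : {set {set 'I_k}})
    (phi : {set 'I_k} -> {linear A -> B}) c i b b' b'' :
  (0 < k)%N -> pi \in NC2 k -> (i <= k)%N -> lin_at c i b b' b'' ->
  let F b := b 0%N * part_map iota pi phi (eta_args iota a b) * b k in
  F b'' = c *: F b + F b'.
Proof.
move=> k0 piNC ik [off at_i] /=.
have npi := NC2_card_gt0 k0 piNC.
have argsE (d : nat -> B) : (forall l, l != i -> d l = b'' l) ->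
    (i == 0%N) || (i == k) ->
    part_map iota pi phi (eta_args iota a d) =
    part_map iota pi phi (eta_args iota a b'').
  move=> dE i0k; congr part_map; apply: funext => l; rewrite /eta_args.
  case: eqP => // /eqP lk; rewrite dE //.
  by case/orP: i0k => /eqP ->.
have off1 l : l != i -> b l = b'' l by move=> /off[].
have off2 l : l != i -> b' l = b'' l by move=> /off[].
have [i0|i0] := eqVneq i 0%N.
  rewrite (argsE b off1) ?(argsE b' off2) ?i0 //; rewrite i0 in at_i off1 off2.
  have k1 : k != 0%N by rewrite -lt0n.
  by rewrite (off1 k) // (off2 k) // at_i !mulrDl -!scalerAl.
have [ik'|nik] := eqVneq i k.
  rewrite (argsE b off1) ?(argsE b' off2) ?ik' ?eqxx ?orbT //; rewrite ik' in at_i off1 off2.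
  have k1 : 0%N != k by rewrite eq_sym -lt0n.
  by rewrite (off1 0%N) // (off2 0%N) // at_i mulrDr -scalerAr.
rewrite (off1 0%N) 1?eq_sym // (off2 0%N) 1?eq_sym //.
rewrite (off1 k) 1?eq_sym // (off2 k) 1?eq_sym //.
rewrite scalerAl scalerAr -mulrDl -mulrDr; congr (_ * _ * _).
have ltik : (i.-1 < k)%N by rewrite prednK ?lt0n.
apply: (@part_map_linear _ _ _ _ (Ordinal ltik)) => //.
- move=> l li; rewrite /eta_args; case: eqP => // _.
  suff li' : l.+1 != i by rewrite off1 // off2.
  by apply: contraNneq li => li; apply/eqP/val_inj; rewrite /= -li.
- rewrite /eta_args /= prednK ?lt0n // (negPf nik) at_i.
  by rewrite linearP mulrDr -scalerAr.
Qed.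

Lemma semicircle_multilinear : moment_multilinear (semicircle_moment iota E a).
Proof.
move=> k c i b b' b'' ik lb; rewrite /semicircle_moment.
case: ifP => _; first by rewrite scaler0 addr0.
case: ifPn => [/eqP k0|k0].
  by case: lb => _; move: ik; rewrite k0 leqn0 => /eqP ->.
rewrite scaler_sumr -big_split /=; apply: eq_bigr => pi piNC.
by apply: sandwiched_multilinear lb; rewrite // lt0n.
Qed.

Lemma arcsine_multilinear : moment_multilinear (arcsine_moment iota E a).
Proof.
move=> k c i b b' b'' ik lb; rewrite /arcsine_moment.
case: ifP => _; first by rewrite scaler0 addr0.
case: ifPn => [/eqP k0|k0].
  by case: lb => _; move: ik; rewrite k0 leqn0 => /eqP ->.
rewrite scaler_sumr -big_split /=; apply: eq_bigr => pi piNC.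
rewrite scalerA mulrC -scalerA -scalerDr; congr (_ *: _).
by apply: sandwiched_multilinear lb; rewrite // lt0n.
Qed.

Lemma inf_sandwiched_multilinear k (pi : {set {set 'I_k}}) c i b b' b'' :
  pi \in NC2 k -> (i <= k)%N -> lin_at c i b b' b'' ->
  let F b := b 0%N * deta_part iota E E' a pi b * b k in
  F b'' = c *: F b + F b'.
Proof.
move=> piNC ik lb /=; rewrite /deta_part /dE_part !mulr_sumr !mulr_suml.
rewrite scaler_sumr -big_split /=; apply: eq_bigr => V Vpi.
apply: sandwiched_multilinear lb => //.
case: k pi piNC ik V Vpi => [|//] pi; rewrite inE => /and3P[_ + _] _ V Vpi.
move=> /forall_inP/(_ V Vpi)/eqP V2.
by have := max_card (mem V); rewrite V2 card_ord.
Qed.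

Lemma inf_semicircle_multilinear :
  moment_multilinear (inf_semicircle_moment iota E E' a).
Proof.
move=> k c i b b' b'' ik lb; rewrite /inf_semicircle_moment.
case: ifP => _; first by rewrite scaler0 addr0.
rewrite scaler_sumr -big_split /=; apply: eq_bigr => pi piNC.
exact: inf_sandwiched_multilinear lb.
Qed.

Lemma inf_arcsine_multilinear :
  moment_multilinear (inf_arcsine_moment iota E E' a).
Proof.
move=> k c i b b' b'' ik lb; rewrite /inf_arcsine_moment.
case: ifP => _; first by rewrite scaler0 addr0.
rewrite scaler_sumr -big_split /=; apply: eq_bigr => pi piNC.
rewrite scalerA mulrC -scalerA -scalerDr; congr (_ *: _).
exact: inf_sandwiched_multilinear lb.
Qed.

Lemma alternating_prod_multilinear (g : nat -> B -> B) n c i b b' b'' :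
  (forall l, linear (g l)) -> (i <= n.*2)%N -> lin_at c i b b' b'' ->
  let F b := b 0%N * \prod_(l < n) (g l (b l.*2.+1) * b l.*2.+2) in
  F b'' = c *: F b + F b'.
Proof.
move=> lg + [off at_i] /=.
have prodE d : (forall l, l != i -> d l = b'' l) -> forall m, (m.*2 < i)%N ->
    d 0%N * \prod_(l < m) (g l (d l.*2.+1) * d l.*2.+2) =
    b'' 0%N * \prod_(l < m) (g l (b'' l.*2.+1) * b'' l.*2.+2).
  move=> dE m mi; rewrite dE; last by case: (i) mi.
  congr (_ * _); apply: eq_bigr => l _.
  have li : (l.*2.+2 < i)%N by apply: leq_ltn_trans mi; rewrite -doubleS leq_double.
  by rewrite (dE l.*2.+1) ?(dE l.*2.+2) // neq_ltn ?li // (ltn_trans _ li).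
have off1 l : l != i -> b l = b'' l by move=> /off[].
have off2 l : l != i -> b' l = b'' l by move=> /off[].
elim: n => [|n IH]; first by rewrite leqn0 !big_ord0 !mulr1 => /eqP <-.
rewrite doubleS !big_ord_recr /= !mulrA.
rewrite leq_eqVlt => /orP[/eqP i2|].
  rewrite !(prodE b off1) ?(prodE b' off2) ?i2 //; rewrite i2 in at_i off1 off2.
  rewrite at_i (off1 n.*2.+1) ?(off2 n.*2.+1) ?ltn_eqF //.
  by rewrite mulrDr -scalerAr.
rewrite ltnS leq_eqVlt => /orP[/eqP i1|].
  rewrite !(prodE b off1) ?(prodE b' off2) ?i1 //; rewrite i1 in at_i off1 off2.
  rewrite at_i (off1 n.*2.+2) ?(off2 n.*2.+2) ?gtn_eqF //.
  by rewrite lg mulrDr mulrDl -scalerAr -scalerAl.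
rewrite ltnS => ni; rewrite IH //.
rewrite (off1 n.*2.+1) ?(off2 n.*2.+1) ?gtn_eqF ?ltnS //.
rewrite (off1 n.*2.+2) ?(off2 n.*2.+2) ?gtn_eqF ?ltnS ?(leq_trans ni) //.
by rewrite !mulrDl -!scalerAl.
Qed.

Lemma bernoulli_multilinear eta : linear eta ->
  moment_multilinear (bernoulli_moment eta).
Proof.
move=> leta k c i b b' b'' ik lb; rewrite /bernoulli_moment.
case: ifPn => [_|k2]; first by rewrite scaler0 addr0.
apply: (@alternating_prod_multilinear (fun=> eta)) lb => //.
by rewrite -(even_halfK k2) in ik.
Qed.

Lemma inf_bernoulli_multilinear eta eta' : linear eta -> linear eta' ->
  moment_multilinear (inf_bernoulli_moment eta eta').
Proof.
move=> leta leta' k c i b b' b'' ik lb; rewrite /inf_bernoulli_moment.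
case: ifPn => [_|k2]; first by rewrite scaler0 addr0.
rewrite scaler_sumr -big_split /=; apply: eq_bigr => j _.
apply: (@alternating_prod_multilinear
  (fun l => if l == j :> nat then eta' else eta)) lb => //.
  by move=> l; case: ifP.
by rewrite -(even_halfK k2) in ik.
Qed.

End Moments.
End Multilinearity.

Section CentralLimit.
Context {R : realType} {A B : banachAlgType R[i]}.

Definition normalized_sum (a : nat -> A) (N : nat) : A :=
  (sqrtC N%:R)^-1 *: \sum_(i < N) a i.

Definition moments_converge (iota : {lrmorphism B -> A}) (E : {linear A -> B})
    (S : nat -> A) (nu : ncpoly B -> B) : Prop :=
  forall (b0 : B) (bs : seq B),
    ((fun N => E (sandwich iota (S N) b0 bs)) @ \oo -->
      nu (sandwich ncC ncX b0 bs))%classic.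

End CentralLimit.

(* Main.v *)
(* The pair (E, E') is a single expectation over the dual numbers: it sends
   x + eps x' to E x + eps (E x' + E' x), and infinitesimal independence with
   respect to (E, E') implies ordinary independence for it.

   E and E' are not assumed to be continuous, so everything is exact in N.  The
   moment of a_(f 1) b_1 a_(f 2) ... depends only on the relative order of the
   values of f, and it vanishes as soon as some value is taken once.  Grouping
   the maps f : [k] -> [N] by their image writes the k-th moment of
   a_1 + ... + a_N as the sum over r <= k / 2 of C(N, r) c_r, where c_r is the
   sum over the surjections f : [k] -> [r]; after division by N ^ (k / 2) only
   c_(k/2) / (k/2)! survives.  Its terms are indexed by a pair partition and an
   order of its blocks.  Contracting neighbouring equal labels, in the monotone
   case the largest ones first, shows that a term is E_pi or zero.  In the free
   case the noncrossing pi contribute for all orders; in the Boolean case only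
   the partition into neighbours contributes; in the monotone case only the
   orders in which inner blocks come after outer ones count, and the hook length
   formula for forests says that there are (k/2)! / tau(pi)! of them. *)

Require Import Defs.
From HB Require Import structures.
From mathcomp Require Import all_boot all_order all_algebra.
From mathcomp Require Import all_classical all_reals.
From mathcomp Require Import topology normedtype sequences.
From mathcomp Require Import complex.
Set Implicit Arguments.
Unset Strict Implicit.
Unset Printing Implicit Defensive.
Import Order.TTheory GRing.Theory Num.Theory.
Import numFieldNormedType.Exports.
Local Open Scope ring_scope.

(** * Dual numbers *)

(** The sums over one distinguished factor in the definitions of infinitesimal independence are
    Leibniz rules, that is, eps parts of products. The laws, however, are stated through [E_pi] and
    its one-block variants, so results over the dual numbers must be read back: a removed pair [c d]
    leaves the scalar [E (c d) + eps E' (c d)], whose eps part supplies the summand of that block.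

    Two obstacles shape the words. Moments under different labelings can be compared only if the
    same polynomial is evaluated at different [a i]; letters are therefore families, stable under
    the products and scalars that a reduction creates. And [E_pi] is computed by contracting the
    leftmost block, whereas independence allows the contraction of neighbours whose labels agree, or
    are also largest; a confluence argument makes the order of contractions immaterial.

    A family [S] of sets stands for the generated algebras, unital or not. Centering subtracts
    scalars, which is why the free case asks that each [S i] contain [B]. *)

(* (x, x') stands for x + eps x' with eps ^ 2 = 0. *)
Definition dual (A : pzRingType) : Type := (A * A)%type.
HB.instance Definition _ (A : pzRingType) := GRing.Zmodule.on (dual A).

Section DualRing.
Variable A : pzRingType.

Definition dual_one : dual A := (1, 0).
Definition dual_mul (x y : dual A) : dual A :=
  (x.1 * y.1, x.1 * y.2 + x.2 * y.1).

Lemma dual_mulA : associative dual_mul.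
Proof.
by move=> x y z; congr (_, _); rewrite /= ?mulrA // mulrDr mulrDl !mulrA addrA.
Qed.

Lemma dual_mul1 : left_id dual_one dual_mul.
Proof. by case=> x y; congr (_, _); rewrite /= !mul1r ?mul0r ?addr0. Qed.

Lemma dual_mulr1 : right_id dual_one dual_mul.
Proof. by case=> x y; congr (_, _); rewrite /= !mulr1 ?mulr0 ?add0r. Qed.

Lemma dual_mulDl : left_distributive dual_mul +%R.
Proof.
by move=> x y z; congr (_, _); rewrite /= !mulrDl // addrACA.
Qed.

Lemma dual_mulDr : right_distributive dual_mul +%R.
Proof.
by move=> x y z; congr (_, _); rewrite /= !mulrDr // addrACA.
Qed.

HB.instance Definition _ := GRing.Zmodule_isPzRing.Build (dual A)
  dual_mulA dual_mul1 dual_mulr1 dual_mulDl dual_mulDr.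

(** As [eps ^ 2 = 0], each term of the eps part takes it from exactly one factor. The Boolean rule
    for [E'] has this very form. *)
Lemma dual_prod n (c : 'I_n -> dual A) :
  \prod_l c l = (\prod_l (c l).1, \sum_j \prod_l (if l == j then (c l).2 else (c l).1)).
Proof.
elim: n c => [|n IH] c; first by rewrite !big_ord0.
rewrite !big_ord_recl IH; congr (_, _) => /=; rewrite addrC; congr (_ + _).
rewrite mulr_sumr; apply: eq_bigr => j _.
by rewrite big_ord_recl.
Qed.

End DualRing.

(** * Words and independence over a ring *)

Section Absorb.
Variables (T M B : Type) (ml : B -> M -> M) (mr : M -> B -> M).

(* Multiplies a scalar standing between x and y into the last letter of x, or
   into the first letter of y when x is empty. *)
Fixpoint absorb (x : seq (T * M)) (b : B) (y : seq (T * M)) : seq (T * M) :=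
  match x with
  | [::] => if y is u :: y' then (u.1, ml b u.2) :: y' else [::]
  | u :: x' => if x' is _ :: _ then u :: absorb x' b y else (u.1, mr u.2 b) :: y
  end.

Lemma absorb_rcons x u b y :
  absorb (rcons x u) b y = x ++ (u.1, mr u.2 b) :: y.
Proof. by elim: x => [|v [|w x] IH] //=; congr (_ :: _). Qed.

Lemma absorb_labels x b y : [seq l.1 | l <- absorb x b y] = [seq l.1 | l <- x ++ y].
Proof.
case/lastP: x => [|x u]; first by case: y.
by rewrite absorb_rcons cat_rcons !map_cat.
Qed.

Lemma size_absorb x b y : size (absorb x b y) = size (x ++ y).
Proof. by rewrite -(size_map fst) absorb_labels size_map. Qed.

Lemma all_absorb (p : pred (T * M)) x b y :
  (forall l, p l -> p (l.1, ml b l.2) && p (l.1, mr l.2 b)) ->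
  all p (x ++ y) -> all p (absorb x b y).
Proof.
move=> pb; case/lastP: x => [|x u].
  by case: y => [|u y] //= /andP[/pb/andP[-> _] ->].
by rewrite absorb_rcons cat_rcons !all_cat /= => /and3P[-> /pb/andP[_ ->] ->].
Qed.

End Absorb.

(* A letter (t, c) consists of a position t and a family c; under a labeling f
   of the positions it is read as c (f t).  One word can thus be compared under
   two labelings. *)
Section Words.
Variables (A B : pzRingType) (j : {rmorphism B -> A}) (E : {additive A -> B}).
Variables (F : pred (nat -> A)) (T : Type).
Local Notation letter := (T * (nat -> A))%type.
Local Notation word := (seq letter).
Implicit Types (f g : T -> nat) (w x y : word) (l : letter) (c d : nat -> A).

Definition fml (b : B) (c : nat -> A) : nat -> A := fun i => j b * c i.
Definition fmr (c : nat -> A) (b : B) : nat -> A := fun i => c i * j b.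
Local Notation fabsorb := (@absorb T (nat -> A) B fml fmr).

Definition ev f w : A := \prod_(l <- w) l.2 (f l.1).
Definition mean (c : nat -> A) : B := E (c 0%N).

(** [F] is a class of families with label-independent mean, closed under what merging letters and
    absorbing scalars do to them. Subtraction of a scalar may leave a non-unital algebra and is a
    separate hypothesis of the free case. *)
Record ncps : Prop := NCPS {
  ncps_bimod : forall b (z : A) b', E (j b * z * j b') = b * E z * b';
  ncps_unit : forall b, E (j b) = b;
  ncps_id : forall c i, F c -> E (c i) = mean c;
  ncps_mul : forall c d, F c -> F d -> F (fun i => c i * d i);
  ncps_ml : forall b c, F c -> F (fml b c);
  ncps_mr : forall b c, F c -> F (fmr c b) }.
Hypothesis sp : ncps.

Definition wordF w : bool := all (fun l => F l.2) w.
Definition centered w : bool := all (fun l => mean l.2 == 0) w.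
Definition altern f w : bool := sorted (fun l l' => f l.1 != f l'.1) w.

Lemma ev_nil f : ev f [::] = 1. Proof. exact: big_nil. Qed.

Lemma ev_cons f l w : ev f (l :: w) = l.2 (f l.1) * ev f w.
Proof. exact: big_cons. Qed.

Lemma ev_cat f x y : ev f (x ++ y) = ev f x * ev f y.
Proof. exact: big_cat. Qed.

Lemma ev_rcons f x l : ev f (rcons x l) = ev f x * l.2 (f l.1).
Proof. by rewrite -cats1 ev_cat ev_cons ev_nil mulr1. Qed.

Lemma ev_absorb f x b y : x ++ y <> [::] ->
  ev f (fabsorb x b y) = ev f x * j b * ev f y.
Proof.
case/lastP: x => [|x u].
  by case: y => [|u y] //= _; rewrite ev_nil mul1r !ev_cons mulrA.
by move=> _; rewrite absorb_rcons ev_cat ev_cons ev_rcons /fmr /= !mulrA.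
Qed.

Lemma wordF_absorb x b y : wordF (x ++ y) -> wordF (fabsorb x b y).
Proof.
by apply: all_absorb => l Fl; rewrite /= (ncps_ml sp) // (ncps_mr sp).
Qed.

Lemma E_ml b (z : A) : E (j b * z) = b * E z.
Proof. by have := ncps_bimod sp b z 1; rewrite rmorph1 !mulr1. Qed.

Lemma E_mr b (z : A) : E (z * j b) = E z * b.
Proof. by have := ncps_bimod sp 1 z b; rewrite rmorph1 !mul1r. Qed.

Lemma E_one : E 1 = 1. Proof. by rewrite -(rmorph1 j) (ncps_unit sp). Qed.

Lemma mean_ml b c : mean (fml b c) = b * mean c. Proof. exact: E_ml. Qed.
Lemma mean_mr b c : mean (fmr c b) = mean c * b. Proof. exact: E_mr. Qed.

Definition label_count f (L : nat) w : nat := count (fun l => f l.1 == L) w.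
Definition label_centered f (L : nat) w : bool :=
  all (fun l => (f l.1 == L) ==> (mean l.2 == 0)) w.

Lemma label_count_absorb f L x b y : label_count f L (fabsorb x b y) = label_count f L (x ++ y).
Proof.
rewrite /label_count -!(count_map fst (fun t => f t == L)).
by rewrite absorb_labels.
Qed.

Lemma label_centered_absorb f L x b y : label_centered f L (x ++ y) ->
  label_centered f L (fabsorb x b y).
Proof.
apply: all_absorb => l /implyP cl; rewrite /= mean_ml mean_mr.
by apply/andP; split; apply/implyP => /cl/eqP->; rewrite ?mul0r ?mulr0.
Qed.

Lemma label_centered0 f L w : label_count f L w = 0%N -> label_centered f L w.
Proof.
by elim: w => //= l w IH; case: eqP => // _ /IH.
Qed.

Definition same_kernel f g := forall t t', (f t == f t') = (g t == g t').
Definition same_order f g := forall t t', (f t < f t')%N = (g t < g t')%N.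

Lemma same_order_kernel f g : same_order f g -> same_kernel f g.
Proof.
move=> fg t u; have := fg t u; have := fg u t.
by case: (ltngtP (f t)) => _; case: (ltngtP (g t)).
Qed.

(** For [same_order] this is spreadability. For [same_kernel], where only equalities among labels
    count, it is the stronger invariance that the free and Boolean cases satisfy. *)
Definition spreads_from (rel : (T -> nat) -> (T -> nat) -> Prop) : Prop :=
  forall f g w, rel f g -> wordF w -> E (ev f w) = E (ev g w).

Definition singletons_vanish : Prop :=
  forall f L w, wordF w -> label_count f L w = 1%N -> label_centered f L w -> E (ev f w) = 0.

(** * Free words: centering and merging *)

Section Free.

Definition free_words : Prop := forall f w, w <> [::] -> wordF w ->
  centered w -> altern f w -> E (ev f w) = 0.

Hypothesis Fsub : forall c b, F c -> F (fun i => c i - j b).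
Hypothesis free : free_words.

Definition center (c : nat -> A) : nat -> A := fun i => c i - j (mean c).

Lemma mean_center c : mean (center c) = 0.
Proof. by rewrite /mean /center raddfB /= (ncps_unit sp) subrr. Qed.

Lemma ev_center f x t c y :
  ev f (x ++ (t, c) :: y) =
  ev f (x ++ (t, center c) :: y) + ev f x * j (mean c) * ev f y.
Proof.
rewrite !ev_cat !ev_cons /= /center mulrBl mulrBr !mulrA.
by rewrite -addrA [- _ + _]addrC subrr addr0.
Qed.

Lemma not_altern f w : ~~ altern f w ->
  exists x t c t' d y, w = x ++ (t, c) :: (t', d) :: y /\ f t = f t'.
Proof.
elim: w => [//|[t c] [//|[t' d] y] IH] /=; rewrite negb_and negbK.
move=> /orP[/eqP ft|/IH [x [s [c' [s' [d' [y' [-> fs]]]]]]]].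
  by exists [::], t, c, t', d, y.
by exists ((t, c) :: x), s, c', s', d', y'.
Qed.

(* Either two neighbours carry the same label and merge, or the word alternates
   and its letters are centered from left to right; each correction term
   c - center c is a scalar, hence leaves a shorter word. *)
Lemma free_ind f (P : word -> Prop) :
  P [::] ->
  (forall w, w <> [::] -> wordF w -> centered w -> altern f w -> P w) ->
  (forall x t c t' d y, f t = f t' -> P (x ++ (t, fun i => c i * d i) :: y) ->
     P (x ++ (t, c) :: (t', d) :: y)) ->
  (forall x t c y, F c -> x ++ y <> [::] -> P (x ++ (t, center c) :: y) ->
     P (fabsorb x (mean c) y) -> P (x ++ (t, c) :: y)) ->
  (forall t c, F c -> P [:: (t, c)]) ->
  forall w, wordF w -> P w.
Proof.
move=> P0 Palt Pmerge Pcenter Pone w; have [n] := ubnP (size w).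
elim: n w => // n IH w; rewrite ltnS => wn Fw.
have [alt|/not_altern[x [t [c [t' [d [y [E1 ft]]]]]]]] := boolP (altern f w);
    last first.
  rewrite E1; apply: Pmerge => //; apply: IH; last first.
    move: Fw; rewrite E1 /wordF !all_cat /= => /and4P[-> Fc Fd ->].
    by rewrite (ncps_mul sp).
  by apply: leq_trans wn; rewrite E1 !size_cat /= !addnS.
(* The prefix [x] is already centered and [y] is still to be treated. Centering a letter keeps the
   size, so this inner induction on [y] sits inside the one on the size. *)
suff main y x : (size (x ++ y) <= n)%N -> wordF (x ++ y) -> altern f (x ++ y) ->
    centered x -> P (x ++ y) by exact: (main w [::]).
elim: y x => [|[t c] y IHy] x xyn Fxy alxy cx.
  rewrite cats0 in xyn Fxy alxy *.
  by case: x xyn Fxy alxy cx => // l x *; apply: Palt.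
have [xy0|xy0] : x ++ y = [::] \/ x ++ y <> [::] by case: (x ++ y); [left|right].
  case: x y xy0 {IHy xyn alxy cx} Fxy => [|//] [|//] _ /=.
  by rewrite andbT; exact: Pone.
have Fc : F c by move: Fxy; rewrite /wordF all_cat /= => /and3P[].
have Fxy' : wordF (x ++ y).
  by move: Fxy; rewrite /wordF !all_cat /= => /and3P[-> _ ->].
apply: Pcenter => //.
  rewrite -cat_rcons; apply: IHy; rewrite ?cat_rcons.
  - by move: xyn; rewrite !size_cat.
  - by move: Fxy; rewrite /wordF !all_cat /= => /and3P[-> _ ->]; rewrite Fsub.
  - move: alxy; rewrite /altern.
    by case: (x) => [|l x'] /=; rewrite ?cat_path /=; case: (y).
  - by rewrite /centered all_rcons /= mean_center eqxx.
apply: IH; last exact: wordF_absorb.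
by rewrite size_absorb; move: xyn; rewrite !size_cat /= addnS.
Qed.

(** The reduction of [free_ind] tests labels only for equality, so it runs identically for [f] and
    [g]. It ends in words that vanish under both or in single letters, whose mean is
    label-independent. *)
Lemma free_spread : spreads_from same_kernel.
Proof.
move=> f g w fg; move: w; apply: (@free_ind f) => [|w w0 Fw cw al|||].
- by rewrite !ev_nil.
- rewrite (free w0 Fw cw al) free //.
  by move: al; rewrite /altern; apply: sub_sorted => l l'; rewrite fg.
- move=> x t c t' d y /eqP ft; move: (ft); rewrite fg => /eqP gt.
  rewrite !ev_cat !ev_cons /= -!mulrA.
  by rewrite -(eqP ft) -gt.
- move=> x t c y Fc xy0 IH1 IH2; rewrite (ev_center f x t c) (ev_center g x t c) !raddfD /= IH1.
  by congr (_ + _); move: IH2; rewrite !ev_absorb.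
- by move=> t c Fc; rewrite !ev_cons !ev_nil /= !mulr1 (ncps_id sp (f t) Fc) (ncps_id sp (g t) Fc).
Qed.

(** The lonely letter is never merged, since two neighbours labelled [L] would count twice, and its
    own centering correction has the factor zero. *)
Lemma free_singleton : singletons_vanish.
Proof.
move=> f L; apply: (@free_ind f) => //.
- by move=> w w0 Fw cw al *; exact: free al.
- move=> x t c t' d y ft; rewrite /label_count /label_centered !count_cat !all_cat /= -ft.
  rewrite !ev_cat !ev_cons /= -ft -!mulrA.
  have [tL|tL] //= := eqVneq (f t) L.
  by move=> _ /eqP; rewrite addnCA !addSn eqSS addnS.
- move=> x t c y Fc xy0 IH1 IH2 lw cw; rewrite ev_center raddfD /= IH1 ?add0r.
  + have [tL|tL] := eqVneq (f t) L.
      move: cw; rewrite /label_centered all_cat /= tL eqxx /= => /and3P[_ /eqP -> _].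
      by rewrite raddf0 mulr0 mul0r raddf0.
    rewrite -ev_absorb //; apply: IH2.
      by rewrite label_count_absorb -lw /label_count !count_cat /= (negPf tL).
    apply: label_centered_absorb; move: cw.
    by rewrite /label_centered !all_cat /= => /and3P[-> _ ->].
  + by rewrite -lw /label_count !count_cat.
  + move: cw; rewrite /label_centered !all_cat /= mean_center eqxx implybT.
    by case/and3P=> -> _ ->.
- move=> t c Fc; rewrite /label_count /label_centered /= ev_cons ev_nil mulr1 /=.
  by case: eqP => //= _ _ /andP[/eqP c0 _]; rewrite (ncps_id sp).
Qed.

(** Merge the two letters and center the product: the centered part is the only letter with its
    label, so it contributes zero and the scalar part remains. *)
Lemma free_pair f x t c t' d y : wordF (x ++ (t, c) :: (t', d) :: y) ->
  f t = f t' -> all (fun l => f l.1 != f t) (x ++ y) ->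
  E (ev f (x ++ (t, c) :: (t', d) :: y)) =
  E (ev f x * j (mean (fun i => c i * d i)) * ev f y).
Proof.
move=> Fw ft xyt; pose cd i := c i * d i.
have -> : ev f (x ++ (t, c) :: (t', d) :: y) = ev f (x ++ (t, cd) :: y).
  by rewrite !ev_cat !ev_cons /= /cd -!mulrA ft.
move: xyt; rewrite all_cat !all_predC !has_count -!leqNgt !leqn0.
move=> /andP[/eqP xt /eqP yt].
rewrite ev_center raddfD /= (@free_singleton f (f t)) ?add0r //.
- move: Fw; rewrite /wordF !all_cat /= => /and4P[-> Fc Fd ->].
  by rewrite Fsub // (ncps_mul sp).
- by rewrite /label_count count_cat /= xt yt eqxx.
- by rewrite /label_centered all_cat /= mean_center !eqxx /=
    -!/(label_centered _ _ _) !label_centered0.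
Qed.

End Free.

(** * Boolean words: splitting at a change of label *)

Section Boolean.

Definition boolean_words : Prop := forall f w, w <> [::] -> wordF w ->
  altern f w -> E (ev f w) = \prod_(l <- w) mean l.2.

Hypothesis hbool : boolean_words.

Lemma alternate f l w : wordF (l :: w) -> exists l' w',
  [/\ wordF (l' :: w'), altern f (l' :: w'), f l'.1 = f l.1,
      f (last l' w').1 = f (last l w).1 & ev f (l' :: w') = ev f (l :: w)].
Proof.
elim: w l => [|m w IH] [t c] Fw; first by exists (t, c), [::].
have /IH[[t' c'] [w' [Fw' al ft' lastw evw]]] : wordF (m :: w) by case/andP: Fw.
have [ft|ft] := eqVneq (f t) (f m.1).
  exists (t, fun i => c i * c' i), w'; split=> //.
  - move: Fw Fw' => /= /andP[Fc _] /andP[Fc' ->].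
    by rewrite (ncps_mul sp).
  - by move: al; case: (w') => //= u w'' ; rewrite ft' ft.
  - rewrite /= in lastw *; rewrite -lastw; case: (w') => //=.
    by rewrite ft ft'.
  - rewrite [RHS]ev_cons -evw !ev_cons /= mulrA.
    by rewrite ft' ft.
exists (t, c), ((t', c') :: w'); split=> //.
- by move: Fw => /= /andP[->].
- by rewrite /altern /= ft' ft.
- by rewrite [LHS]ev_cons evw -ev_cons.
Qed.

(** Made alternating separately, the two halves remain alternating when joined, because the labels
    at the seam differ; the product of means then factors. *)
Lemma boolean_split_core f x l m y : wordF (rcons x l ++ m :: y) ->
  f l.1 != f m.1 ->
  E (ev f (rcons x l ++ m :: y)) = E (ev f (rcons x l)) * E (ev f (m :: y)).
Proof.
have [u [x' xE]] : exists u x', rcons x l = u :: x'.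
  by case: x => [|u x]; [exists l, [::] | exists u, (rcons x l)].
rewrite /wordF all_cat => /andP[Fx Fy] lm.
have ll : last u x' = l by rewrite -[RHS](last_rcons u x) xE.
rewrite xE in Fx *.
have [u1 [x1 [Fx1 al1 _ last1 ev1]]] := alternate f Fx.
have [m1 [y1 [Fy1 al2 fm _ ev2]]] := alternate f Fy.
have al12 : altern f ((u1 :: x1) ++ m1 :: y1).
  rewrite /altern /= cat_path; move: al1 al2; rewrite /altern /= => -> -> /=.
  by rewrite last1 fm ll lm.
have Fw12 : wordF ((u1 :: x1) ++ m1 :: y1) by rewrite /wordF all_cat -!/(wordF _) Fx1 Fy1.
by rewrite ev_cat -ev1 -ev2 -ev_cat !(@hbool f) // big_cat.
Qed.

Lemma boolean_splitl f x l y : wordF (x ++ l :: y) ->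
  all (fun m => f m.1 != f l.1) x ->
  E (ev f (x ++ l :: y)) = E (ev f x) * E (ev f (l :: y)).
Proof.
case/lastP: x => [|x m] Fw; first by rewrite ev_nil E_one mul1r.
by rewrite all_rcons /= => /andP[ml _]; exact: boolean_split_core.
Qed.

Lemma boolean_splitr f x l y : wordF (rcons x l ++ y) ->
  all (fun m => f m.1 != f l.1) y ->
  E (ev f (rcons x l ++ y)) = E (ev f (rcons x l)) * E (ev f y).
Proof.
case: y => [|m y] Fw; first by rewrite cats0 ev_nil E_one mulr1.
by move=> /= /andP[ml _]; apply: boolean_split_core; rewrite // eq_sym.
Qed.

Lemma boolean_spread : spreads_from same_kernel.
Proof.
move=> f g w fg; have [n] := ubnP (size w).
elim: n w => // n IH [|[t c] [|[t' d] y]] /=; rewrite ?ltnS => wn Fw.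
- by rewrite !ev_nil.
- move: Fw; rewrite !ev_cons !ev_nil !mulr1 /= andbT => Fc.
  by rewrite (ncps_id sp (f t) Fc) (ncps_id sp (g t) Fc).
have [ft|ft] := eqVneq (f t) (f t').
  have gt : g t = g t' by apply/eqP; rewrite -fg ft.
  have Fcd : wordF ((t, fun i => c i * d i) :: y).
    by move: Fw => /= /and3P[Fc Fd ->]; rewrite (ncps_mul sp).
  have := IH ((t, fun i => c i * d i) :: y) wn Fcd.
  by rewrite !ev_cons /= ft gt !mulrA.
have split h : h t != h t' -> E (ev h [:: (t, c), (t', d) & y]) =
    E (c (h t)) * E (ev h ((t', d) :: y)).
  move=> ht.
  have := @boolean_split_core h [::] (t, c) (t', d) y Fw ht.
  by rewrite /= (ev_cons h (t, c) [::]) ev_nil mulr1.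
have gt : g t != g t' by rewrite -fg.
move: (Fw) => /= /andP[Fc Fy].
by rewrite !split // (ncps_id sp (f t) Fc) (ncps_id sp (g t) Fc) IH.
Qed.

(** The letter labelled [L] has no neighbour with that label, so the word splits on both of its
    sides and its mean, zero, is a factor. *)
Lemma boolean_singleton : singletons_vanish.
Proof.
move=> f L w Fw lw cw.
have : has (fun l => f l.1 == L) w by rewrite has_count -/(label_count f L w) lw.
move=> hs; case: (split_find hs) Fw lw cw => -[t c] x y /= /eqP tL xL Fw lw cw.
have yL : all (fun m => f m.1 != f t) y.
  rewrite all_predC has_count tL -leqNgt leqn0.
  move: lw; rewrite /label_count count_cat -cats1 count_cat /= tL eqxx.
  by rewrite addn0 addnAC addn1 => -[/eqP]; rewrite addn_eq0 => /andP[_].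
rewrite boolean_splitr // -cats1 boolean_splitl ?all_predC ?tL //.
  move: cw; rewrite /label_centered !all_cat all_rcons /= tL eqxx => /andP[/andP[/eqP c0 _] _].
  rewrite (ev_cons f (t, c)) ev_nil mulr1 /= (ncps_id sp) ?c0 ?mulr0 ?mul0r //.
  by move: Fw; rewrite /wordF all_cat all_rcons => /andP[/andP[]].
by move: Fw; rewrite /wordF !all_cat all_rcons /= => /andP[/andP[-> ->] _].
Qed.

End Boolean.

(** * Monotone words: peaks *)

Section Monotone.

Definition peak f x l y : Prop :=
  (forall x' u, x = rcons x' u -> (f u.1 < f l.1)%N) /\
  (forall u y', y = u :: y' -> (f u.1 < f l.1)%N).

Definition monotone_words : Prop := forall f x l y, wordF (x ++ l :: y) ->
  peak f x l y -> E (ev f (x ++ l :: y)) = E (ev f x * j (mean l.2) * ev f y).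

Hypothesis mono : monotone_words.

(** A peak of the tail stays a peak unless it is the first letter of the tail. In that case the new
    letter is compared with it: if smaller, the old peak survives; if larger, the new letter is a
    peak; otherwise two neighbours agree. *)
Lemma exists_peak f l w :
  (exists x t c t' d y, l :: w = x ++ (t, c) :: (t', d) :: y /\ f t = f t') \/
  (exists x m y, l :: w = x ++ m :: y /\ peak f x m y).
Proof.
elim: w l => [|[t' d] w IH] [t c].
  by right; exists [::], (t, c), [::]; split=> //; split=> // -[].
have [[x [s [e [s' [e' [y [-> fs]]]]]]]|[[|u x] [m [y [wE [pl pr]]]]]] := IH (t', d).
- by left; exists ((t, c) :: x), s, e, s', e', y.
- case: wE => mE yE; rewrite -{}mE -{}yE in pl pr *.
  have [ft|ft|ft] := ltngtP (f t) (f t').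
  + right; exists [:: (t, c)], (t', d), w; split=> //; split=> // x' u.
    by case: x' => [|? [|? ?]] //= [<-].
  + right; exists [::], (t, c), ((t', d) :: w); split=> //; split=> [[]//|].
    by move=> u y' [<- _].
  + by left; exists [::], t, c, t', d, w.
- right; exists ((t, c) :: u :: x), m, y; split; first by rewrite wE.
  split=> // x' v; case: x' => [//|v' x'] [_ xE].
  exact: (pl x').
Qed.

(** The monotone rule replaces a peak by its mean whether or not it is centered, so every step
    shortens the word and the size is a sufficient measure. *)
Lemma mono_ind f (P : word -> Prop) :
  P [::] ->
  (forall x t c t' d y, f t = f t' -> P (x ++ (t, fun i => c i * d i) :: y) ->
     P (x ++ (t, c) :: (t', d) :: y)) ->
  (forall x l y, wordF (x ++ l :: y) -> peak f x l y -> x ++ y <> [::] ->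
     P (fabsorb x (mean l.2) y) -> P (x ++ l :: y)) ->
  (forall l, F l.2 -> P [:: l]) ->
  forall w, wordF w -> P w.
Proof.
move=> P0 Pmerge Ppeak Pone w; have [n] := ubnP (size w).
elim: n w => // n IH [//|l w]; rewrite ltnS => wn Fw.
case: (exists_peak f l w) => [[x [t [c [t' [d [y [wE ft]]]]]]]|[x [m [y [wE pk]]]]].
  rewrite wE; apply: Pmerge => //; apply: IH.
    by apply: leq_trans wn; rewrite wE !size_cat /= !addnS.
  move: Fw; rewrite wE /wordF !all_cat /= => /and4P[-> Fc Fd ->].
  by rewrite (ncps_mul sp).
rewrite wE in wn Fw *.
have [xy0|xy0] : x ++ y = [::] \/ x ++ y <> [::] by case: (x ++ y); [left|right].
  case: x y xy0 {wn pk wE} Fw => [|//] [|//] _ /=.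
  by rewrite andbT; exact: Pone.
apply: Ppeak => //; apply: IH.
  by rewrite size_absorb; move: wn; rewrite !size_cat /= addnS.
apply: wordF_absorb; move: Fw.
by rewrite /wordF !all_cat /= => /and3P[-> _ ->].
Qed.

(** Being a peak depends on strict inequalities between labels, so invariance is obtained for
    [same_order] only. *)
Lemma mono_spread : spreads_from same_order.
Proof.
move=> f g w fg; move: w; apply: (@mono_ind f) => [|||].
- by rewrite !ev_nil.
- move=> x t c t' d y ft; have gt : g t = g t'.
    by move: (fg t t') (fg t' t); rewrite ft ltnn; case: ltngtP.
  by rewrite !ev_cat !ev_cons /= -!mulrA ft gt.
- move=> x l y Fw pk xy0; rewrite (ev_absorb f) // (ev_absorb g) // => IH.
  have pk' : peak g x l y.
    case: pk => pl pr; split=> [x' u xE|u y' yE]; first by rewrite -fg; exact: pl xE.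
    by rewrite -fg; exact: pr yE.
  by rewrite (mono Fw pk) (mono Fw pk').
- move=> [t c] /= Fc; rewrite !ev_cons !ev_nil !mulr1.
  by rewrite /= (ncps_id sp (f t) Fc) (ncps_id sp (g t) Fc).
Qed.

Lemma mono_singleton : singletons_vanish.
Proof.
move=> f L; apply: (@mono_ind f) => //.
- move=> x t c t' d y ft; rewrite /label_count /label_centered !count_cat !all_cat /= -ft.
  rewrite !ev_cat !ev_cons /= -ft -!mulrA.
  have [tL|tL] //= := eqVneq (f t) L.
  by move=> _ /eqP; rewrite addnCA !addSn eqSS addnS.
- move=> x [t c] y Fw pk xy0; rewrite mono //= -ev_absorb // => IH lw cw.
  have [tL|tL] := eqVneq (f t) L.
    move: cw; rewrite /label_centered all_cat /= tL eqxx /= => /and3P[_ /eqP -> _].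
    by rewrite ev_absorb // raddf0 mulr0 mul0r raddf0.
  apply: IH; first by rewrite label_count_absorb -lw /label_count !count_cat /= (negPf tL).
  apply: label_centered_absorb; move: cw.
  by rewrite /label_centered !all_cat /= => /and3P[-> _ ->].
- move=> [t c] Fc; rewrite /label_count /label_centered /= ev_cons ev_nil mulr1 /=.
  by case: eqP => //= _ _ /andP[/eqP c0 _]; rewrite (ncps_id sp).
Qed.

Lemma mono_pair f x t c t' d y : wordF (x ++ (t, c) :: (t', d) :: y) ->
  f t = f t' -> all (fun l => (f l.1 < f t)%N) (x ++ y) ->
  E (ev f (x ++ (t, c) :: (t', d) :: y)) =
  E (ev f x * j (mean (fun i => c i * d i)) * ev f y).
Proof.
move=> Fw ft; rewrite all_cat => /andP[xt yt].
have -> : ev f (x ++ (t, c) :: (t', d) :: y) =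
    ev f (x ++ (t, fun i => c i * d i) :: y).
  by rewrite !ev_cat !ev_cons /= -!mulrA ft.
rewrite mono //.
  move: Fw; rewrite /wordF !all_cat /= => /and4P[-> Fc Fd ->].
  by rewrite (ncps_mul sp).
split=> [x' u xE|u y' yE] /=; first by move: xt; rewrite xE all_rcons => /andP[].
by move: yt; rewrite yE => /andP[].
Qed.

End Monotone.
End Words.

Lemma prod_subst (A : pzRingType) (L : Type) (G : L -> A) l0 (x : seq L) l y v :
  \prod_(k < size (x ++ l :: y))
    (if k == size x :> nat then v else G (nth l0 (x ++ l :: y) k)) =
  (\prod_(u <- x) G u) * v * \prod_(u <- y) G u.
Proof.
elim: x => [|u x IH] /=.
  by rewrite big_ord_recl /= big_nil mul1r (big_nth l0) big_mkord.
by rewrite big_ord_recl /= big_cons -!mulrA [_ * (v * _)]mulrA -IH.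
Qed.

(** [P] and [Q] are fixed before [H]: products that differ only in factor [m] can thus be added and
    compared as [P * _ * Q]. *)
Lemma prod_ord_subst (A : pzRingType) n (m : 'I_n) (G : 'I_n -> A) :
  exists P Q, forall H : 'I_n -> A,
    \prod_l (if l == m then H l else G l) = P * H m * Q.
Proof.
pose e := enum 'I_n.
exists (\prod_(l <- take m e) G l), (\prod_(l <- drop m.+1 e) G l) => H.
have eE : e = take m e ++ m :: drop m.+1 e.
  rewrite -[in LHS](cat_take_drop m e) (drop_nth m) ?size_enum_ord //.
  by rewrite nth_ord_enum.
have sm : size (take m e) = m by rewrite size_take size_enum_ord ltn_ord.
have := prod_subst G m (take m e) m (drop m.+1 e) (H m).
rewrite -eE size_enum_ord sm => <-; apply: eq_bigr => l _.
by rewrite nth_ord_enum -val_eqE; case: eqP => // /val_inj ->.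
Qed.

(** * Infinitesimal independence as independence over the dual numbers *)

Section DualSpace.
Variables (K : fieldType) (A B : algType K).
Variables (iota : {lrmorphism B -> A}) (E E' : {linear A -> B}).

Definition dual_incl (b : dual B) : dual A := (iota b.1, iota b.2).
Definition dual_E (x : dual A) : dual B := (E x.1, E x.2 + E' x.1).

Lemma dual_incl_zmod : zmod_morphism dual_incl.
Proof. by move=> b c; congr (_, _); rewrite raddfB. Qed.
HB.instance Definition _ :=
  GRing.isZmodMorphism.Build (dual B) (dual A) dual_incl dual_incl_zmod.

Lemma dual_incl_monoid : monoid_morphism dual_incl.
Proof.
split=> [|b c]; first by congr (_, _); rewrite ?rmorph1 ?raddf0.
by congr (_, _); rewrite ?rmorphD !rmorphM.
Qed.
HB.instance Definition _ :=
  GRing.isMonoidMorphism.Build (dual B) (dual A) dual_incl dual_incl_monoid.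

Lemma dual_E_zmod : zmod_morphism dual_E.
Proof.
move=> b c; congr (_, _); first exact: raddfB.
transitivity (E (b.2 - c.2) + E' (b.1 - c.1)) => //.
by rewrite !raddfB /= opprD addrACA.
Qed.
HB.instance Definition _ :=
  GRing.isZmodMorphism.Build (dual A) (dual B) dual_E dual_E_zmod.

Hypothesis sp : infinitesimal_prob_space iota E E'.

Lemma iEl b x : E (iota b * x) = b * E x.
Proof. by have := ips_bimod sp b x 1; rewrite rmorph1 !mulr1. Qed.
Lemma iEr b x : E (x * iota b) = E x * b.
Proof. by have := ips_bimod sp 1 x b; rewrite rmorph1 !mul1r. Qed.
Lemma iE'l b x : E' (iota b * x) = b * E' x.
Proof. by have := ips_bimod' sp b x 1; rewrite rmorph1 !mulr1. Qed.
Lemma iE'r b x : E' (x * iota b) = E' x * b.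
Proof. by have := ips_bimod' sp 1 x b; rewrite rmorph1 !mul1r. Qed.
Lemma iE'u b : E' (iota b) = 0.
Proof. by rewrite -[iota b]mulr1 iE'l (ips_unit' sp) mulr0. Qed.

Lemma dual_E_bimod b (x : dual A) b' :
  dual_E (dual_incl b * x * dual_incl b') = b * dual_E x * b'.
Proof.
congr (_, _) => /=; first by rewrite (ips_bimod sp).
rewrite mulrDl !raddfD /= !(ips_bimod sp) (ips_bimod' sp).
rewrite mulrDr !mulrDl -!addrA; do 2![congr (_ + _)]; exact: addrC.
Qed.

Lemma dual_E_unit b : dual_E (dual_incl b) = b.
Proof. by case: b => b b'; rewrite /dual_E /= !(ips_unit sp) iE'u addr0. Qed.

Variable S : nat -> set A.

Section Free.
Hypothesis Sadd : forall i x y, S i x -> S i y -> S i (x + y).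
Hypothesis SB : forall i b, S i (iota b).
Hypothesis free : infinitesimally_free iota E E' S.

(** If [(x, x')] has mean zero, then [E x = 0] while [E x' = - E' x], so [x' + iota (E' x)] is
    centered. The added scalar is the one that the rule for [E'] supplies; hence the eps part is a
    sum of moments of centered alternating words, each zero. *)
Lemma dual_free n (i : 'I_n.+1 -> nat) (c : 'I_n.+1 -> dual A) :
  alternating i -> (forall l, S (i l) (c l).1 /\ S (i l) (c l).2) ->
  (forall l, dual_E (c l) = 0) -> dual_E (\prod_l c l) = 0.
Proof.
move=> alt Sc Ec; rewrite dual_prod.
have Ec1 l : E (c l).1 = 0 by case: (Ec l).
have Ec2 l : E (c l).2 + E' (c l).1 = 0 by case: (Ec l).
have [E0 E'0] := free (c := fun l => (c l).1) alt (fun l => (Sc l).1) Ec1.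
congr (_, _) => //=; rewrite E'0 raddf_sum -big_split /= big1 // => m _.
rewrite -raddfD /=.
pose u := (c m).2 + iota (E' (c m).1).
have -> : \prod_l (if l == m then (c l).2 else (c l).1) +
    \prod_l subst_at (fun l => (c l).1) m (iota (E' (c m).1)) l =
    \prod_l subst_at (fun l => (c l).1) m u l.
  have [P [Q PQ]] := prod_ord_subst m (fun l => (c l).1).
  have /= e1 := PQ (fun l => (c l).2); have /= e2 := PQ (fun=> iota (E' (c m).1)).
  by rewrite /subst_at e1 e2 (PQ (fun=> u)) mulrDr mulrDl.
have Su l : S (i l) (subst_at (fun l => (c l).1) m u l).
  rewrite /subst_at; case: eqP => [->|_]; last exact: (Sc l).1.
  by apply: Sadd; [exact: (Sc m).2 | exact: SB].
have [|-> //] := free alt Su.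
move=> l; rewrite /subst_at; case: eqP => // _.
by rewrite raddfD /= (ips_unit sp).
Qed.
End Free.

Lemma dual_boolean n (i : 'I_n.+1 -> nat) (c : 'I_n.+1 -> dual A) :
  infinitesimally_boolean E E' S ->
  alternating i -> (forall l, S (i l) (c l).1 /\ S (i l) (c l).2) ->
  dual_E (\prod_l c l) = \prod_l dual_E (c l).
Proof.
move=> bool alt Sc; rewrite !dual_prod.
have [E0 E'0] := bool _ _ (fun l => (c l).1) alt (fun l => (Sc l).1).
congr (_, _) => //=; rewrite E'0 raddf_sum -big_split /=; apply: eq_bigr => m _.
have Sm l : S (i l) (if l == m then (c l).2 else (c l).1).
  by case: eqP => _; [exact: (Sc l).2 | exact: (Sc l).1].
have [-> _] := bool _ _ _ alt Sm.
have [P [Q PQ]] := prod_ord_subst m (fun l => E (c l).1).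
have /= e1 := PQ (fun l => E (c l).2 + E' (c l).1).
have /= e2 := PQ (fun l => E' (c l).1); have /= e3 := PQ (fun l => E (c l).2).
rewrite e1 e2.
have -> : \prod_l E (if l == m then (c l).2 else (c l).1) =
    \prod_l (if l == m then E (c l).2 else E (c l).1).
  by apply: eq_bigr => l _; case: ifP.
by rewrite e3 -mulrDl -mulrDr addrC.
Qed.

(** Where the eps part is taken away from the peak [m], the rule for [E] applies to the word with
    that one letter changed. Where it is taken at [m], the term joins the [E'] correction to form
    the eps part of [dual_E (c m)]. *)
Lemma dual_monotone n (i : 'I_n.+1 -> nat) (c : 'I_n.+1 -> dual A) m :
  infinitesimally_monotone iota E E' S ->
  is_peak i m -> (forall l, S (i l) (c l).1 /\ S (i l) (c l).2) ->
  dual_E (\prod_l c l) =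
  dual_E (\prod_l (if l == m then dual_incl (dual_E (c m)) else c l)).
Proof.
move=> mono pk Sc; rewrite !dual_prod.
pose d l := if l == m then dual_incl (dual_E (c m)) else c l.
pose D k l := if l == k then (c l).2 else (c l).1.
have d1 : (fun l => (d l).1) = subst_at (fun l => (c l).1) m (iota (E (c m).1)).
  by apply: funext => l; rewrite /d /subst_at; case: ifP.
have [E0 E'0] := mono _ i (fun l => (c l).1) m (fun l => (Sc l).1) pk.
congr (_, _) => /=; first by rewrite E0 -d1.
rewrite E'0 -d1 addrA; congr (_ + _); rewrite !raddf_sum (bigD1 m) //= [RHS](bigD1 m) //=.
have mD k : E (\prod_l D k l) = E (\prod_l subst_at (D k) m (iota (E (D k m))) l).
  have Sk l : S (i l) (D k l).
    by rewrite /D; case: eqP => _; [exact: (Sc l).2 | exact: (Sc l).1].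
  by have [] := mono _ i (D k) m Sk pk.
rewrite addrAC; congr (_ + _).
  rewrite -/(D m) mD -raddfD /=; congr (E _).
  have [P [Q PQ]] := prod_ord_subst m (fun l => (c l).1).
  have -> : \prod_l subst_at (D m) m (iota (E (D m m))) l =
      \prod_l (if l == m then iota (E (c m).2) else (c l).1).
    by apply: eq_bigr => l _; rewrite /subst_at /D eqxx; case: eqP.
  have -> : \prod_l (if l == m then (d l).2 else (d l).1) =
      \prod_l (if l == m then iota (E (c m).2 + E' (c m).1) else (c l).1).
    by apply: eq_bigr => l _; rewrite /d; case: eqP.
  rewrite /subst_at (PQ (fun=> iota (E (c m).2))) (PQ (fun=> iota (E' (c m).1))).
  by rewrite (PQ (fun=> iota (E (c m).2 + E' (c m).1))) raddfD mulrDr mulrDl.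
apply: eq_bigr => k km; rewrite -/(D k) mD; congr (E _); apply: eq_bigr => l _.
rewrite /subst_at /D /d; have [->|lm] := eqVneq l m; last by [].
by rewrite eq_sym (negPf km).
Qed.

End DualSpace.

(** * Families of polynomials in the [a i] *)

Section Families.
Variables (K : fieldType) (A B : algType K).
Variables (iota : {lrmorphism B -> A}) (E E' : {linear A -> B}).
Variables (a : nat -> A) (S : nat -> set A).

Hypothesis sp : infinitesimal_prob_space iota E E'.
Hypothesis id_distr : identically_distributed iota E E' a.

Lemma sandwich_mulw (x : A) (u v : B * seq B) :
  sandwich iota x (mulw u v).1 (mulw u v).2 =
  sandwich iota x u.1 u.2 * sandwich iota x v.1 v.2.
Proof.
case: u v => b s [b' s']; rewrite /mulw /=; elim: s b => [|c s IH] b /=.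
  by rewrite /sandwich /= big_nil mulr1 rmorphM mulrA.
rewrite /sandwich /= !big_cons -!mulrA; congr (_ * (_ * _)).
have := IH c; rewrite /sandwich -!mulrA => <-.
by [].
Qed.

(* Families i |-> c i given by one noncommutative polynomial in a i: their
   moments do not depend on i because the a i are identically distributed. *)
Definition represents (P : seq (B * seq B)) (c : nat -> A) : Prop :=
  forall i, c i = \sum_(p <- P) sandwich iota (a i) p.1 p.2.

(** The outer coefficients leave by the bimodule property; what remains begins and ends with [a i],
    the shape covered by [id_distr]. *)
Lemma sandwich_moment i k b bs :
  E (sandwich iota (a i) b bs) = E (sandwich iota (a k) b bs) /\
  E' (sandwich iota (a i) b bs) = E' (sandwich iota (a k) b bs).
Proof.
case/lastP: bs => [|bs b'].
  by rewrite /sandwich !big_nil !mulr1.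
have shape x : sandwich iota x b (rcons bs b') =
    iota b * (x * \prod_(c <- bs) (iota c * x)) * iota b'.
  rewrite /sandwich -!mulrA; congr (_ * _).
  elim: bs => [|c bs IH]; first by rewrite /= big_seq1 big_nil mul1r.
  by rewrite rcons_cons !big_cons IH -!mulrA.
have [Ei E'i] := id_distr i k bs.
by rewrite !shape !(ips_bimod sp) !(ips_bimod' sp) Ei E'i.
Qed.

Lemma represents_moment P c i k : represents P c ->
  E (c i) = E (c k) /\ E' (c i) = E' (c k).
Proof.
move=> rep; rewrite !rep !raddf_sum.
by split; apply: eq_bigr => p _; have [] := sandwich_moment i k p.1 p.2.
Qed.

Lemma represents_add P Q c d : represents P c -> represents Q d ->
  represents (P ++ Q) (fun i => c i + d i).
Proof. by move=> rc rd i; rewrite big_cat -rc -rd. Qed.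

Lemma represents_mul P Q c d : represents P c -> represents Q d ->
  represents [seq mulw p q | p <- P, q <- Q] (fun i => c i * d i).
Proof.
move=> rc rd i; rewrite big_allpairs_dep rc rd mulr_suml; apply: eq_bigr => p _.
by rewrite mulr_sumr; apply: eq_bigr => q _; rewrite sandwich_mulw.
Qed.

Lemma represents_const b : represents [:: (b, [::])] (fun=> iota b).
Proof. by move=> i; rewrite big_seq1 /sandwich big_nil mulr1. Qed.

Lemma represents_gen : represents [:: (1, [:: 1])] a.
Proof. by move=> i; rewrite big_seq1 /sandwich big_seq1 rmorph1 mul1r mulr1. Qed.

(** The closure properties common to [alg_gen] and [nonunital_alg_gen], so that one argument serves
    both. *)
Record algebra_family : Prop := AlgebraFamily {
  af_gen : forall i, S i (a i);
  af_add : forall i x y, S i x -> S i y -> S i (x + y);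
  af_mul : forall i x y, S i x -> S i y -> S i (x * y);
  af_bim : forall i b x b', S i x -> S i (iota b * x * iota b') }.
Hypothesis fam : algebra_family.

Definition family (c : nat -> A) : bool :=
  `[< (exists P, represents P c) /\ forall i, S i (c i) >].

Definition dual_family (c : nat -> dual A) : bool :=
  family (fun i => (c i).1) && family (fun i => (c i).2).

Lemma familyP c : reflect ((exists P, represents P c) /\ forall i, S i (c i))
  (family c).
Proof. exact: asboolP. Qed.

Lemma family_add c d : family c -> family d -> family (fun i => c i + d i).
Proof.
move=> /familyP[[P rc] Sc] /familyP[[Q rd] Sd]; apply/familyP; split.
  by exists (P ++ Q); exact: represents_add.
by move=> i; exact: (af_add fam).
Qed.

Lemma family_mul c d : family c -> family d -> family (fun i => c i * d i).
Proof.
move=> /familyP[[P rc] Sc] /familyP[[Q rd] Sd]; apply/familyP; split.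
  by exists [seq mulw p q | p <- P, q <- Q]; exact: represents_mul.
by move=> i; exact: (af_mul fam).
Qed.

Lemma family_bim b c b' : family c -> family (fun i => iota b * c i * iota b').
Proof.
move=> /familyP[[P rc] Sc]; apply/familyP; split; last first.
  by move=> i; exact: (af_bim fam).
have := represents_mul (represents_mul (represents_const b) rc)
  (represents_const b').
by eexists; eassumption.
Qed.

Lemma family_ml b c : family c -> family (fun i => iota b * c i).
Proof.
move=> /(family_bim b 1); congr family; apply: funext => i.
by rewrite rmorph1 mulr1.
Qed.

Lemma family_mr b c : family c -> family (fun i => c i * iota b).
Proof.
move=> /(family_bim 1 b); congr family; apply: funext => i.
by rewrite rmorph1 mul1r.
Qed.

Lemma family_gen : family a.
Proof.
apply/familyP; split; last exact: af_gen fam.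
by eexists; exact: represents_gen.
Qed.

Lemma family_moment c i k : family c ->
  E (c i) = E (c k) /\ E' (c i) = E' (c k).
Proof. by move=> /familyP[[P rc] _]; exact: represents_moment rc. Qed.

Local Notation jt := (dual_incl iota).
Local Notation Et := (dual_E E E').

Lemma dual_ncps : ncps jt Et dual_family.
Proof.
split=> [b x b'|b|c i|c d|b c|b c].
- exact: dual_E_bimod.
- exact: dual_E_unit.
- move=> /andP[F1 F2];
  have [e1 e2] := family_moment i 0 F1; have [e3 _] := family_moment i 0 F2.
  by congr (_, _ + _).
- move=> /andP[c1 c2] /andP[d1 d2]; rewrite /dual_family /= family_mul //=.
  by apply: family_add; exact: family_mul.
- move=> /andP[c1 c2]; rewrite /dual_family /= family_ml //=.
  by apply: family_add; exact: family_ml.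
- move=> /andP[c1 c2]; rewrite /dual_family /= family_mr //=.
  by apply: family_add; exact: family_mr.
Qed.

Section OnWords.
Variable T : Type.

Lemma dual_family_S (c : nat -> dual A) i : dual_family c ->
  S i (c i).1 /\ S i (c i).2.
Proof. by move=> /andP[/familyP[_ S1] /familyP[_ S2]]. Qed.

Lemma all_tnth_word (p : pred (T * (nat -> dual A))) w (l : 'I_(size w)) :
  all p w -> p (tnth (in_tuple w) l).
Proof.
case: w l => [[]//|l0 w] l; rewrite (tnth_nth l0) => /(all_nthP l0); exact.
Qed.

Lemma tnth_dual_family (w : seq (T * (nat -> dual A))) (l : 'I_(size w)) : wordF dual_family w ->
  dual_family (tnth (in_tuple w) l).2.
Proof. exact: (@all_tnth_word (fun l : T * (nat -> dual A) => dual_family l.2)). Qed.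

Lemma tnth_dual_S (w : seq (T * (nat -> dual A))) (l : 'I_(size w)) i : wordF dual_family w ->
  S i ((tnth (in_tuple w) l).2 i).1 /\ S i ((tnth (in_tuple w) l).2 i).2.
Proof. by move=> /(tnth_dual_family l); exact: dual_family_S. Qed.

Lemma altern_tnth (f : T -> nat) (w : seq (T * (nat -> dual A))) : altern f w ->
  alternating (fun l => f (tnth (in_tuple w) l).1).
Proof.
case: w => [|l0 w] al l m ml; first by case: l ml.
rewrite !(tnth_nth l0) ml; apply/eqP.
by move/(sortedP l0): al; apply; rewrite -ml.
Qed.

Lemma free_dual_words : (forall i b, S i (iota b)) ->
  infinitesimally_free iota E E' S ->
  free_words Et dual_family T.
Proof.
move=> SB free f [//|l0 w] _ Fw cw al; rewrite /ev big_tnth.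
apply: (dual_free sp (af_add fam) SB free (altern_tnth al)) => l.
  exact: tnth_dual_S.
rewrite (ncps_id dual_ncps); last exact: tnth_dual_family.
by apply/eqP; exact: (@all_tnth_word (fun l : T * (nat -> dual A) => mean Et l.2 == 0)).
Qed.

Lemma boolean_dual_words : infinitesimally_boolean E E' S ->
  boolean_words Et dual_family T.
Proof.
move=> bool f [//|l0 w] _ Fw al; rewrite /ev big_tnth [RHS]big_tnth.
apply: etrans (dual_boolean bool (altern_tnth al) _) _ => [l|].
  exact: tnth_dual_S.
by apply: eq_bigr => l _; rewrite (ncps_id dual_ncps) //; exact: tnth_dual_family.
Qed.

Lemma monotone_dual_words : infinitesimally_monotone iota E E' S ->
  monotone_words jt Et dual_family T.
Proof.
move=> mono f x l y Fw [pl pr].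
(* The independence hypothesis is indexed by ['I_n.+1]. Stating the step for an arbitrary word [u]
   allows [u] to be destructed as a nonempty list. *)
have peakE u (m : 'I_(size u)) (c := fun k => tnth (in_tuple u) k) :
    wordF dual_family u -> is_peak (fun k => f (c k).1) m ->
    Et (ev f u) = Et (\prod_k (if k == m then jt (Et ((c m).2 (f (c m).1)))
                               else (c k).2 (f (c k).1))).
  case: u m @c => [[]//|l0 u] m c Fu pk; rewrite /ev big_tnth.
  apply: (dual_monotone mono pk) => k.
  exact: tnth_dual_S.
have left n : n.+1 = size x -> (f (nth l (x ++ l :: y) n).1 < f l.1)%N.
  case/lastP: x pl {Fw pr} => [//|x u] pl; rewrite size_rcons => -[->].
  by rewrite cat_rcons nth_cat ltnn subnn /=; exact: pl.
have right n : n = (size x).+1 -> (n < size (x ++ l :: y))%N ->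
    (f (nth l (x ++ l :: y) n).1 < f l.1)%N.
  move=> ->; rewrite size_cat => sz.
  rewrite nth_cat [X in if X then _ else _]ltnNge leqnSn /= subSnn /=.
  by move: sz; case: y pr {Fw left} => [|u y] pr; [rewrite addn1 ltnn | move=> sz; exact: pr].
have xl : (size x < size (x ++ l :: y))%N by rewrite size_cat /= addnS ltnS leq_addr.
have nl : tnth (in_tuple (x ++ l :: y)) (Ordinal xl) = l.
  by rewrite (tnth_nth l) /= nth_cat ltnn subnn.
have pk : is_peak (fun k => f (tnth (in_tuple (x ++ l :: y)) k).1) (Ordinal xl).
  move=> k; rewrite nl (tnth_nth l) /= => -[kx|kx]; first exact: left.
  by apply: right => //; exact: ltn_ord.
apply: etrans (peakE _ (Ordinal xl) Fw pk) _; rewrite /= nl.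
rewrite (ncps_id dual_ncps); last by move: Fw; rewrite /wordF all_cat /= => /and3P[].
congr (Et _); rewrite /ev.
have := prod_subst (fun u => u.2 (f u.1)) l x l y (jt (mean Et l.2)).
by move=> <-; apply: eq_bigr => k _; rewrite (tnth_nth l) -val_eqE.
Qed.

End OnWords.
End Families.

(** * Partitioned maps *)

Section PartRec.
Variables (K : fieldType) (A B : algType K) (iota : {lrmorphism B -> A}).
Variables (k : nat) (pi : {set {set 'I_k}}).

Definition scale_left (b : B) (x : A) : A := iota b * x.
Definition scale_right (x : A) (b : B) : A := x * iota b.
Local Notation pword := (seq ('I_k * A)).
Local Notation pabsorb := (@absorb 'I_k A B scale_left scale_right).

Section Phi.
Variable phi : {set 'I_k} -> {linear A -> B}.
Hypothesis phiB : forall V b x b', phi V (iota b * x * iota b') = b * phi V x * b'.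

Local Notation val v w := (phi [set v.1; w.1] (v.2 * w.2)).

Definition remove_pair (x : pword) (v w : 'I_k * A) (y : pword) : pword :=
  pabsorb x (val v w) y.

(** An adjacent block somewhere keeps [contract] from returning the word unchanged, though the block
    it removes may be another one. The size bound excludes a word of one pair, on which [contract]
    stalls. *)
Lemma contractP (s : pword) x v w y : (2 < size s)%N ->
  s = x ++ v :: w :: y -> [set v.1; w.1] \in pi ->
  exists x0 v0 w0 y0, [/\ s = x0 ++ v0 :: w0 :: y0, [set v0.1; w0.1] \in pi &
    Defs.contract iota pi phi s = remove_pair x0 v0 w0 y0].
Proof.
have inner u s' x' : s' = x' ++ v :: w :: y -> [set v.1; w.1] \in pi ->
    exists x0 v0 w0 y0, [/\ s' = x0 ++ v0 :: w0 :: y0, [set v0.1; w0.1] \in pi &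
    contract_inner iota pi phi (u :: s') = remove_pair (u :: x0) v0 w0 y0].
  move=> + vw; elim: x' u s' => [|u' x' IH] u s' ->.
    by exists [::], v, w, y; split; rewrite //= vw.
  have [x0 [v0 [w0 [y0 [sE vw0 cE]]]]] := IH u' _ erefl.
  case xE: (x' ++ v :: w :: y) sE cE => [|w' t] sE cE; first by case: (x') xE.
  rewrite cat_cons xE.
  have [uw|uw] := boolP ([set u'.1; w'.1] \in pi).
    by exists [::], u', w', t; rewrite /= uw.
  exists (u' :: x0), v0, w0, y0; split=> //; first by rewrite sE.
  by rewrite /= (negPf uw) -/(contract_inner _ _ _ (u' :: w' :: t)) cE.
case: s => [//|v1 [//|w1 [//|u t]]] _ sE vw /=.
have [vw1|vw1] := boolP ([set v1.1; w1.1] \in pi).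
  by exists [::], v1, w1, (u :: t).
case: x sE => [|u0 x].
  by case=> E1 E2; move: vw1; rewrite E1 E2 vw.
case=> -> sE; have [x0 [v0 [w0 [y0 [sE0 vw0 cE]]]]] := inner u0 _ x sE vw.
exists (u0 :: x0), v0, w0, y0; split=> //; by rewrite sE0.
Qed.

(** Local confluence. Each of two disjoint adjacent pairs stays adjacent when the other is removed,
    but a letter of it may have absorbed the other's value; the bimodule property moves that scalar
    out again. The cases tell which letter absorbs, hence the fresh names for the modified words.
    Some letter outside the two pairs must remain to absorb the last scalar. *)
Lemma diamond x v w z v' w' y : x ++ z ++ y <> [::] ->
  exists X V W Y X' V' W' Y',
  [/\ remove_pair x v w (z ++ v' :: w' :: y) = X' ++ V' :: W' :: Y',
      remove_pair (x ++ v :: w :: z) v' w' y = X ++ V :: W :: Y,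
      [/\ V.1 = v.1, W.1 = w.1, V'.1 = v'.1 & W'.1 = w'.1] &
      remove_pair X V W Y = remove_pair X' V' W' Y'].
Proof.
set p := val v w; set q := val v' w'.
have phir u c d (b : B) : phi u (c * (d * iota b)) = phi u (c * d) * b.
  by have := phiB u 1 (c * d) b; rewrite rmorph1 !mul1r mulrA.
have phil u c d (b : B) : phi u (iota b * c * d) = b * phi u (c * d).
  by have := phiB u b (c * d) 1; rewrite rmorph1 !mulr1 mulrA.
move=> nz; rewrite /remove_pair -/p -/q.
case/lastP: x nz => [|x u] nz; last first.
  rewrite absorb_rcons; case/lastP: z {nz} => [|z t].
    exists (rcons x u), v, (w.1, w.2 * iota q), y.
    exists (x ++ [:: (u.1, u.2 * iota p)]), v', w', y; split => //=.
    - by rewrite -catA.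
    - by rewrite -[[:: v; w]]/(rcons [:: v] w) -rcons_cat absorb_rcons -catA.
    - rewrite absorb_rcons cats1 absorb_rcons /=.
      by rewrite phir /scale_right rmorphM mulrA.
  exists (rcons x u), v, w, (rcons z (t.1, t.2 * iota q) ++ y).
  exists (x ++ (u.1, u.2 * iota p) :: rcons z t), v', w', y; split => //=.
  - by rewrite -catA.
  - by rewrite -!rcons_cons -rcons_cat absorb_rcons -catA /= !cat_rcons.
  - rewrite absorb_rcons -rcons_cons -rcons_cat absorb_rcons -catA /=.
    by rewrite !cat_rcons.
case: z nz => [|t z] nz /=.
  case: y nz => [//|u y] _.
  exists [::], v, (w.1, w.2 * iota q), (u :: y).
  exists [::], (v'.1, iota p * v'.2), w', (u :: y); split=> //=.
  by rewrite phir phil.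
case/lastP: z {nz} => [|z t'].
  exists [::], v, w, ((t.1, t.2 * iota q) :: y).
  exists [:: (t.1, iota p * t.2)], v', w', y; split=> //=.
  by rewrite /scale_left /scale_right /= mulrA.
exists [::], v, w, (t :: rcons z (t'.1, t'.2 * iota q) ++ y).
exists ((t.1, iota p * t.2) :: rcons z t'), v', w', y; split=> //.
  have /= -> := absorb_rcons scale_left scale_right [:: v, w, t & z] t' q y.
  by rewrite cat_rcons.
have /= -> := absorb_rcons scale_left scale_right ((t.1, iota p * t.2) :: z) t' (val v' w') y.
by rewrite cat_rcons.
Qed.

Lemma remove_pair_labels x v w y :
  [seq l.1 | l <- remove_pair x v w y] = [seq l.1 | l <- x ++ y].
Proof. exact: absorb_labels. Qed.

Hypothesis triv : finset.trivIset pi.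

Lemma uniq_split (x y x' y' : pword) v w v' w' :
  uniq [seq l.1 | l <- x ++ v :: w :: y] ->
  x ++ v :: w :: y = x' ++ v' :: w' :: y' ->
  [set v.1; w.1] \in pi -> [set v'.1; w'.1] \in pi -> (size x <= size x')%N ->
  [/\ x = x', v = v', w = w' & y = y'] \/
  exists z, x' = x ++ v :: w :: z /\ y = z ++ v' :: w' :: y'.
Proof.
elim: x x' => [|u x IH] [|u' x'] //=.
- by move=> _ [-> -> ->] *; left.
- case: x' => [|w1 z] us; last first.
    by case=> <- <- -> *; right; exists z.
  (* The two blocks would overlap in the single letter [w = v'], hence coincide, and a label would
     occur twice in the word. *)
  case=> vE wE yE vw vw' _; exfalso; move: us; rewrite yE wE /=.
  rewrite !inE !negb_or -!andbA => /and4P[vv' vw1 _ _].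
  have E2 : [set v.1; w.1] = [set v'.1; w'.1].
    apply: contraTeq isT => ne; have := finset.trivIsetP triv _ _ vw vw' ne.
    by move=> /pred0P/(_ v'.1); rewrite /= !inE wE eqxx orbT.
  have := set21 v.1 w.1; rewrite E2 !inE => /orP[/eqP vE'|/eqP vE'].
    by rewrite vE' eqxx in vv'.
  by rewrite vE' eqxx in vw1.
- move=> /andP[_ us] [<- sE] vw vw' sz; case: (IH _ us sE vw vw' sz) =>
    [[-> -> -> ->]|[z [-> ->]]]; by [left | right; exists z].
Qed.

(* [part_rec] contracts the leftmost pair; any other adjacent pair may be
   contracted first. *)
Lemma part_rec_remove n (x y : pword) v w :
  size (x ++ v :: w :: y) = n.+2.*2 -> uniq [seq l.1 | l <- x ++ v :: w :: y] ->
  [set v.1; w.1] \in pi ->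
  part_rec iota pi phi n.+2 (x ++ v :: w :: y) =
  part_rec iota pi phi n.+1 (remove_pair x v w y).
Proof.
(* The two statements climb together: [confl] at [m] gives [removal] at [m], which through [diamond]
   gives [confl] at [m.+1]. *)
pose removal n := forall x v w y, size (x ++ v :: w :: y) = n.+2.*2 ->
  uniq [seq l.1 | l <- x ++ v :: w :: y] -> [set v.1; w.1] \in pi ->
  part_rec iota pi phi n.+2 (x ++ v :: w :: y) =
  part_rec iota pi phi n.+1 (remove_pair x v w y).
pose confl n := forall x v w z v' w' y,
  size (x ++ v :: w :: z ++ v' :: w' :: y) = n.+2.*2 ->
  uniq [seq l.1 | l <- x ++ v :: w :: z ++ v' :: w' :: y] ->
  [set v.1; w.1] \in pi -> [set v'.1; w'.1] \in pi ->
  part_rec iota pi phi n.+1 (remove_pair x v w (z ++ v' :: w' :: y)) =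
  part_rec iota pi phi n.+1 (remove_pair (x ++ v :: w :: z) v' w' y).
have conflS m : confl m -> removal m.
  move=> cf {}x {}v {}w {}y sz us vw.
  have s3 : (2 < size (x ++ v :: w :: y))%N by rewrite sz.
  have [x0 [v0 [w0 [y0 [sE vw0 cE]]]]] := contractP s3 erefl vw.
  transitivity (part_rec iota pi phi m.+1 (remove_pair x0 v0 w0 y0)).
    by rewrite -cE.
  have [xx0|/ltnW xx0] := leqP (size x) (size x0).
    have [[-> -> -> ->] //|[z [xE yE]]] := uniq_split us sE vw vw0 xx0.
    by rewrite xE yE cf // -yE.
  rewrite sE in us sz.
  have [[-> -> -> ->] //|[z [xE yE]]] := uniq_split us (esym sE) vw0 vw xx0.
  by rewrite xE yE cf // -yE.
have step m : removal m -> confl m.+1.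
  move=> rm {}x {}v {}w z v' w' {}y sz us vw vw'.
  have nz : x ++ z ++ y <> [::].
    move=> /(congr1 size); move: sz; rewrite !size_cat /= !size_cat /= => sz e.
    by move: sz; rewrite !addnS addnCA; case: (x) e; case: (z); case: (y).
  have [X [V [W [Y [X' [V' [W' [Y' [E1 E2 [V1 W1 V1' W1'] E3]]]]]]]]] :=
    diamond v w v' w' nz.
  have drop2 u1 u2 p q : size (u1 ++ p :: q :: u2) = m.+3.*2 ->
      uniq [seq l.1 | l <- u1 ++ p :: q :: u2] ->
      size (remove_pair u1 p q u2) = m.+2.*2 /\
      uniq [seq l.1 | l <- remove_pair u1 p q u2].
    rewrite remove_pair_labels size_absorb !size_cat /= !addnS => -[->]; split=> //.
    move: H; rewrite !map_cat /= !cat_uniq /= !negb_or => /and3P[-> /and3P[_ _ ->]].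
    by case/and3P.
  have [sP uP] := drop2 _ _ _ _ sz us.
  have sE : x ++ v :: w :: z ++ v' :: w' :: y = (x ++ v :: w :: z) ++ v' :: w' :: y.
    by rewrite -catA.
  rewrite sE in sz us; have [sQ uQ] := drop2 _ _ _ _ sz us.
  rewrite E1 in sP uP *; rewrite E2 in sQ uQ *.
  by rewrite !rm ?E3 ?V1 ?W1 ?V1' ?W1'.
(* Two pairs and no further letter, the case outside [diamond]: both orders give the product of the
   two values. *)
have base : confl 0%N.
  move=> x0 v0 w0 z v' w' y0 sz _ _ _.
  have /eqP : (size x0 + size z + size y0 = 0)%N.
    move: sz; rewrite !size_cat /= !size_cat /= !addnS => -[sz].
    by rewrite -addnA sz.
  rewrite !addn_eq0 -andbA => /and3P[/nilP -> /nilP -> /nilP ->] /=.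
  have := phiB [set v0.1; w0.1] 1 (v0.2 * w0.2) (phi [set v'.1; w'.1] (v'.2 * w'.2)).
  rewrite rmorph1 !mul1r mulrA => ->.
  have := phiB [set v'.1; w'.1] (phi [set v0.1; w0.1] (v0.2 * w0.2)) (v'.2 * w'.2) 1.
  by rewrite rmorph1 !mulr1 mulrA => ->.
have all_removal m : removal m.
  by elim: m => [|m IH]; apply: conflS => //; exact: step.
exact: all_removal.
Qed.

End Phi.
End PartRec.

(** * Words that can be consumed pair by pair *)

Section Evaluation.
Variables (K : fieldType) (A B : algType K).
Variables (iota : {lrmorphism B -> A}) (E E' : {linear A -> B}).
Variables (a : nat -> A) (S : nat -> set A) (i0 : nat).
Hypothesis sp : infinitesimal_prob_space iota E E'.
Hypothesis id_distr : identically_distributed iota E E' a.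
Hypothesis fam : algebra_family iota a S.

Definition centered_family (c : nat -> A) : bool :=
  [&& family iota a S c, E (c i0) == 0 & E' (c i0) == 0].

Lemma centered_familyP c i : centered_family c -> E (c i) = 0 /\ E' (c i) = 0.
Proof.
case/and3P=> Fc /eqP E0 /eqP E'0.
by have [-> ->] := family_moment sp id_distr i i0 Fc.
Qed.

Lemma centered_family_absorb c b : centered_family c ->
  centered_family (fml iota b c) && centered_family (fmr iota c b).
Proof.
case/and3P=> Fc /eqP E0 /eqP E'0; rewrite /centered_family /fml /fmr.
rewrite (family_ml fam) // (family_mr fam) // !(iEl sp, iEr sp, iE'l sp, iE'r sp).
by rewrite E0 E'0 !mulr0 !mul0r eqxx.
Qed.

Variables (k : nat) (pi : {set {set 'I_k}}) (f : 'I_k -> nat).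
Local Notation word := (seq ('I_k * (nat -> A))).
Local Notation fabsorb := (@absorb 'I_k (nat -> A) B (fml iota) (fmr iota)).

Definition labels (w : word) : seq 'I_k := [seq l.1 | l <- w].
Definition centered_word (w : word) : bool := all (fun l => centered_family l.2) w.
Definition at_ref (w : word) : seq ('I_k * A) := [seq (l.1, l.2 i0) | l <- w].

Lemma centered_word_absorb x b y :
  centered_word (x ++ y) -> centered_word (fabsorb x b y).
Proof. by apply: all_absorb => l; exact: centered_family_absorb. Qed.

Lemma at_ref_absorb x b y : at_ref (fabsorb x b y) =
  @absorb 'I_k A B (scale_left iota) (scale_right iota) (at_ref x) b (at_ref y).
Proof.
case/lastP: x => [|x u]; first by case: y.
by rewrite absorb_rcons {2}/at_ref map_rcons absorb_rcons /at_ref map_cat.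
Qed.

(* Let v and w share a label that x and y do not use.  Then this holds under
   freeness, and under monotone independence if that label is the largest. *)
Definition removable x v w y : Prop := forall X c d Y,
  labels X = x -> labels Y = y -> centered_word (X ++ (v, c) :: (w, d) :: Y) ->
  let u := ev f (X ++ (v, c) :: (w, d) :: Y) in
  E u = E (ev f X * iota (E (c i0 * d i0)) * ev f Y) /\
  E' u = E' (ev f X * iota (E (c i0 * d i0)) * ev f Y) +
         E (ev f X * iota (E' (c i0 * d i0)) * ev f Y).

Definition vanishes x : Prop := forall w, labels w = x -> centered_word w ->
  E (ev f w) = 0 /\ E' (ev f w) = 0.

(** A derivation is an order in which the blocks become neighbours and can be removed. It mentions
    positions only, because a removal changes the remaining letters but not where they stand. *)
Inductive reducible : seq 'I_k -> Prop :=
| reducible_nil : reducible [::]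
| reducible_pair x v w y : [set v; w] \in pi -> f v = f w ->
    removable x v w y -> reducible (x ++ y) -> reducible (x ++ v :: w :: y).

Lemma labels_cat2 (W : word) x v w y : labels W = x ++ v :: w :: y ->
  exists X c d Y, [/\ W = X ++ (v, c) :: (w, d) :: Y, labels X = x & labels Y = y].
Proof.
elim: x W => [|t x IH] [|[t' e] W] //=.
  case: W => [|[w' d] Y] //= [-> -> yE].
  by exists [::], e, d, Y.
case=> -> /IH [X [c [d [Y [-> <- <-]]]]].
by exists ((t, e) :: X), c, d, Y.
Qed.

(** The value of the removed pair is absorbed by a remaining letter, which stays centered; each
    resulting term is therefore a word covered by [vanishes (x ++ y)]. *)
Lemma vanishes_step x v w y : removable x v w y -> x ++ y <> [::] ->
  vanishes (x ++ y) -> vanishes (x ++ v :: w :: y).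
Proof.
move=> rm nz van W WE cW; have [X [c [d [Y [E1 xE yE]]]]] := labels_cat2 WE.
rewrite E1 in cW *; have [-> ->] := rm _ _ _ _ xE yE cW.
have nXY : X ++ Y <> [::].
  by move=> XY; apply: nz; rewrite -xE -yE -map_cat XY.
have cXY : centered_word (X ++ Y).
  by move: cW; rewrite /centered_word !all_cat /= => /and4P[-> _ _ ->].
have absorb0 b := van (fabsorb X b Y) _ (centered_word_absorb b cXY).
have lab b : labels (fabsorb X b Y) = x ++ y.
  by rewrite /labels absorb_labels map_cat -xE -yE.
rewrite -!ev_absorb //.
have [-> ->] := absorb0 lab (E (c i0 * d i0)).
by have [-> _] := absorb0 lab (E' (c i0 * d i0)); rewrite addr0.
Qed.

Hypothesis triv : finset.trivIset pi.
Hypothesis pairs : forall V, V \in pi -> #|V| = 2%N.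

Definition block_phi (V W : {set 'I_k}) : {linear A -> B} := if W == V then E' else E.

Lemma block_phiB V W b x b' :
  block_phi V W (iota b * x * iota b') = b * block_phi V W x * b'.
Proof.
by rewrite /block_phi; case: ifP => _; [exact: (ips_bimod' sp) | exact: (ips_bimod sp)].
Qed.

Definition part_word phi n (w : word) : B := part_rec iota pi phi n (at_ref w).

Lemma part_word_remove (phi : {set 'I_k} -> {linear A -> B}) n X v c w d Y :
  (forall V b x b', phi V (iota b * x * iota b') = b * phi V x * b') ->
  size (X ++ (v, c) :: (w, d) :: Y) = n.+2.*2 ->
  uniq (labels (X ++ (v, c) :: (w, d) :: Y)) -> [set v; w] \in pi ->
  part_word phi n.+2 (X ++ (v, c) :: (w, d) :: Y) =
  part_word phi n.+1 (fabsorb X (phi [set v; w] (c i0 * d i0)) Y).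
Proof.
move=> phiB sz us vw; rewrite /part_word at_ref_absorb [in LHS]/at_ref map_cat 2!map_cons.
apply: (part_rec_remove phiB triv) => //.
  by move: sz; rewrite !size_cat /= !size_map.
by move: us; rewrite /labels !map_cat /= -!map_comp.
Qed.

Lemma nil_or_size n (x : seq 'I_k) v w y : size (x ++ v :: w :: y) = n.+1.*2 ->
  (n = 0%N /\ (x = [::] /\ y = [::])) \/
  exists m, [/\ n = m.+1, size (x ++ y) = m.+1.*2 & x ++ y <> [::]].
Proof.
rewrite size_cat /= !addnS => -[]; rewrite -size_cat; case: n => [|m] sz.
  by left; split=> //; case: x y sz => [|//] [|//].
by right; exists m; split=> //; case: (x ++ y) sz.
Qed.

Lemma uniq_removed (x : seq 'I_k) v w y : uniq (x ++ v :: w :: y) -> uniq (x ++ y).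
Proof.
rewrite !cat_uniq /= !negb_or => /and3P[-> /and3P[_ _ ->]].
by case/and3P.
Qed.

Lemma labels_nilP (X Y : word) : labels X ++ labels Y <> [::] -> X ++ Y <> [::].
Proof. by case: X => [|//]; case: Y. Qed.

(** The recursion consults [phi] only at blocks made of positions of the word. So once [V] has been
    removed, [block_phi V] may be exchanged for [E]. *)
Lemma part_word_eq (phi phi' : {set 'I_k} -> {linear A -> B}) n x (W : word) :
  (forall V b x b', phi V (iota b * x * iota b') = b * phi V x * b') ->
  (forall V b x b', phi' V (iota b * x * iota b') = b * phi' V x * b') ->
  reducible x -> size x = n.+1.*2 -> uniq x -> labels W = x ->
  (forall V, V \in pi -> V \subset [set t in x] -> phi V = phi' V) ->
  part_word phi n.+1 W = part_word phi' n.+1 W.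
Proof.
move=> phiB phi'B red.
elim: red n W => {x} [//|x v w y vw _ _ _ IH] n W sz us WE agree.
have [X [c [d [Y [E1 xE yE]]]]] := labels_cat2 WE; rewrite {W WE}E1.
have szW : size (X ++ (v, c) :: (w, d) :: Y) = size (x ++ v :: w :: y).
  by rewrite -xE -yE !size_cat /= !size_map.
have usW : uniq (labels (X ++ (v, c) :: (w, d) :: Y)).
  by rewrite /labels map_cat /= -/(labels X) -/(labels Y) xE yE.
have e : phi [set v; w] = phi' [set v; w].
  apply: agree => //; apply/fintype.subsetP => t; rewrite !inE mem_cat !inE.
  by case/orP=> ->; rewrite ?orbT.
have [[n0 [x0 y0]]|[m [nE sz' nz]]] := nil_or_size sz.
  rewrite {}x0 {}y0 {}n0 in xE yE *.
  case: X Y xE yE {szW usW} => [|//] [|//] _ _.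
  by rewrite /part_word /= e.
rewrite nE in sz *; rewrite !part_word_remove ?szW // e; apply: IH => //.
- exact: uniq_removed us.
- by rewrite /labels absorb_labels map_cat -xE -yE.
- move=> V Vpi sV; apply: agree => //; apply: (fintype.subset_trans sV).
  apply/fintype.subsetP => t; rewrite !inE !mem_cat !inE.
  by case/orP=> ->; rewrite ?orbT.
Qed.

Lemma sub_block x v w y V : uniq (x ++ v :: w :: y) -> [set v; w] \in pi ->
  (V \in pi) && (V \subset [set t in x ++ v :: w :: y]) && (V != [set v; w]) =
  (V \in pi) && (V \subset [set t in x ++ y]).
Proof.
move=> us vw; case Vpi: (V \in pi) => //=; apply/andP/idP => [[sV nV]|sV].
  have /pred0P dis := finset.trivIsetP triv _ _ Vpi vw nV.
  apply/fintype.subsetP => t tV; have := fintype.subsetP sV t tV.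
  have : t \notin [set v; w] by apply/negP=> tvw; have := dis t; rewrite /= tV tvw.
  by rewrite !inE negb_or !mem_cat !inE => /andP[/negPf -> /negPf ->].
split.
  apply: (fintype.subset_trans sV); apply/fintype.subsetP => t.
  by rewrite !inE !mem_cat !inE => /orP[->|->]; rewrite ?orbT.
apply/eqP => VE; have := fintype.subsetP sV v; rewrite VE !inE eqxx => /(_ isT).
move: us; rewrite cat_uniq => /and3P[_ /hasPn/(_ v) nx /= /andP[+ _]].
rewrite mem_cat inE negb_or => /andP[_ /negPf ->]; rewrite orbF => vx.
by move: (nx (mem_head _ _)); rewrite /= vx.
Qed.

(** Induction on the derivation: at each removal, [removable] splits [E'] into the term where it
    hits the pair and the term where it acts on the rest. Unfolded, this is the sum over the
    blocks. *)
Theorem evaluation n x (W : word) : reducible x -> size x = n.+1.*2 ->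
  uniq x -> labels W = x -> centered_word W ->
  E (ev f W) = part_word (fun=> E) n.+1 W /\
  E' (ev f W) = \sum_(V in pi | V \subset [set t in x]) part_word (block_phi V) n.+1 W.
Proof.
move=> red; elim: red n W => {x} [//|x v w y vw fvw rm red IH] n W sz us WE cW.
have [X [c [d [Y [E1 xE yE]]]]] := labels_cat2 WE.
rewrite {W WE}E1 in cW *; have [-> ->] := rm _ _ _ _ xE yE cW.
have cXY : centered_word (X ++ Y).
  by move: cW; rewrite /centered_word !all_cat /= => /and4P[-> _ _ ->].
have vw' : [set v; w] \in pi /\ [set v; w] \subset [set t in x ++ v :: w :: y].
  split=> //; apply/fintype.subsetP => t; rewrite !inE mem_cat !inE.
  by case/orP=> ->; rewrite ?orbT.
rewrite (bigD1 [set v; w]) /=; last by apply/andP.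
under eq_bigl => V do rewrite sub_block //.
have szW : size (X ++ (v, c) :: (w, d) :: Y) = size (x ++ v :: w :: y).
  by rewrite -xE -yE !size_cat /= !size_map.
have usW : uniq (labels (X ++ (v, c) :: (w, d) :: Y)).
  by rewrite /labels map_cat /= -/(labels X) -/(labels Y) xE yE.
have [[n0 [x0 y0]]|[m [nE sz' nz]]] := nil_or_size sz.
  rewrite {}x0 {}y0 {}n0 in xE yE *.
  case: X Y xE yE {cW cXY szW usW rm} => [|//] [|//] _ _.
  rewrite ev_nil !mul1r !mulr1 !(ips_unit sp) (iE'u sp) add0r.
  rewrite big1 ?addr0 => [|V]; first by rewrite /part_word /= /block_phi eqxx.
  case/andP=> Vpi /fintype.subsetP sV; have : (0 < #|V|)%N by rewrite pairs.
  by case/card_gt0P=> t /sV; rewrite !inE.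
rewrite {n}nE in sz *.
rewrite part_word_remove ?szW //; last by move=> *; exact: (ips_bimod sp).
have nXY : X ++ Y <> [::] by apply: labels_nilP; rewrite xE yE.
have lab b : labels (fabsorb X b Y) = x ++ y.
  by rewrite /labels absorb_labels map_cat -xE -yE.
have us' := uniq_removed us.
rewrite -!ev_absorb //.
have IHb b := IH m (fabsorb X b Y) sz' us' (lab b) (centered_word_absorb b cXY).
have [-> ->] := IHb (E (c i0 * d i0)); have [-> _] := IHb (E' (c i0 * d i0)).
(* The term with [E'] on the removed pair is the summand of the block [[set v; w]]; the rest of its
   word sees only [E]. *)
split=> //; rewrite [LHS]addrC; congr (_ + _).
  rewrite part_word_remove ?szW //; last exact: block_phiB.
  have -> : block_phi [set v; w] [set v; w] = E' by rewrite /block_phi eqxx.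
  apply: (part_word_eq _ _ red sz' us' (lab _)) => [*|*|V Vpi sub].
  - exact: (ips_bimod sp).
  - exact: block_phiB.
  rewrite /block_phi; case: eqP => // VE; move: sub; rewrite {}VE => sub.
  by have := sub_block [set v; w] us vw; rewrite vw sub eqxx !andbF.
apply: eq_bigr => V /andP[Vpi subV].
rewrite part_word_remove ?szW //; last exact: block_phiB.
have -> // : block_phi V [set v; w] = E.
rewrite /block_phi; case: eqP => // E2.
by have := sub_block V us vw; rewrite Vpi subV -E2 eqxx !andbF.
Qed.

End Evaluation.

(** * Reducing a word in which every label occurs twice *)

Section Reduction.
Variables (K : fieldType) (A B : algType K).
Variables (iota : {lrmorphism B -> A}) (E E' : {linear A -> B}).
Variables (a : nat -> A) (S : nat -> set A) (i0 : nat).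
Hypothesis sp : infinitesimal_prob_space iota E E'.
Hypothesis id_distr : identically_distributed iota E E' a.
Hypothesis fam : algebra_family iota a S.
Variables (k : nat) (pi : {set {set 'I_k}}) (f : 'I_k -> nat).
Local Notation word := (seq ('I_k * (nat -> A))).
Local Notation removable := (removable iota E E' a S i0 f).
Local Notation vanishes := (vanishes iota E E' a S i0 f).
Local Notation reducible := (reducible iota E E' a S i0 pi f).
Local Notation centered_word := (centered_word iota E E' a S i0).

(** With eps part zero, the two components of [dual_E] of a word are its [E] and its [E']. *)
Definition emb_letter (l : 'I_k * (nat -> A)) : 'I_k * (nat -> dual A) :=
  (l.1, fun i => (l.2 i, 0)).
Definition emb (w : word) := [seq emb_letter l | l <- w].

Local Notation jt := (dual_incl iota).
Local Notation Et := (dual_E E E').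
Local Notation Ft := (dual_family iota a S).

Lemma ev_emb g w : ev g (emb w) = (ev g w, 0).
Proof.
elim: w => [|l w IH]; first by rewrite !ev_nil.
by rewrite !ev_cons IH; congr (_, _); rewrite /= mulr0 mul0r addr0.
Qed.

Lemma family_zero : family iota a S (fun=> 0).
Proof.
have := family_ml fam 0 (family_gen fam).
by congr (family _ _ _); apply: funext => i; rewrite raddf0 mul0r.
Qed.

Lemma wordF_emb w : centered_word w -> wordF Ft (emb w).
Proof.
elim: w => //= l w IH /andP[/and3P[Fl _ _] cw].
by rewrite /dual_family /= Fl family_zero IH.
Qed.

Lemma centered_emb w : centered_word w -> centered Et (emb w).
Proof.
elim: w => //= l w IH /andP[cl cw]; rewrite IH // andbT.
have [E0 E'0] := centered_familyP sp id_distr 0 cl.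
by rewrite /mean /dual_E /= raddf0 E0 E'0 addr0.
Qed.

Lemma dual_vanish w : Et (ev f (emb w)) = 0 ->
  E (ev f w) = 0 /\ E' (ev f w) = 0.
Proof. by rewrite ev_emb /dual_E /= raddf0 add0r => -[]. Qed.

(** The mean of the removed pair has eps part [E' (c i0 * d i0)], the source of the second summand
    for [E']. *)
Lemma dual_removal x y (c d : nat -> A) (u : word) :
  family iota a S c -> family iota a S d ->
  Et (ev f (emb u)) = Et (ev f (emb x) *
    jt (mean Et (fun i => ((c i, 0) : dual A) * (d i, 0))) * ev f (emb y)) ->
  E (ev f u) = E (ev f x * iota (E (c i0 * d i0)) * ev f y) /\
  E' (ev f u) = E' (ev f x * iota (E (c i0 * d i0)) * ev f y) +
    E (ev f x * iota (E' (c i0 * d i0)) * ev f y).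
Proof.
move=> Fc Fd; have [e1 e2] := family_moment sp id_distr 0 i0 (family_mul fam Fc Fd).
rewrite !ev_emb /mean /dual_E /= => -[-> ].
rewrite !(mulr0, mul0r, raddf0, addr0, add0r) e1 e2 => ->; split=> //.
exact: addrC.
Qed.

Definition increasing (p : seq 'I_k) := pairwise (fun s t : 'I_k => s < t)%N p.
Definition paired (p : seq 'I_k) :=
  forall t, t \in p -> count (fun s => f s == f t) p = 2%N.

Lemma increasing_uniq p : increasing p -> uniq p.
Proof.
by move=> ip; rewrite uniq_pairwise; apply: sub_pairwise ip => s t /= st;
  rewrite -val_eqE neq_ltn st.
Qed.

Lemma increasing_removed x v w y : increasing (x ++ v :: w :: y) -> increasing (x ++ y).
Proof.
rewrite /increasing !pairwise_cat /= => /and3P[/allrelP r -> /and3P[_ _ ->]].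
rewrite !andbT; apply/allrelP => s t sx ty.
by apply: r => //; rewrite !inE ty !orbT.
Qed.

Lemma increasing_adjacent x (v w : 'I_k) y t : increasing (x ++ v :: w :: y) ->
  t \in x ++ v :: w :: y -> (v < t)%N -> (t < w)%N -> False.
Proof.
rewrite /increasing !pairwise_cat /= => /and3P[/allrelP r _ /and3P[/andP[vw vy] wy _]].
rewrite mem_cat !inE => /orP[tx|/or3P[/eqP->|/eqP->|ty]]; rewrite ?ltnn //.
  by move=> vt _; have := r t v tx; rewrite inE eqxx => /(_ isT) /(ltn_trans vt); rewrite ltnn.
by move=> _ tw; have := allP wy t ty; move=> /(ltn_trans tw); rewrite ltnn.
Qed.

Lemma paired_others x v w y : paired (x ++ v :: w :: y) -> f v = f w ->
  all (fun s => f s != f v) (x ++ y).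
Proof.
move=> pp fvw; have := pp v; rewrite mem_cat inE eqxx orbT => /(_ isT).
rewrite count_cat /= -fvw eqxx /= !add1n !addnS -count_cat => -[c0].
by rewrite all_predC has_count c0.
Qed.

Lemma paired_removed x v w y : paired (x ++ v :: w :: y) -> f v = f w ->
  paired (x ++ y).
Proof.
move=> pp fvw t txy; have nt := allP (paired_others pp fvw) t txy.
rewrite -(pp t); last by move: txy; rewrite !mem_cat !inE => /orP[->|->]; rewrite ?orbT.
by rewrite !count_cat /= -fvw eq_sym (negPf nt).
Qed.

Lemma paired_partner p t : uniq p -> paired p -> t \in p ->
  exists u, [/\ u \in p, u != t & f u = f t].
Proof.
move=> up pp tp; have := pp t tp; case/splitPr: tp up {pp} => x y up.
have tE : t \notin x ++ y by move: up; rewrite -cat1s uniq_catCA /= => /andP[].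
rewrite count_cat /= eqxx addnCA add1n -count_cat => -[c1].
have : has (fun s => f s == f t) (x ++ y) by rewrite has_count c1.
case/hasP=> u uxy /eqP fu; exists u; split=> //.
  by move: uxy; rewrite !mem_cat !inE => /orP[->|->]; rewrite ?orbT.
by apply: contraNneq tE => <-.
Qed.

(** In a [paired] word four increasing positions cannot share a label, so the conclusion then
    amounts to a contradiction. *)
Definition crossing_free (p : seq 'I_k) := forall p1 q1 p2 q2,
  p1 \in p -> q1 \in p -> p2 \in p -> q2 \in p ->
  (p1 < q1)%N -> (q1 < p2)%N -> (p2 < q2)%N ->
  f p1 = f p2 -> f q1 = f q2 -> f p1 = f q1.

(** Labels do not decrease towards the inside of a pair: inner blocks come after outer ones. *)
Definition inward (p : seq 'I_k) := forall u t v,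
  u \in p -> t \in p -> v \in p -> (u < t)%N -> (t < v)%N ->
  f u = f v -> (f u <= f t)%N.

Lemma mem_removed x (v w t : 'I_k) y : t \in x ++ v :: w :: y ->
  [\/ t = v, t = w | t \in x ++ y].
Proof.
rewrite !mem_cat !inE => /orP[->|/or3P[/eqP->|/eqP->|->]]; rewrite ?orbT;
  by [constructor 3 | constructor 1 | constructor 2].
Qed.

Lemma removed_sub x (v w : 'I_k) y : {subset x ++ y <= x ++ v :: w :: y}.
Proof. by move=> t; rewrite !mem_cat !inE => /orP[->|->]; rewrite ?orbT. Qed.

Lemma removed_pair x v w y t u : increasing (x ++ v :: w :: y) ->
  paired (x ++ v :: w :: y) -> f v = f w ->
  t \in x ++ v :: w :: y -> u \in x ++ v :: w :: y -> (t < u)%N -> f t = f u ->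
  (t = v /\ u = w) \/ (t \in x ++ y /\ u \in x ++ y).
Proof.
move=> ip pp fvw tp up tu ftu; have others := allP (paired_others pp fvw).
have vw : (v < w)%N.
  by move: ip; rewrite /increasing pairwise_cat /= => /and3P[_ _ /andP[/andP[]]].
have [tE|tE|txy] := mem_removed tp; have [uE|uE|uxy] := mem_removed up; subst.
- by rewrite ltnn in tu.
- by left.
- by have := others _ uxy; rewrite ftu eqxx.
- by move: tu; rewrite ltnNge ltnW.
- by rewrite ltnn in tu.
- by have := others _ uxy; rewrite -ftu fvw eqxx.
- by have := others _ txy; rewrite ftu eqxx.
- by have := others _ txy; rewrite ftu fvw eqxx.
- by right.
Qed.

(** No position of the word lies between the neighbours [v] and [w], so their pair crosses
    nothing. *)
Lemma crossing_free_removed x v w y : increasing (x ++ v :: w :: y) ->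
  paired (x ++ v :: w :: y) -> f v = f w ->
  crossing_free (x ++ v :: w :: y) <-> crossing_free (x ++ y).
Proof.
move=> ip pp fvw; split=> nc p1 q1 p2 q2.
  by move=> /removed_sub h1 /removed_sub h2 /removed_sub h3 /removed_sub h4; exact: nc.
move=> h1 h2 h3 h4 l1 l2 l3 e1 e2.
have [[E1 E2]|[m1 m3]] := removed_pair ip pp fvw h1 h3 (ltn_trans l1 l2) e1.
  by subst; case: (increasing_adjacent ip h2 l1 l2).
have [[E1 E2]|[m2 m4]] := removed_pair ip pp fvw h2 h4 (ltn_trans l2 l3) e2.
  by subst; case: (increasing_adjacent ip h3 l2 l3).
exact: nc l1 l2 l3 e1 e2.
Qed.

(** As an outer pair, [v] and [w] enclose nothing; as inner positions they satisfy every constraint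
    because their label is largest. *)
Lemma inward_removed x v w y : increasing (x ++ v :: w :: y) ->
  paired (x ++ v :: w :: y) -> f v = f w ->
  (forall t, t \in x ++ y -> (f t <= f v)%N) ->
  inward (x ++ v :: w :: y) <-> inward (x ++ y).
Proof.
move=> ip pp fvw fmax; split=> iw u t s.
  by move=> /removed_sub h1 /removed_sub h2 /removed_sub h3; exact: iw.
move=> h1 h2 h3 l1 l2 e.
have [[E1 E2]|[m1 m3]] := removed_pair ip pp fvw h1 h3 (ltn_trans l1 l2) e.
  by subst; case: (increasing_adjacent ip h2 l1 l2).
by have [->|->|m2] := mem_removed h2; rewrite -?fvw; [exact: fmax..|exact: (iw u t s)].
Qed.

(* The last position that opens a pair is followed by its partner. *)
Lemma crossing_free_adjacent p : increasing p -> paired p -> p <> [::] ->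
  crossing_free p -> exists x v w y, p = x ++ v :: w :: y /\ f v = f w.
Proof.
move=> ip pp p0 nc; have up := increasing_uniq ip.
pose opens v := (v \in p) && [exists u in p, (v < u)%N && (f v == f u)].
have [v0 ov0] : exists v, opens v.
  case: p p0 @opens up pp {ip nc} => // t p _ opens up pp.
  have [u [up' ut fut]] := paired_partner up pp (mem_head t p).
  have [tu|ut'|/val_inj tu] := ltngtP t u.
  - exists t; rewrite /opens mem_head; apply/exists_inP; exists u => //.
    by rewrite tu fut eqxx.
  - exists u; rewrite /opens up'; apply/exists_inP; exists t; rewrite ?mem_head //.
    by rewrite ut' fut eqxx.
  - by rewrite tu eqxx in ut.
case: (arg_maxnP (fun v : 'I_k => v : nat) ov0) =>
  v /andP[vp /exists_inP[v' v'p /andP[vv' /eqP fv']]] vmax0.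
have vmax t s : t \in p -> s \in p -> (t < s)%N -> f t = f s -> (t <= v)%N.
  move=> tp s_p ts fts; apply: vmax0; rewrite /opens tp; apply/exists_inP.
  by exists s; rewrite // ts fts eqxx.
move: {vmax0 ov0 opens v0} vp ip pp nc {p0} vmax v'p up => vp.
case/splitPr: vp => x y ip pp nc vmax v'p up.
case: y ip pp nc vmax v'p up => [|w y] ip pp nc vmax v'p up.
  move: v'p; rewrite mem_cat inE => /orP[v'x|/eqP v'E]; last by rewrite v'E ltnn in vv'.
  move: ip; rewrite /increasing pairwise_cat => /and3P[/allrelP r _ _].
  by have := r v' v v'x (mem_head _ _) => /(ltn_trans vv'); rewrite ltnn.
exists x, v, w, y; split=> //.
have vw : (v < w)%N.
  by move: ip; rewrite /increasing pairwise_cat /= => /and3P[_ _ /andP[/andP[]]].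
have wp : w \in x ++ v :: w :: y by rewrite mem_cat !inE eqxx !orbT.
have vp : v \in x ++ v :: w :: y by rewrite mem_cat !inE eqxx !orbT.
(* If the partner [u] of [w] came after [w], then [w] would open a pair later than [v]. If [u] came
   before [v] and the partner [v'] of [v] after [w], then [u, v, w, v'] would cross. *)
have [u [u_p uw fuw]] := paired_partner up pp wp.
have [u_w|w_u|/val_inj u_w] := ltngtP u w; last by rewrite u_w eqxx in uw.
  have [uv|vu|/val_inj <- //] := ltngtP u v; last by case: (increasing_adjacent ip u_p vu u_w).
  have [v'w|wv'|/val_inj <- //] := ltngtP v' w.
    by case: (increasing_adjacent ip v'p vv' v'w).
  by rewrite -fuw; apply/esym; exact: (nc u v w v').
by have := vmax w u wp u_p w_u (esym fuw) => /(leq_trans vw); rewrite ltnn.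
Qed.

Hypothesis fpi : forall v w, v != w -> f v = f w -> [set v; w] \in pi.

Lemma adjacent_block x v w y : increasing (x ++ v :: w :: y) -> f v = f w ->
  [set v; w] \in pi.
Proof.
move=> ip; apply: fpi; rewrite neq_ltn.
by move: ip; rewrite /increasing pairwise_cat /= => /and3P[_ _ /andP[/andP[->]]].
Qed.

Lemma sorted_or_adjacent p :
  ~ (exists x v w y, p = x ++ v :: w :: y /\ f v = f w) ->
  sorted (fun s t => f s != f t) p.
Proof.
elim: p => [//|v [//|w p] IH] nadj /=; apply/andP; split.
  by apply/eqP => fvw; apply: nadj; exists [::], v, w, p.
by apply: IH => -[x [v' [w' [y [pE fvw]]]]]; apply: nadj; exists (v :: x), v', w', y; rewrite pE.
Qed.

Section Free.
Hypothesis pairF : forall x v w y, f v = f w ->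
  all (fun s => f s != f v) (x ++ y) -> removable x v w y.
Hypothesis altF : forall p, p <> [::] -> sorted (fun s t => f s != f t) p -> vanishes p.

(** Removing neighbours with equal labels preserves both alternatives. When there are none, the word
    alternates and vanishes, and [crossing_free_adjacent] shows that it has a crossing. *)
Lemma free_reduction p : increasing p -> paired p -> p <> [::] ->
  (crossing_free p -> reducible p) /\ (~ crossing_free p -> vanishes p).
Proof.
have [n] := ubnP (size p); elim: n p => // n IH p; rewrite ltnS => pn ip pp p0.
have [[x [v [w [y [pE fvw]]]]]|nadj] :=
    pselect (exists x v w y, p = x ++ v :: w :: y /\ f v = f w); last first.
  split=> [nc|_]; first by case: nadj; exact: crossing_free_adjacent.
  by apply: altF => //; exact: sorted_or_adjacent.
rewrite pE in pn ip pp p0 *.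
have ncE := crossing_free_removed ip pp fvw.
have rm := pairF fvw (paired_others pp fvw).
have [xy0|xy0] : x ++ y = [::] \/ x ++ y <> [::] by case: (x ++ y); [left|right].
  have red : reducible (x ++ v :: w :: y).
    by apply: reducible_pair => //;
      [exact: adjacent_block ip _ | rewrite xy0; exact: reducible_nil].
  by split=> // ncp; case: ncp; apply/ncE; rewrite xy0 => ? ? ? ?.
have sz : (size (x ++ y) < n)%N by move: pn; rewrite !size_cat /= !addnS => /ltnW.
have [red van] := IH _ sz (increasing_removed ip) (paired_removed pp fvw) xy0.
split=> [/ncE nc|nnc].
  by apply: reducible_pair => //; [exact: adjacent_block ip _ | exact: red].
by apply: vanishes_step rm xy0 _ => //; apply: van => /ncE.
Qed.
End Free.

(** Taking the first of the maxima makes the left neighbour strictly smaller and, in a paired word,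
    puts the partner on the right. *)
Lemma first_max (p : seq 'I_k) : p <> [::] -> exists x v y,
  [/\ p = x ++ v :: y, all (fun s => (f s < f v)%N) x & all (fun s => (f s <= f v)%N) y].
Proof.
elim: p => [//|u [|u' p] IH] _; first by exists [::], u, [::].
have [x [v [y [pE xv yv]]]] : exists x v y, [/\ u' :: p = x ++ v :: y,
    all (fun s => (f s < f v)%N) x & all (fun s => (f s <= f v)%N) y] by exact: IH.
have [uv|vu] := ltnP (f u) (f v); first by exists (u :: x), v, y; rewrite pE /= uv.
exists [::], u, (u' :: p); split=> //; rewrite pE all_cat /= vu /=.
by apply/andP; split; [apply: sub_all xv => s /ltnW|apply: sub_all yv => s] => /leq_trans; apply.
Qed.

Section Monotone.
Hypothesis pairM : forall x v w y, f v = f w ->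
  all (fun s => (f s < f v)%N) (x ++ y) -> removable x v w y.
Hypothesis peakM : forall x v y, all (fun s => (f s < f v)%N) x ->
  (forall w y', y = w :: y' -> (f w < f v)%N) -> vanishes (x ++ v :: y).

(** Let [v] be the first maximum and [w] its right neighbour. Equal labels are removed as a pair.
    Otherwise [v] is a centered peak and the word vanishes; and [w] then lies between [v] and its
    partner with a smaller label, which contradicts [inward]. *)
Lemma monotone_reduction p : increasing p -> paired p ->
  (inward p -> reducible p) /\ (~ inward p -> vanishes p).
Proof.
have [n] := ubnP (size p); elim: n p => // n IH p; rewrite ltnS => pn ip pp.
have [p0|p0] : p = [::] \/ p <> [::] by case: (p); [left|right].
  rewrite p0; split=> [_|[]]; first exact: reducible_nil.
  by move=> ? ? ?.
have [x [v [y [pE xv yv]]]] := first_max p0; rewrite {p p0}pE in pn ip pp *.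
have vp : v \in x ++ v :: y by rewrite mem_cat inE eqxx orbT.
have up := increasing_uniq ip.
case: y pn ip pp up vp yv => [|w y] pn ip pp up vp yv.
  have [u [+ uv fu]] := paired_partner up pp vp.
  rewrite mem_cat inE (negPf uv) orbF => /(allP xv).
  by rewrite fu ltnn.
move: yv => /= /andP[wv yv]; move: wv; rewrite leq_eqVlt => /orP[/eqP fwv|wv]; last first.
  split=> [iw|_]; last by apply: peakM => // ? ? [<- _].
  have [u [up' uv fu]] := paired_partner up pp vp.
  exfalso; move: (up'); rewrite mem_cat 2!inE (negPf uv) /= => /or3P[|/eqP uE|uy].
  - by move/(allP xv); rewrite fu ltnn.
  - by move: wv; rewrite -uE fu ltnn.
  have wu : (w < u)%N.
    move: ip; rewrite /increasing pairwise_cat /= => /and3P[_ _ /and3P[_ wy _]].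
    exact: (allP wy).
  have vw : (v < w)%N.
    by move: ip; rewrite /increasing pairwise_cat /= => /and3P[_ _ /andP[/andP[]]].
  have wp : w \in x ++ v :: w :: y by rewrite mem_cat !inE eqxx !orbT.
  by have := iw v w u vp wp up' vw wu (esym fu); rewrite leqNgt wv.
have fvw : f v = f w by [].
have others := paired_others pp fvw.
have lt_v : all (fun s => (f s < f v)%N) (x ++ y).
  apply/allP => s sxy; rewrite ltn_neqAle (allP others _ sxy) /=.
  move: sxy; rewrite mem_cat => /orP[/(allP xv)/ltnW //|].
  exact: (allP yv).
have iwE := inward_removed ip pp fvw (fun t txy => ltnW (allP lt_v t txy)).
have rm := pairM fvw lt_v; have vwpi := adjacent_block ip fvw.
have [xy0|xy0] : x ++ y = [::] \/ x ++ y <> [::] by case: (x ++ y); [left|right].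
  have red : reducible (x ++ v :: w :: y).
    by apply: reducible_pair => //; rewrite xy0; exact: reducible_nil.
  by split=> // ncp; case: ncp; apply/iwE; rewrite xy0 => ? ? ?.
have sz : (size (x ++ y) < n)%N by move: pn; rewrite !size_cat /= !addnS => /ltnW.
have [red van] := IH _ sz (increasing_removed ip) (paired_removed pp fvw).
split=> [/iwE nc|nnc]; first by apply: reducible_pair => //; exact: red.
by apply: vanishes_step rm xy0 _ => //; apply: van => /iwE.
Qed.
End Monotone.

Lemma emb_cat x y : emb (x ++ y) = emb x ++ emb y.
Proof. exact: map_cat. Qed.

Lemma all_emb (q : pred nat) w :
  all (fun l => q (f l.1)) (emb w) = all (fun t => q (f t)) (labels w).
Proof. by rewrite /labels !all_map. Qed.

Section FreeIndependence.
Hypothesis SB : forall i b, S i (iota b).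
Hypothesis free : infinitesimally_free iota E E' S.

Lemma family_sub_const (c : nat -> A) b : family iota a S c ->
  family iota a S (fun i => c i - iota b).
Proof.
move=> Fc; have Fb : family iota a S (fun=> iota (- b)).
  by apply/familyP; split=> [|i]; [eexists; exact: represents_const | exact: SB].
have := family_add fam Fc Fb; congr (family _ _ _).
by apply: funext => i; rewrite raddfN.
Qed.

Lemma free_pairF x v w y : f v = f w ->
  all (fun s => f s != f v) (x ++ y) -> removable x v w y.
Proof.
move=> fvw xyv X c d Y xE yE cW u.
move: (cW); rewrite /centered_word all_cat /= => /and4P[_ /and3P[Fc _ _] /and3P[Fd _ _] _].
apply: dual_removal => //; rewrite /u emb_cat /=.
apply: (free_pair (dual_ncps sp id_distr fam)) => //=.
- move=> e b /andP[F1 F2]; rewrite /dual_family /=.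
  by apply/andP; split; exact: family_sub_const.
- exact: free_dual_words.
- by have := wordF_emb cW; rewrite emb_cat.
by rewrite -emb_cat (all_emb (fun n => n != f v)) /labels map_cat -/(labels X) -/(labels Y) xE yE.
Qed.

Lemma free_altF p : p <> [::] -> sorted (fun s t => f s != f t) p -> vanishes p.
Proof.
move=> p0 al w wE cw; apply: dual_vanish.
apply: (free_dual_words sp id_distr fam SB free).
- by case: w wE {cw} => [pE|//]; case: p0; rewrite -pE.
- exact: wordF_emb.
- exact: centered_emb.
- by move: al; rewrite -wE /altern /labels !sorted_map.
Qed.
End FreeIndependence.

Section MonotoneIndependence.
Hypothesis mono : infinitesimally_monotone iota E E' S.

Lemma mono_pairM x v w y : f v = f w ->
  all (fun s => (f s < f v)%N) (x ++ y) -> removable x v w y.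
Proof.
move=> fvw xyv X c d Y xE yE cW u.
move: (cW); rewrite /centered_word all_cat /= => /and4P[_ /and3P[Fc _ _] /and3P[Fd _ _] _].
apply: dual_removal => //; rewrite /u emb_cat /=.
apply: (mono_pair (dual_ncps sp id_distr fam)) => //=.
- exact: monotone_dual_words.
- by have := wordF_emb cW; rewrite emb_cat.
by rewrite -emb_cat (all_emb (fun n => n < f v)%N) /labels map_cat -/(labels X) -/(labels Y) xE yE.
Qed.

Lemma mono_peakM x v y : all (fun s => (f s < f v)%N) x ->
  (forall w y', y = w :: y' -> (f w < f v)%N) -> vanishes (x ++ v :: y).
Proof.
move=> xv yv w wE cw; apply: dual_vanish.
have [X [c [Y [wE' xE yE]]]] : exists X c Y, [/\ w = X ++ (v, c) :: Y, labels X = x & labels Y = y].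
  elim: x w wE {xv cw} => [|t x IH] [|[t' e] W] //=; first by case=> -> yE; exists [::], e, W.
  case=> -> /IH [X [c [Y [-> <- <-]]]].
  by exists ((t, e) :: X), c, Y.
rewrite {w wE}wE' in cw *.
rewrite emb_cat (monotone_dual_words sp id_distr fam mono); last 2 first.
- by have := wordF_emb cw; rewrite emb_cat.
- split=> [x' u xE'|u y' yE'] /=.
    have := all_emb (fun n => n < f v)%N X; rewrite xE xv xE' all_rcons.
    by case/andP.
  case: Y yE yE' {cw} => [//|[t e] Y] /= yE [<- _].
  by apply: (yv t (labels Y)); rewrite -yE.
have := centered_emb cw; rewrite emb_cat /centered all_cat /= => /and3P[_ /eqP -> _].
by rewrite raddf0 mulr0 mul0r raddf0.
Qed.
End MonotoneIndependence.

End Reduction.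

(** * Moments of [E] and [E'] read off the dual space, and the Boolean pairs *)

Section PlainMoments.
Variables (K : fieldType) (A B : algType K).
Variables (iota : {lrmorphism B -> A}) (E E' : {linear A -> B}).
Variables (a : nat -> A) (S : nat -> set A) (i0 : nat).
Hypothesis sp : infinitesimal_prob_space iota E E'.
Hypothesis id_distr : identically_distributed iota E E' a.
Hypothesis fam : algebra_family iota a S.
Variable (k : nat).
Local Notation word := (seq ('I_k * (nat -> A))).
Local Notation centered_word := (centered_word iota E E' a S i0).
Local Notation emb := (@emb K A k).
Local Notation jt := (dual_incl iota).
Local Notation Et := (dual_E E E').
Local Notation Ft := (dual_family iota a S).
Implicit Types (f g : 'I_k -> nat) (w : word).

Lemma plain_spread (rel : ('I_k -> nat) -> ('I_k -> nat) -> Prop) f g w :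
  spreads_from Et Ft rel -> rel f g -> centered_word w ->
  E (ev f w) = E (ev g w) /\ E' (ev f w) = E' (ev g w).
Proof.
move=> spr fg cw;
have : Et (ev f (emb w)) = Et (ev g (emb w)) by exact: spr fg (wordF_emb fam cw).
by rewrite !ev_emb /dual_E /= !raddf0 !add0r => -[-> ->].
Qed.

Lemma plain_singleton f L w : singletons_vanish Et Ft 'I_k ->
  centered_word w -> count (fun t => f t == L) (labels w) = 1%N ->
  E (ev f w) = 0 /\ E' (ev f w) = 0.
Proof.
move=> sing cw c1; apply: dual_vanish; apply: (sing f L).
- exact: (wordF_emb fam cw).
- by rewrite -c1 /label_count /labels !count_map.
- have := centered_emb sp id_distr cw.
  by apply: sub_all => l ->; rewrite implybT.
Qed.

Section Boolean.
Hypothesis bool : infinitesimally_boolean E E' S.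

Let bw : boolean_words Et Ft 'I_k := boolean_dual_words sp id_distr fam bool.
Let np := dual_ncps sp id_distr fam.

Definition neighbours f w r :=
  forall z l, (l < r)%N -> f (nth z w l.*2).1 = f (nth z w l.*2.+1).1.

Definition pair_mean z w (l : nat) : dual B :=
  (E ((nth z w l.*2).2 i0 * (nth z w l.*2.+1).2 i0),
   E' ((nth z w l.*2).2 i0 * (nth z w l.*2.+1).2 i0)).

(** If the first two labels differ, the first letter splits off with mean zero. If they agree, no
    later letter has that label, so the pair splits off as a factor. *)
Lemma boolean_pairs f r z w : size w = r.*2 -> centered_word w ->
  paired f (labels w) ->
  (neighbours f w r -> Et (ev f (emb w)) = \prod_(l < r) pair_mean z w l) /\
  (~ neighbours f w r -> Et (ev f (emb w)) = 0).
Proof.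
elim: r w => [|r IH] w sz cw pw.
  case: w sz {cw pw} => // _; rewrite ev_nil big_ord0; split=> [_|[]] //.
  exact: (E_one np).
case: w sz cw pw => [//|l0 [//|l1 w]] [sz] cw pw.
move: (cw) => /= /and3P[cl0 cl1 cw'].
have Fw : wordF Ft (emb [:: l0, l1 & w]) by exact: (wordF_emb fam cw).
have [f01|f01] := eqVneq (f l0.1) (f l1.1); last first.
  split=> [nb|_]; first by move: f01; rewrite (nb z 0%N) ?eqxx.
  have := @boolean_split_core _ _ _ _ _ _ np bw f [::] (emb_letter l0)
    (emb_letter l1) (emb w) Fw f01.
  have m0 : mean Et (emb_letter l0).2 = 0.
    by have /andP[/eqP] := centered_emb sp id_distr cw.
  move=> ->; rewrite [X in X * _](_ : _ = 0) ?mul0r //.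
  rewrite (ev_cons f (emb_letter l0) [::]) ev_nil mulr1 (ncps_id np) //.
  by move: Fw => /= /andP[].
have pw' : paired f (labels w) by exact: (@paired_removed _ f [::] l0.1 l1.1).
have split2 : Et (ev f (emb [:: l0, l1 & w])) =
    pair_mean z [:: l0, l1 & w] 0 * Et (ev f (emb w)).
  have := @boolean_splitr _ _ _ _ _ _ np bw f [:: emb_letter l0] (emb_letter l1) (emb w) Fw.
  rewrite /= => ->.
    congr (_ * _); rewrite !ev_cons ev_nil mulr1 /= -f01.
    have [Fl0 Fl1] : family iota a S l0.2 /\ family iota a S l1.2.
      by case/and3P: cl0 => -> _ _; case/and3P: cl1 => ->.
    have [e1 e2] := family_moment sp id_distr (f l0.1) i0 (family_mul fam Fl0 Fl1).
    rewrite /dual_E /pair_mean /= mulr0 mul0r addr0 raddf0 add0r.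
    by rewrite e1 e2.
  have := all_emb f (fun n => n != f l1.1) w.
  rewrite -f01 => ->; exact: (@paired_others _ f [::] l0.1 l1.1).
have [good bad] := IH w sz cw' pw'.
have nbE : neighbours f [:: l0, l1 & w] r.+1 <-> neighbours f w r.
  by split=> nb y l lr; [exact: (nb y l.+1) | case: l lr => [//|l] lr; exact: nb].
split=> [/nbE nb|nnb]; last by rewrite split2 bad ?mulr0 // => /nbE.
by rewrite split2 good // big_ord_recl.
Qed.

End Boolean.
End PlainMoments.

(** * Counting labelings *)

Section Counting.
Variables (V : zmodType) (k : nat) (Mom : ('I_k -> nat) -> V).
Hypothesis spread : forall f g, same_order f g -> Mom f = Mom g.
Hypothesis singleton : forall f L, count (fun t => f t == L) (enum 'I_k) = 1%N ->
  Mom f = 0.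

Definition rank_in n (R : {set 'I_n}) (x : 'I_n) : nat := #|[set t in R | (t < x)%N]|.

Lemma rank_in_lt n (R : {set 'I_n}) (x y : 'I_n) : x \in R -> (x < y)%N ->
  (rank_in R x < rank_in R y)%N.
Proof.
move=> xR xy; apply: proper_card; apply/properP; split.
  by apply/fintype.subsetP => t; rewrite !inE => /andP[-> /ltn_trans]; apply.
by exists x; rewrite !inE xR ?xy ?ltnn.
Qed.

Lemma rank_in_bound n (R : {set 'I_n}) x : x \in R -> (rank_in R x < #|R|)%N.
Proof.
move=> xR; apply: proper_card; apply/properP; split.
  by apply/fintype.subsetP => t; rewrite !inE => /andP[].
by exists x; rewrite // !inE ltnn andbF.
Qed.

Lemma rank_in_ltE n (R : {set 'I_n}) (x y : 'I_n) : x \in R -> y \in R ->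
  (rank_in R x < rank_in R y)%N = (x < y)%N.
Proof.
move=> xR yR; have [xy|yx|/val_inj ->] := ltngtP x y; last by rewrite ltnn.
  exact: rank_in_lt.
by apply/negbTE; rewrite -leqNgt ltnW // rank_in_lt.
Qed.

Definition onto r (g : {ffun 'I_k -> 'I_r}) : bool := [set g x | x : 'I_k] == [set: 'I_r].

Definition onto_sum r : V := \sum_(g : {ffun 'I_k -> 'I_r} | onto g) Mom (fun l => g l : nat).

(** Composition with the increasing bijection from ['I_#|R|] to [R] keeps the relative order of
    labels, hence by [spread] the value. *)
Lemma image_sum n (R : {set 'I_n}) :
  \sum_(f : {ffun 'I_k -> 'I_n} | [set f x | x : 'I_k] == R) Mom (fun l => f l : nat) =
  onto_sum #|R|.
Proof.
pose rk (x : 'I_n) (xR : x \in R) : 'I_#|R| := Ordinal (rank_in_bound xR).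
have rk_inj : injective (fun i : 'I_#|R| => rk _ (enum_valP i)).
  move=> i i' /(congr1 val) /= e; apply: enum_val_inj; apply: val_inj.
  have := rank_in_ltE (enum_valP i) (enum_valP i').
  have := rank_in_ltE (enum_valP i') (enum_valP i).
  by rewrite e ltnn; case: ltngtP.
(* The rank is an injective, hence invertible, self-map of the indices of [R]. Its inverse yields
   [h i], the element of [R] of rank [i]. *)
pose un := invF rk_inj.
pose h (i : 'I_#|R|) : 'I_n := enum_val (un i).
have hR i : h i \in R by exact: enum_valP.
have rkh i : rank_in R (h i) = i.
  by rewrite /h; have := f_invF rk_inj i => /(congr1 val).
have h_inj : injective h by move=> i i' e; apply: ord_inj; rewrite -(rkh i) -(rkh i') e.
have hrk x (xR : x \in R) : h (rk x xR) = x.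
  have := rank_in_ltE (hR (rk x xR)) xR; have := rank_in_ltE xR (hR (rk x xR)).
  by rewrite rkh /= ltnn; case: ltngtP => // /val_inj.
have h_onto x : x \in R -> exists i, h i = x.
  by move=> xR; exists (rk x xR).
pose comp (g : {ffun 'I_k -> 'I_#|R|}) : {ffun 'I_k -> 'I_n} := [ffun l => h (g l)].
have comp_inj : injective comp.
  move=> g g' /ffunP e; apply/ffunP => l; apply: h_inj.
  by have := e l; rewrite !ffunE.
have imE g : ([set comp g x | x : 'I_k] == R) = onto g.
  apply/eqP/eqP => [e|e].
    apply/finset.setP => i; rewrite inE; have /finset.setP/(_ (h i)) := e.
    rewrite hR => /imsetP[x _].
    by rewrite ffunE => /h_inj ->; exact: imset_f.
  apply/finset.setP => x; apply/imsetP/idP => [[l _ ->]|xR]; first by rewrite ffunE.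
  have [i <-] := h_onto x xR; have : i \in [set g x | x : 'I_k] by rewrite e inE.
  by case/imsetP=> l _ ->; exists l; rewrite // ffunE.
have -> : \sum_(f : {ffun 'I_k -> 'I_n} | [set f x | x : 'I_k] == R) Mom (fun l => f l : nat) =
    \sum_(f in comp @: [set g | onto g]) Mom (fun l => f l : nat).
  apply: eq_bigl => f; apply/idP/imsetP => [/eqP fR|[g]]; last first.
    by rewrite inE -imE => /[swap] ->.
  have fRl l : f l \in R by rewrite -fR; exact: imset_f.
  pose g0 : {ffun 'I_k -> 'I_#|R|} := [ffun l => rk (f l) (fRl l)].
  have fE : f = comp g0 by apply/ffunP => l; rewrite !ffunE hrk.
  by exists g0; rewrite // inE -imE -fE fR.
rewrite big_imset /=; last by move=> g g' _ _; exact: comp_inj.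
apply: eq_big => [g|g _]; first by rewrite inE.
apply: spread => l l'; rewrite !ffunE -(rank_in_ltE (hR (g l)) (hR (g l'))).
by rewrite !rkh.
Qed.

(** An image has at most [k] elements, so the range of [r] does not grow with [n]; this lets the
    limit be taken term by term. *)
Lemma counting n : \sum_(f : {ffun 'I_k -> 'I_n}) Mom (fun l => f l : nat) =
  \sum_(r < k.+1) onto_sum r *+ 'C(n, r).
Proof.
rewrite (partition_big (fun f : {ffun 'I_k -> 'I_n} => [set f x | x : 'I_k]) xpredT) //=.
under eq_bigr => R _ do rewrite image_sum.
rewrite (bigID (fun R : {set 'I_n} => #|R| < k.+1)%N) /= [X in _ + X]big1 ?addr0.
  rewrite (partition_big (fun R : {set 'I_n} => inord #|R| : 'I_k.+1) xpredT) //=.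
  apply: eq_bigr => r _; rewrite (eq_bigr (fun=> onto_sum r)) => [|R].
    rewrite sumr_const; congr (_ *+ _).
    rewrite -[in RHS](card_ord n) -card_draws; apply: eq_card => R.
    rewrite !inE unfold_in /=; apply/andP/eqP => [[Rk /eqP <-]|->].
      by rewrite inordK.
    by rewrite ltn_ord inord_val.
  by case/andP=> Rk /eqP <-; rewrite inordK.
move=> R; rewrite -leqNgt => kR; rewrite /onto_sum big1 // => g /eqP gT.
have := leq_imset_card g 'I_k; rewrite gT cardsT !card_ord leqNgt.
by rewrite kR.
Qed.

Lemma count_fibre r (g : {ffun 'I_k -> 'I_r}) (y : 'I_r) :
  count (fun t => (g t : nat) == y) (enum 'I_k) = #|[set x | g x == y]|.
Proof. by rewrite cardsE cardE size_filter enumT. Qed.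

Lemma fibres_cover r (g : {ffun 'I_k -> 'I_r}) :
  (\sum_y #|[set x | g x == y]|)%N = k.
Proof.
rewrite -[RHS]card_ord -sum1_card (partition_big g xpredT) //=.
by apply: eq_bigr => y _; rewrite sum1_card cardsE.
Qed.

Lemma onto_fibre r (g : {ffun 'I_k -> 'I_r}) y : onto g -> (0 < #|[set x | g x == y]|)%N.
Proof.
move=> /eqP/finset.setP/(_ y); rewrite inE => /imsetP[x _ ->].
by apply/card_gt0P; exists x; rewrite inE.
Qed.

Lemma onto_small_fibre r (g : {ffun 'I_k -> 'I_r}) y : onto g ->
  (#|[set x | g x == y]| < 2)%N -> Mom (fun l => g l : nat) = 0.
Proof.
move=> og; have := onto_fibre y og; case E : #|_| => [|[|]] // _ _.
by apply: (singleton (L := y)); rewrite count_fibre.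
Qed.

(** Pigeonhole: too few points for [r] fibres of size two, so some fibre, nonempty by surjectivity,
    is a singleton. *)
Lemma onto_sum_small r : (k < r.*2)%N -> onto_sum r = 0.
Proof.
move=> kr; apply: big1 => g og.
have [y yl] : exists y, (#|[set x | g x == y]| < 2)%N.
  apply/existsP; apply: contraLR kr; rewrite negb_exists => /forallP big.
  rewrite -leqNgt -[X in (_ <= X)%N](fibres_cover g) -muln2 mulnC.
  rewrite -[X in (2 * X)%N](card_ord r) mulnC -sum_nat_const; apply: leq_sum => y _.
  by rewrite leqNgt; exact: big.
exact: onto_small_fibre yl.
Qed.

Definition two_to_one r (g : {ffun 'I_k -> 'I_r}) : bool :=
  [forall y, #|[set x | g x == y]| == 2].

Lemma onto_sum_pairs r : k = r.*2 ->
  onto_sum r = \sum_(g : {ffun 'I_k -> 'I_r} | two_to_one g) Mom (fun l => g l : nat).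
Proof.
move=> kr; rewrite /onto_sum (bigID (@two_to_one r)) /= [X in _ + X]big1 ?addr0.
  apply: eq_bigl => g; apply/andP/idP => [[]//|tg]; split=> //.
  apply/eqP/finset.setP => y; rewrite inE.
  have : (0 < #|[set x | g x == y]|)%N by rewrite (eqP (forallP tg y)).
  by case/card_gt0P=> x; rewrite inE => /eqP <-; exact: imset_f.
move=> g /andP[og ntg].
have [y yl] : exists y, (#|[set x | g x == y]| < 2)%N.
  apply/existsP; apply: contraR ntg; rewrite negb_exists => /forallP big.
  have ge2 y : (2 <= #|[set x | g x == y]|)%N by rewrite leqNgt; exact: big.
  apply/forallP => y; rewrite eqn_leq ge2 andbT leqNgt; apply/negP => gt2.
  (* All fibres have at least two points; one with more would make the total exceed [k = r.*2]. *)
  have : (\sum_(y : 'I_r) 2 < \sum_y #|[set x | g x == y]|)%N.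
    rewrite (bigD1 y) //= [X in (_ < X)%N](bigD1 y) //= -addSn leq_add //.
    exact: leq_sum.
  by rewrite fibres_cover sum_nat_const card_ord muln2 -kr ltnn.
exact: onto_small_fibre yl.
Qed.

End Counting.

(** * Two-to-one labelings as pair partitions with ordered blocks *)

Section PairPartitions.
Variables (k r : nat).
Hypothesis kr : k = r.*2.

Definition fibre (g : {ffun 'I_k -> 'I_r}) (y : 'I_r) : {set 'I_k} := [set x | g x == y].
Definition fibres g : seq {set 'I_k} := [seq fibre g y | y <- enum 'I_r].
Definition kernel g : {set {set 'I_k}} := [set V in fibres g].

Definition pair_partition (pi : {set {set 'I_k}}) : bool :=
  finset.partition pi [set: 'I_k] && [forall V in pi, #|V| == 2].

Definition block_label (pi : {set {set 'I_k}}) (s : seq {set 'I_k}) (l : 'I_k) : nat :=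
  index (finset.pblock pi l) s.

Lemma fibre_inj g : two_to_one g -> injective (fibre g).
Proof.
move=> tg y z e; have : (0 < #|fibre g y|)%N by rewrite (eqP (forallP tg y)).
case/card_gt0P=> x xy; have : x \in fibre g z by rewrite -e.
by move: xy; rewrite !inE => /eqP -> /eqP.
Qed.

Lemma fibres_uniq g : two_to_one g -> uniq (fibres g).
Proof. by move=> tg; rewrite map_inj_uniq ?enum_uniq //; exact: fibre_inj. Qed.

Lemma mem_kernel g x : fibre g (g x) \in kernel g.
Proof. by rewrite inE; apply: map_f; rewrite mem_enum. Qed.

Lemma kernel_pair_partition g : two_to_one g -> pair_partition (kernel g).
Proof.
move=> tg; apply/andP; split; last first.
  apply/forall_inP => V; rewrite inE => /mapP[y _ ->].
  exact: (forallP tg y).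
apply/and3P; split.
- apply/eqP/finset.setP => x; rewrite inE; apply/bigcupP.
  by exists (fibre g (g x)); [exact: mem_kernel | rewrite inE].
- apply/finset.trivIsetP => V W; rewrite !inE => /mapP[y _ ->] /mapP[z _ ->] yz.
  apply/pred0P => x; rewrite /= !inE; apply/negP => /andP[/eqP gy /eqP gz].
  by rewrite -gy -gz eqxx in yz.
- rewrite inE; apply/negP => /mapP[y _ e].
  by have := forallP tg y; rewrite -/(fibre g y) -e cards0.
Qed.

Lemma pblock_kernel g x : two_to_one g -> finset.pblock (kernel g) x = fibre g (g x).
Proof.
move=> /kernel_pair_partition/andP[/and3P[_ triv _] _].
by apply: def_pblock => //; [exact: mem_kernel | rewrite inE].
Qed.

Lemma block_label_kernel g x : two_to_one g ->
  block_label (kernel g) (fibres g) x = g x.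
Proof.
move=> tg; rewrite /block_label pblock_kernel // index_map; last exact: fibre_inj.
exact: index_enum_ord.
Qed.

Lemma card_pair_partition pi : pair_partition pi -> #|pi| = r.
Proof.
case/andP=> ppi /forall_inP two.
have two' : {in pi, forall V : {set 'I_k}, #|V| = 2%N} by move=> V /two/eqP.
have := card_uniform_partition two' ppi; rewrite cardsT card_ord [LHS]kr -muln2.
by move/eqP; rewrite eqn_pmul2r // => /eqP.
Qed.

Lemma label_fibres pi s (g : {ffun 'I_k -> 'I_r}) :
  pair_partition pi -> s \in permutations (enum pi) ->
  (forall l, g l = block_label pi s l :> nat) -> fibres g = s.
Proof.
move=> ppi; rewrite mem_permutations => sp gE.
have us : uniq s by rewrite (perm_uniq sp) enum_uniq.
have szs : size s = r by rewrite (perm_size sp) -cardE card_pair_partition.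
have ms V : (V \in s) = (V \in pi) by rewrite (perm_mem sp) mem_enum.
case/andP: (ppi) => /and3P[/eqP cov triv _] _.
apply: (@eq_from_nth _ finset.set0) => [|i]; rewrite size_map size_enum_ord ?szs //.
move=> ir; rewrite (nth_map (Ordinal ir)) ?size_enum_ord //.
have -> : nth (Ordinal ir) (enum 'I_r) i = Ordinal ir.
  by apply: val_inj; rewrite /= nth_enum_ord.
have Vpi : nth finset.set0 s i \in pi by rewrite -ms mem_nth // szs.
apply/finset.setP => x; rewrite inE -val_eqE /= gE /block_label.
have xcov : x \in finset.cover pi by rewrite cov inE.
apply/eqP/idP => [<-|xV].
  by rewrite nth_index ?ms ?pblock_mem // mem_pblock.
by rewrite (def_pblock triv Vpi xV) index_uniq // szs.
Qed.

(** [kernel] forgets the labels and [fibres] lists the blocks in the order of their labels; over a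
    fixed kernel, [fibres] is a bijection onto the orderings, with inverse [block_label]. *)
Lemma two_to_one_sum (V : zmodType) (F : ('I_k -> nat) -> V) :
  \sum_(g : {ffun 'I_k -> 'I_r} | two_to_one g) F (fun l => g l : nat) =
  \sum_(pi | pair_partition pi) \sum_(s <- permutations (enum pi)) F (block_label pi s).
Proof.
rewrite (partition_big kernel pair_partition) => [|g]; last exact: kernel_pair_partition.
apply: eq_bigr => pi ppi; rewrite -big_filter.
set G := [seq g <- _ | _].
have GP g : g \in G = two_to_one g && (kernel g == pi).
  by rewrite mem_filter mem_index_enum andbT.
suff pG : perm_eq (map fibres G) (permutations (enum pi)).
  rewrite -(perm_big _ pG) big_map big_seq [RHS]big_seq; apply: eq_bigr => g.
  rewrite GP => /andP[tg /eqP <-].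
  by congr F; apply: funext => l; rewrite block_label_kernel.
have inv g : g \in G -> forall l, g l = block_label pi (fibres g) l :> nat.
  by rewrite GP => /andP[tg /eqP <-] l; rewrite block_label_kernel.
apply: uniq_perm; last first.
- move=> s; apply/mapP/idP => [[g + ->]|sp].
    rewrite GP => /andP[tg /eqP <-]; rewrite mem_permutations.
    apply: uniq_perm; rewrite ?fibres_uniq ?enum_uniq // => W.
    by rewrite mem_enum inE.
  have lt l : (block_label pi s l < r)%N.
    move: (sp); rewrite mem_permutations => sp'.
    rewrite -(card_pair_partition ppi) cardE -(perm_size sp') index_mem (perm_mem sp') mem_enum.
    by case/andP: (ppi) => /and3P[/eqP cov _ _] _; apply: pblock_mem; rewrite cov inE.
  pose g : {ffun 'I_k -> 'I_r} := [ffun l => Ordinal (lt l)].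
  have gs : fibres g = s by apply: (label_fibres ppi sp) => l; rewrite ffunE.
  have ms W : (W \in s) = (W \in pi).
    by move: sp; rewrite mem_permutations => /perm_mem ->; rewrite mem_enum.
  have kg : kernel g = pi by apply/finset.setP => W; rewrite inE gs ms.
  exists g => //; rewrite GP kg eqxx andbT; apply/forallP => y.
  have : fibre g y \in pi by rewrite -kg inE; apply: map_f; rewrite mem_enum.
  by case/andP: (ppi) => _ /forall_inP; apply.
- exact: permutations_uniq.
- rewrite map_inj_in_uniq ?filter_uniq ?index_enum_uniq // => g g' gG g'G e.
  by apply/ffunP => l; apply: val_inj; rewrite /= (inv g gG) (inv g' g'G) e.
Qed.

End PairPartitions.

(** * Hook length formula for forests *)

Section HookLength.
Variables (T : finType) (le : rel T) (D : {set T}).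
Hypothesis le_refl : {in D, reflexive le}.
Hypothesis le_trans : {in D & &, transitive le}.
Hypothesis le_anti : {in D &, antisymmetric le}.
Hypothesis le_forest : {in D & &, forall x y z, le x y -> le x z -> le y z || le z y}.
Implicit Type S : {set T}.

(** With [le := nested] this counts the blocks inside [x], itself included. The order axioms are
    asked on [D] only: distinct sets with the same hull would break antisymmetry. *)
Definition hook S x : nat := #|[set y in S | le y x]|.
Definition top_down (s : seq T) : bool := pairwise (fun x y => ~~ le x y) s.
Definition orders S : nat := count top_down (permutations (enum S)).
Definition is_root S x : bool := [forall y in S, (y != x) ==> ~~ le x y].

(** The first element of a top-down order has nothing else above it, and what follows is a top-down
    order of the rest. *)
Lemma orders_step S : S != finset.set0 ->
  orders S = (\sum_(x in S | is_root S x) orders (S :\ x))%N.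
Proof.
move=> S0; have eS0 : enum S != [::].
  by apply: contraNneq S0 => e; rewrite -cards_eq0 cardE e.
rewrite /orders (permP (permutationsE _)); last by case: (enum S) eS0.
rewrite undup_id ?enum_uniq // count_flatten sumnE !big_map.
rewrite -[RHS]big_enum_cond /= [RHS]big_mkcond /= big_seq [RHS]big_seq.
apply: eq_bigr => x; rewrite mem_enum => xS.
have remE : perm_eq (rem x (enum S)) (enum (S :\ x)).
  apply: uniq_perm; rewrite ?rem_uniq ?enum_uniq // => y.
  by rewrite mem_rem_uniq ?enum_uniq // !inE !mem_enum !inE.
have rootE t : t \in permutations (rem x (enum S)) ->
    all (fun y => ~~ le x y) t = is_root S x.
  rewrite mem_permutations => tp; apply/allP/forall_inP => h y.
    move=> yS; apply/implyP => yx; apply: h.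
    by rewrite (perm_mem tp) (perm_mem remE) mem_enum !inE yx.
  rewrite (perm_mem tp) (perm_mem remE) mem_enum !inE => /andP[yx yS].
  exact: implyP (h y yS) yx.
rewrite count_map; case: ifP => rx; last first.
  apply/eqP; rewrite eqn0Ngt -has_count; apply/hasPn => t tp.
  by rewrite /= /top_down /= (rootE t tp) rx.
rewrite -(permP (perm_permutations remE)); apply: eq_in_count => t tp.
by rewrite /= /top_down /= (rootE t tp) rx.
Qed.

(** Among the elements above [y] take one with the largest hook: anything strictly above it would
    have a strictly larger hook. *)
Lemma root_above S y : S \subset D -> y \in S ->
  exists x, [/\ x \in S, is_root S x & le y x].
Proof.
move=> /fintype.subsetP SD yS; pose P x := (x \in S) && le y x.
have Py : P y by rewrite /P yS le_refl // SD.
case: (arg_maxnP (hook S) Py) => x /andP[xS yx] xmax; exists x; split=> //.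
apply/forall_inP => z zS; apply/implyP => zx; apply/negP => xz.
have Pz : P z by rewrite /P zS (le_trans _ _ _ yx xz) ?SD.
have := xmax z Pz; apply/negP; rewrite -ltnNge; apply: proper_card; apply/properP.
split.
  apply/fintype.subsetP => t; rewrite !inE => /andP[tS tx].
  by rewrite tS (le_trans _ _ _ tx xz) ?SD.
exists z; rewrite !inE zS; first by rewrite le_refl ?SD.
by apply: contra zx => /= zx'; apply/eqP/le_anti; rewrite ?SD // zx' xz.
Qed.

(** Each element lies below exactly one root: two roots above it would be comparable by the forest
    property, hence equal. *)
Lemma sum_root_hooks S : S \subset D -> (\sum_(x in S | is_root S x) hook S x = #|S|)%N.
Proof.
move=> SD; have inD x : x \in S -> x \in D by move/(fintype.subsetP SD).
under eq_bigr => x _ do rewrite /hook -sum1_card big_mkcond.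
rewrite exchange_big /= -sum1_card [RHS]big_mkcond; apply: eq_bigr => y _.
have [yS|yS] := boolP (y \in S); last first.
  by rewrite big1 // => x _; rewrite inE (negPf yS).
have [x [xS rx yx]] := root_above SD yS.
rewrite (bigD1 x) /=; last by rewrite xS.
rewrite inE yS yx big1 // => x' /andP[/andP[xS' rx'] xx'].
rewrite inE yS; case: ifP => // yx'.
have := le_forest (inD _ yS) (inD _ xS) (inD _ xS') yx yx'.
have := forall_inP rx _ xS'; have := forall_inP rx' _ xS.
by rewrite xx' eq_sym xx' /= => /negPf -> /negPf ->.
Qed.

(* An order starts with a root; removing a root does not change the hooks of
   the other elements, and the hooks of the roots add up to #|S|. *)
Theorem hook_length S : S \subset D -> (orders S * \prod_(x in S) hook S x = (#|S|)`!)%N.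
Proof.
move: {2}#|S| (erefl #|S|) => n; elim: n S => [|n IH] S cS SD.
  have -> : S = finset.set0 by apply/eqP; rewrite -cards_eq0 cS.
  by rewrite cards0 big_set0 /orders enum_set0.
rewrite orders_step; last by rewrite -cards_eq0 cS.
rewrite big_distrl /= cS factS -cS -(sum_root_hooks SD) big_distrl /=.
apply: eq_bigr => x /andP[xS rx].
rewrite (bigD1 x) //= mulnCA; congr (_ * _)%N.
have cSx : #|S :\ x| = n by apply/eqP; rewrite -eqSS -cS (cardsD1 x S) xS.
rewrite -cSx -(IH _ cSx); last by apply: fintype.subset_trans SD; exact: subsetDl.
congr (_ * _)%N; apply: eq_big => [y|y /andP[yS yx]]; first by rewrite !inE andbC.
rewrite /hook; apply: eq_card => z; rewrite !inE; case: eqP => [->|] //=.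
have := forall_inP rx y yS; rewrite yx /= => /negPf ->.
by rewrite andbF.
Qed.

End HookLength.

(** * Crossing and nesting of blocks in terms of labels *)

Section BlockLabels.
Variables (k r : nat) (pi : {set {set 'I_k}}).
Hypothesis kr : k = r.*2.
Hypothesis ppi : pair_partition pi.

Definition nested (V W : {set 'I_k}) : bool := V \subset hull W.

Lemma pair_partition_triv : finset.trivIset pi.
Proof. by case/andP: ppi => /and3P[]. Qed.

Lemma pair_partition_card V : V \in pi -> #|V| = 2%N.
Proof. by case/andP: ppi => _ /forall_inP two /two/eqP. Qed.

Lemma block_pair V : V \in pi -> exists u v : 'I_k, (u < v)%N /\ V = [set u; v].
Proof.
move=> /pair_partition_card/eqP/cards2P[u [v [uv ->]]].
have [?|?|/val_inj e] := ltngtP u v; [by exists u, v | | by rewrite e eqxx in uv].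
by exists v, u; rewrite finset.setUC.
Qed.

Lemma mem_hull (u v i : 'I_k) : (u < v)%N -> (i \in hull [set u; v]) = (u <= i <= v)%N.
Proof.
move=> uv; rewrite inE; apply/exists_inP/idP => [[x]|/andP[ui iv]]; last first.
  exists u; rewrite ?set21 //; apply/exists_inP; exists v; rewrite ?set22 //.
  by rewrite ui.
rewrite !inE => /orP[]/eqP-> /exists_inP[y]; rewrite !inE => /orP[]/eqP-> /andP[h1 h2].
- by rewrite h1 (leq_trans h2 (ltnW uv)).
- by rewrite h1.
- by move: (leq_trans (leq_trans uv h1) h2); rewrite ltnn.
- by rewrite (leq_trans (ltnW uv) h1).
Qed.

Lemma nested_pair (u v u' v' : 'I_k) : (u < v)%N -> (u' < v')%N ->
  nested [set u; v] [set u'; v'] = (u' <= u)%N && (v <= v')%N.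
Proof.
move=> uv uv'; apply/fintype.subsetP/andP => [sub|[uu vv] i].
  have := sub u (set21 _ _); have := sub v (set22 _ _).
  by rewrite !mem_hull // => /andP[_ ->] /andP[->].
case/set2P=> ->; rewrite mem_hull //.
  by rewrite uu (leq_trans (ltnW uv)).
by rewrite vv (leq_trans uu (ltnW uv)).
Qed.

Lemma noncrossingP : reflect
  (forall p1 q1 p2 q2 : 'I_k, (p1 < q1)%N -> (q1 < p2)%N -> (p2 < q2)%N ->
     [set p1; p2] \in pi -> [set q1; q2] \in pi -> False)
  (noncrossing pi).
Proof.
apply: (iffP forall_inP) => [nc p1 q1 p2 q2 l1 l2 l3 Vpi Wpi|nc V Vpi].
  have VW : [set p1; p2] != [set q1; q2].
    apply/eqP => e; have := set21 p1 p2; rewrite e !inE => /orP[]/eqP e'.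
      by rewrite e' ltnn in l1.
    by have := ltn_trans l1 (ltn_trans l2 l3); rewrite e' ltnn.
  have := forall_inP (nc _ Vpi) _ Wpi; rewrite VW /= => /negP; apply.
  apply/exists_inP; exists p1; rewrite ?set21 //; apply/exists_inP; exists q1; rewrite ?set21 //.
  apply/exists_inP; exists p2; rewrite ?set22 //; apply/exists_inP; exists q2; rewrite ?set22 //.
  by rewrite l1 l2.
apply/forall_inP => W Wpi; apply/implyP => VW; apply/negP.
case/exists_inP=> p1 p1V /exists_inP[q1 q1W /exists_inP[p2 p2V
  /exists_inP[q2 q2W /and3P[l1 l2 l3]]]].
have mk (X : {set 'I_k}) (x y : 'I_k) :
    X \in pi -> x \in X -> y \in X -> (x < y)%N -> X = [set x; y].
  move=> /pair_partition_card cX xX yX xy; apply/esym/eqP; rewrite eqEcard cX cards2.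
  rewrite (neq_ltn x y) xy andbT; apply/fintype.subsetP => z.
  by rewrite !inE => /orP[]/eqP->.
apply: (nc p1 q1 p2 q2) => //.
  by rewrite -(mk V) // (ltn_trans l1).
by rewrite -(mk W) // (ltn_trans l2).
Qed.

Lemma disjoint_blocks (u v u' v' : 'I_k) : [set u; v] \in pi -> [set u'; v'] \in pi ->
  [set u; v] = [set u'; v'] \/ [/\ u != u', u != v', v != u' & v != v'].
Proof.
move=> Vpi Wpi; have [|ne] := eqVneq [set u; v] [set u'; v']; first by left.
right; have /pred0P dis := finset.trivIsetP pair_partition_triv _ _ Vpi Wpi ne.
by split; apply/eqP => e; [have := dis u | have := dis u | have := dis v | have := dis v];
  rewrite /= !inE e !eqxx ?orbT.
Qed.

Lemma nested_trans : {in pi & &, transitive nested}.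
Proof.
move=> W V X Wpi Vpi Xpi.
have [u [v [uv ->]]] := block_pair Vpi; have [u' [v' [uv' ->]]] := block_pair Wpi.
have [u2 [v2 [uv2 ->]]] := block_pair Xpi; rewrite !nested_pair //.
by move=> /andP[h1 h2] /andP[h3 h4]; rewrite (leq_trans h3) ?(leq_trans h2).
Qed.

Lemma nested_refl : {in pi, reflexive nested}.
Proof. by move=> V /block_pair[u [v [uv ->]]]; rewrite nested_pair // !leqnn. Qed.

Lemma nested_anti : {in pi &, antisymmetric nested}.
Proof.
move=> V W /block_pair[u [v [uv ->]]] /block_pair[u' [v' [uv' ->]]].
rewrite !nested_pair // => /andP[/andP[h1 h2] /andP[h3 h4]].
by congr [set _; _]; apply/val_inj/eqP; rewrite eqn_leq; apply/andP.
Qed.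

(** Two blocks whose hulls both contain [X] have overlapping hulls; if neither contained the other,
    their endpoints would interlace. *)
Lemma nested_forest : noncrossing pi ->
  {in pi & &, forall X V W, nested X V -> nested X W -> nested V W || nested W V}.
Proof.
move=> /noncrossingP nc X V W Xpi Vpi Wpi.
have [x [y [xy XE]]] := block_pair Xpi.
have [u [v [uv VE]]] := block_pair Vpi; have [u' [v' [uv' WE]]] := block_pair Wpi.
rewrite XE VE WE in Xpi Vpi Wpi *; rewrite !nested_pair //.
move=> /andP[h1 h2] /andP[h3 h4].
have [E|[n1 n2 n3 n4]] := disjoint_blocks Vpi Wpi.
  by move: (nested_pair uv uv'); rewrite -E nested_refl // => <-.
have uv'l : (u < v')%N by apply: leq_ltn_trans h1 (leq_trans xy h4).
have u'vl : (u' < v)%N by apply: leq_ltn_trans h3 (leq_trans xy h2).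
have [uu|uu] := leqP u' u; have [vv|vv] := leqP v v'; rewrite ?(ltnW uu) ?(ltnW vv) ?orbT //=.
  have uu' : (u' < u)%N by rewrite ltn_neqAle uu eq_sym n1.
  by case: (nc u' u v' v).
have vv' : (v < v')%N by rewrite ltn_neqAle vv n4.
by case: (nc u u' v v').
Qed.

Lemma tau_fact_hooks : tau_fact pi = (\prod_(V in pi) hook nested pi V)%N.
Proof. by []. Qed.

Lemma orders_tau : noncrossing pi -> (orders nested pi * tau_fact pi = r`!)%N.
Proof.
move=> nc; rewrite tau_fact_hooks -(card_pair_partition kr ppi).
apply: (hook_length nested_refl nested_trans nested_anti (nested_forest nc)).
exact: fintype.subxx.
Qed.

Section Labels.
Variable s : seq {set 'I_k}.
Hypothesis sp : s \in permutations (enum pi).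
Let f := block_label pi s.

Lemma mem_order V : (V \in s) = (V \in pi).
Proof. by move: sp; rewrite mem_permutations => /perm_mem ->; rewrite mem_enum. Qed.

Lemma pblock_pi l : finset.pblock pi l \in pi.
Proof.
by case/andP: ppi => /and3P[/eqP cov _ _] _; apply: pblock_mem; rewrite cov inE.
Qed.

Lemma mem_own_pblock l : l \in finset.pblock pi l.
Proof.
by case/andP: ppi => /and3P[/eqP cov _ _] _; rewrite mem_pblock cov inE.
Qed.

Lemma label_eq u v : (f u == f v) = (finset.pblock pi u == finset.pblock pi v).
Proof.
apply/eqP/eqP => [e|e]; last by rewrite /f /block_label e.
rewrite -(nth_index finset.set0 (s := s) (x := finset.pblock pi u)) ?mem_order ?pblock_pi //.
rewrite -/(block_label pi s u) -/f e.
by rewrite nth_index ?mem_order ?pblock_pi.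
Qed.

Lemma label_block V u v : V \in pi -> u \in V -> v \in V -> f u = f v.
Proof.
move=> Vpi uV vV; apply/eqP; rewrite label_eq.
by rewrite !(def_pblock pair_partition_triv Vpi).
Qed.

Lemma label_of_block V u : V \in pi -> u \in V -> f u = index V s.
Proof. by move=> Vpi uV; rewrite /f /block_label (def_pblock pair_partition_triv Vpi). Qed.

Lemma label_pair v w : v != w -> f v = f w -> [set v; w] \in pi.
Proof.
move=> vw /eqP; rewrite label_eq => /eqP e.
suff -> : [set v; w] = finset.pblock pi v by exact: pblock_pi.
apply/eqP; rewrite eqEcard (pair_partition_card (pblock_pi _)) cards2 vw andbT.
by apply/fintype.subsetP => z; rewrite !inE => /orP[]/eqP->;
  rewrite ?mem_own_pblock // e mem_own_pblock.
Qed.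

Lemma label_paired : paired f (enum 'I_k).
Proof.
move=> t _; rewrite -(pair_partition_card (pblock_pi t)) cardE.
rewrite size_filter enumT; apply: eq_count => u; rewrite /= label_eq.
apply/eqP/idP => [<-|ut]; first exact: mem_own_pblock.
by rewrite (def_pblock pair_partition_triv (pblock_pi t) ut).
Qed.

Lemma label_crossing_free : crossing_free f (enum 'I_k) <-> noncrossing pi.
Proof.
split=> [nc|/noncrossingP nc p1 q1 p2 q2 _ _ _ _ l1 l2 l3 /eqP e1 /eqP e2].
  apply/noncrossingP => p1 q1 p2 q2 l1 l2 l3 Vpi Wpi.
  have e : f p1 = f q1.
    apply: (nc p1 q1 p2 q2); rewrite ?mem_enum //.
      by apply: (label_block Vpi); rewrite ?set21 ?set22.
    by apply: (label_block Wpi); rewrite ?set21 ?set22.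
  have : [set p1; q1] \in pi by apply: label_pair; rewrite // neq_ltn l1.
  move=> Xpi; have [E|[]] := disjoint_blocks Xpi Vpi; last by rewrite eqxx.
  have := set22 p1 q1; rewrite E !inE => /orP[]/eqP e'.
    by rewrite e' ltnn in l1.
  by rewrite e' ltnn in l2.
exfalso; apply: (nc p1 q1 p2 q2) => //; apply: label_pair; rewrite ?(eqP e1) ?(eqP e2) //.
  by rewrite neq_ltn (ltn_trans l1).
by rewrite neq_ltn (ltn_trans l2).
Qed.

(** A block inside another puts one of its endpoints strictly between the outer ones. Conversely, a
    position strictly between the endpoints of a block belongs to a nested block, because [pi] has
    no crossing. *)
Lemma label_inward : noncrossing pi ->
  (inward f (enum 'I_k) <-> top_down nested s).
Proof.
move=> ncpi; have us : uniq s.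
  by move: sp; rewrite mem_permutations => /perm_uniq ->; exact: enum_uniq.
split=> [iw|/(pairwiseP finset.set0) td u t v _ _ _ l1 l2 e].
  apply/(pairwiseP finset.set0) => i j; rewrite !inE => si sj ij; apply/negP.
  set V := nth _ s i; set W := nth _ s j.
  have Vpi : V \in pi by rewrite -mem_order mem_nth.
  have Wpi : W \in pi by rewrite -mem_order mem_nth.
  have iV : index V s = i by exact: index_uniq.
  have jW : index W s = j by exact: index_uniq.
  have [u [v [uv VE]]] := block_pair Vpi; have [u' [v' [uv' WE]]] := block_pair Wpi.
  rewrite VE WE nested_pair // => /andP[h1 h2].
  have : [set u; v] = [set u'; v'] \/ [/\ u != u', u != v', v != u' & v != v'].
    by apply: disjoint_blocks; rewrite -?VE -?WE.
  case=> [E|[n1 _ _ _]]; first by move: ij; rewrite -iV -jW VE WE E ltnn.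
  have u'u : (u' < u)%N by rewrite ltn_neqAle h1 eq_sym n1.
  have fu : f u = i by rewrite (label_of_block Vpi) // VE set21.
  have fu' : f u' = j by rewrite (label_of_block Wpi) // WE set21.
  have fv' : f v' = j by rewrite (label_of_block Wpi) // WE set22.
  have h := iw u' u v'; rewrite !mem_enum fu fu' fv' in h.
  by have := h isT isT isT u'u (leq_trans uv h2) erefl; rewrite leqNgt ij.
have uv : (u < v)%N by apply: ltn_trans l1 l2.
have Vpi : [set u; v] \in pi by apply: label_pair; rewrite // neq_ltn uv.
have [w [x [wx WE]]] := block_pair (pblock_pi t).
have Wpi : [set w; x] \in pi by rewrite -WE; exact: pblock_pi.
have tW : t \in [set w; x] by rewrite -WE; exact: mem_own_pblock.
have [E|[n1 n2 n3 n4]] := disjoint_blocks Wpi Vpi.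
  by rewrite (label_block Wpi (u := u) (v := t)) // E set21.
have nest : nested [set w; x] [set u; v].
  rewrite nested_pair //; move/noncrossingP: ncpi => nc.
  move: tW; rewrite !inE => /orP[]/eqP tE; rewrite tE in l1 l2.
    rewrite (ltnW l1) /= leqNgt; apply/negP => vx.
    exact: (nc u w v x).
  rewrite (ltnW l2) andbT leqNgt; apply/negP => wu.
  exact: (nc w u x v).
rewrite leqNgt (label_of_block Vpi (set21 u v)) (label_of_block Wpi tW).
apply/negP => lt.
have := td (index [set w; x] s) (index [set u; v] s).
rewrite !inE !index_mem !mem_order Vpi Wpi !nth_index ?mem_order // nest.
by move=> /(_ isT isT lt).
Qed.

(** In a crossing each pair has an endpoint inside the other, so the two labels bound each other and
    coincide. *)
Lemma inward_noncrossing : inward f (enum 'I_k) -> noncrossing pi.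
Proof.
move=> iw; apply/label_crossing_free => p1 q1 p2 q2 _ _ _ _ l1 l2 l3 e1 e2.
apply/eqP; rewrite eqn_leq (iw p1 q1 p2) ?mem_enum //= e1.
by apply: (iw q1 p2 q2); rewrite ?mem_enum.
Qed.

End Labels.
End BlockLabels.

(** * Leading terms and limits *)

Section LeadingTerms.
Variables (K : fieldType) (A B : algType K).
Variables (iota : {lrmorphism B -> A}) (E E' : {linear A -> B}).
Variables (a : nat -> A) (S : nat -> set A) (i0 : nat).
Hypothesis sp : infinitesimal_prob_space iota E E'.
Hypothesis id_distr : identically_distributed iota E E' a.
Hypothesis fam : algebra_family iota a S.
Hypothesis Ea : forall i, E (a i) = 0.
Hypothesis E'a : forall i, E' (a i) = 0.
Variables (k : nat).
Local Notation centered_word := (centered_word iota E E' a S i0).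
Local Notation Et := (dual_E E E').
Local Notation Ft := (dual_family iota a S).

Definition position_word (c : 'I_k -> nat -> A) : seq ('I_k * (nat -> A)) :=
  [seq (l, c l) | l <- enum 'I_k].

Lemma labels_position_word c : labels (position_word c) = enum 'I_k.
Proof. by rewrite /labels -map_comp map_id. Qed.

Lemma ev_position_word f c : ev f (position_word c) = \prod_l c l (f l).
Proof. by rewrite /ev big_map enumT. Qed.

Lemma position_word_centered c : (forall l, centered_family iota E E' a S i0 (c l)) ->
  centered_word (position_word c).
Proof. by move=> cc; apply/allP => -[l d] /mapP[l' _ [-> ->]]; exact: cc. Qed.

Lemma centered_gen : centered_family iota E E' a S i0 a.
Proof. by rewrite /centered_family family_gen // Ea E'a eqxx. Qed.

Lemma centered_scaled_gen b : centered_family iota E E' a S i0 (fun i => a i * iota b).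
Proof. by have /andP[_] := centered_family_absorb sp fam b centered_gen. Qed.

Definition law_letter (b : nat -> B) (l : 'I_k) (i : nat) : A := eta_args iota (a i) b l.

Lemma centered_law_letter b l : centered_family iota E E' a S i0 (law_letter b l).
Proof.
rewrite /law_letter /eta_args; case: eqP => _; first exact: centered_gen.
exact: centered_scaled_gen.
Qed.

Lemma moments_spread (f g : 'I_k -> nat) (c : 'I_k -> nat -> A) :
  (forall l, centered_family iota E E' a S i0 (c l)) ->
  spreads_from Et Ft (@same_order 'I_k) -> same_order f g ->
  E (\prod_l c l (f l)) = E (\prod_l c l (g l)) /\
  E' (\prod_l c l (f l)) = E' (\prod_l c l (g l)).
Proof.
move=> cc spr fg; rewrite -!ev_position_word.
by apply: (plain_spread fam spr fg); exact: position_word_centered.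
Qed.

Lemma moments_singleton (f : 'I_k -> nat) (L : nat) (c : 'I_k -> nat -> A) :
  (forall l, centered_family iota E E' a S i0 (c l)) ->
  singletons_vanish Et Ft 'I_k -> count (fun t => f t == L) (enum 'I_k) = 1%N ->
  E (\prod_l c l (f l)) = 0 /\ E' (\prod_l c l (f l)) = 0.
Proof.
move=> cc sing c1; rewrite -!ev_position_word.
apply: (plain_singleton sp id_distr fam (L := L) sing); first exact: position_word_centered.
by rewrite labels_position_word.
Qed.

Section PairMoments.
Variables (r : nat) (b : nat -> B).
Hypothesis kr : k = r.+1.*2.
Let W := position_word (law_letter b).
Let cW : centered_word W := position_word_centered (centered_law_letter b).

Lemma enum_increasing : increasing (enum 'I_k).
Proof.
have : sorted ltn (map val (enum 'I_k)) by rewrite val_enum_ord iota_ltn_sorted.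
rewrite sorted_map /increasing -sorted_pairwise //.
by move=> x y z; exact: ltn_trans.
Qed.

Lemma reducible_moment pi f : pair_partition pi ->
  reducible iota E E' a S i0 pi f (enum 'I_k) ->
  E (ev f W) = eta_part iota E (a i0) pi b /\
  E' (ev f W) = deta_part iota E E' (a i0) pi b.
Proof.
move=> ppi red; have cpi := card_pair_partition kr ppi.
have [||||-> ->] := evaluation sp fam (pair_partition_triv ppi)
  (pair_partition_card ppi) red (n := r) (W := W).
- by rewrite size_enum_ord.
- exact: enum_uniq.
- exact: labels_position_word.
- exact: cW.
have prE phi : part_word iota i0 pi phi r.+1 W = part_map iota pi phi (eta_args iota (a i0) b).
  by rewrite /part_word /part_map cpi /at_ref /W /position_word -map_comp.
split; first exact: prE.
rewrite /deta_part /dE_part; apply: eq_big => [V|V _]; last exact: prE.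
have [Vpi|//] := boolP (V \in pi).
by apply/fintype.subsetP => t _; rewrite inE mem_enum.
Qed.

Let Mom (f : 'I_k -> nat) : B := E (\prod_l law_letter b l (f l)).
Let Mom' (f : 'I_k -> nat) : B := E' (\prod_l law_letter b l (f l)).

Lemma NC2E pi : (pi \in NC2 k) = pair_partition pi && noncrossing pi.
Proof. by rewrite inE andbA. Qed.

(** [good pi s] selects the orderings of the blocks that contribute: all of them in the free case,
    the top-down ones in the monotone case. *)
Lemma leading_sum (M : ('I_k -> nat) -> B) (v : {set {set 'I_k}} -> B)
    (good : {set {set 'I_k}} -> pred (seq {set 'I_k})) :
  (forall f L, count (fun t => f t == L) (enum 'I_k) = 1%N -> M f = 0) ->
  (forall pi s, pair_partition pi -> s \in permutations (enum pi) ->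
    M (block_label pi s) = if noncrossing pi && good pi s then v pi else 0) ->
  onto_sum M r.+1 = \sum_(pi in NC2 k) v pi *+ count (good pi) (permutations (enum pi)).
Proof.
move=> sing val; rewrite onto_sum_pairs // two_to_one_sum //.
rewrite [RHS](eq_bigl _ _ NC2E) [RHS]big_mkcondr /=; apply: eq_bigr => pi ppi.
rewrite (eq_big_seq _ (fun s => val pi s ppi)) /=.
case: noncrossing; last by rewrite big1.
by rewrite -big_mkcond big_const_seq iter_addr_0.
Qed.

Section Free.
Hypothesis SB : forall i b, S i (iota b).
Hypothesis free : infinitesimally_free iota E E' S.

Lemma free_singletons_vanish : singletons_vanish Et Ft 'I_k.
Proof.
apply: (free_singleton (dual_ncps sp id_distr fam)); last exact: free_dual_words.
move=> e b1 /andP[F1 F2]; rewrite /dual_family /=.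
by apply/andP; split; exact: family_sub_const.
Qed.

(** The conjunct [true] is the value of [good] expected by [leading_sum]. *)
Lemma free_block_moment pi s : pair_partition pi -> s \in permutations (enum pi) ->
  Mom (block_label pi s) = (if noncrossing pi && true then eta_part iota E (a i0) pi b else 0) /\
  Mom' (block_label pi s) = (if noncrossing pi && true then deta_part iota E E' (a i0) pi b else 0).
Proof.
move=> ppi sp'; rewrite /Mom /Mom' -!ev_position_word -/W andbT.
have e0 : enum 'I_k <> [::] by move/(congr1 size); rewrite size_enum_ord kr.
have pF := free_pairF sp id_distr fam SB free (i0 := i0) (f := block_label pi s).
have aF := free_altF sp id_distr fam SB free (i0 := i0) (f := block_label pi s).
have [red van] := free_reduction sp fam (label_pair ppi sp')
  pF aF enum_increasing (label_paired ppi sp') e0.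
have ncE := label_crossing_free ppi sp'.
case: ifPn => nc; first by apply: reducible_moment => //; apply: red; apply/ncE.
by apply: (van _ W) => //; [move/ncE; exact/negP | exact: labels_position_word].
Qed.

Lemma free_leading :
  onto_sum Mom r.+1 = \sum_(pi in NC2 k) eta_part iota E (a i0) pi b *+ (r.+1)`! /\
  onto_sum Mom' r.+1 = \sum_(pi in NC2 k) deta_part iota E E' (a i0) pi b *+ (r.+1)`!.
Proof.
have cnt pi : pi \in NC2 k -> count xpredT (permutations (enum pi)) = (r.+1)`!.
  rewrite NC2E => /andP[ppi _].
  by rewrite count_predT size_permutations ?enum_uniq // -cardE (card_pair_partition kr ppi).
have sing f L (c1 : count (fun t => f t == L) (enum 'I_k) = 1%N) :=
  moments_singleton (centered_law_letter b) free_singletons_vanish c1.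
split.
  rewrite (@leading_sum Mom (fun pi => eta_part iota E (a i0) pi b) (fun=> xpredT)).
  - by apply: eq_bigr => pi /cnt ->.
  - by move=> f L /sing[].
  - by move=> pi s ppi /(free_block_moment ppi)[].
rewrite (@leading_sum Mom' (fun pi => deta_part iota E E' (a i0) pi b) (fun=> xpredT)).
- by apply: eq_bigr => pi /cnt ->.
- by move=> f L /sing[].
- by move=> pi s ppi /(free_block_moment ppi)[].
Qed.
End Free.

Section Monotone.
Hypothesis mono : infinitesimally_monotone iota E E' S.

Lemma mono_block_moment pi s : pair_partition pi -> s \in permutations (enum pi) ->
  Mom (block_label pi s) =
    (if noncrossing pi && top_down (@nested k) s then eta_part iota E (a i0) pi b else 0) /\
  Mom' (block_label pi s) =
    (if noncrossing pi && top_down (@nested k) s then deta_part iota E E' (a i0) pi b else 0).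
Proof.
move=> ppi sp'; rewrite /Mom /Mom' -!ev_position_word -/W.
have pM := mono_pairM sp id_distr fam mono (i0 := i0) (f := block_label pi s).
have peM := mono_peakM sp id_distr fam mono (i0 := i0) (f := block_label pi s).
have [red van] := monotone_reduction sp fam (label_pair ppi sp')
  pM peM enum_increasing (label_paired ppi sp').
have iwE : noncrossing pi && top_down (@nested k) s <->
    inward (block_label pi s) (enum 'I_k).
  split=> [/andP[nc td]|iw]; first by apply/(label_inward ppi sp' nc).
  have nc := inward_noncrossing ppi sp' iw; rewrite nc /=.
  by apply/(label_inward ppi sp' nc).
case: ifPn => iw; first by apply: reducible_moment => //; apply: red; apply/iwE.
by apply: (van _ W) => //; [move/iwE; exact/negP | exact: labels_position_word].
Qed.

Lemma mono_singletons_vanish : singletons_vanish Et Ft 'I_k.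
Proof.
apply: (mono_singleton (dual_ncps sp id_distr fam)).
exact: monotone_dual_words.
Qed.

Lemma mono_leading :
  onto_sum Mom r.+1 =
    \sum_(pi in NC2 k) eta_part iota E (a i0) pi b *+ orders (@nested k) pi /\
  onto_sum Mom' r.+1 =
    \sum_(pi in NC2 k) deta_part iota E E' (a i0) pi b *+ orders (@nested k) pi.
Proof.
have sing f L (c1 : count (fun t => f t == L) (enum 'I_k) = 1%N) :=
  moments_singleton (centered_law_letter b) mono_singletons_vanish c1.
split.
  rewrite (@leading_sum Mom (fun pi => eta_part iota E (a i0) pi b)
    (fun=> top_down (@nested k))) //.
    by move=> f L /sing[].
  by move=> pi s ppi /(mono_block_moment ppi)[].
rewrite (@leading_sum Mom' (fun pi => deta_part iota E E' (a i0) pi b)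
  (fun=> top_down (@nested k))) //.
  by move=> f L /sing[].
by move=> pi s ppi /(mono_block_moment ppi)[].
Qed.
End Monotone.

End PairMoments.
Section Boolean.
Variables (r : nat) (b : nat -> B) (eta eta' : B -> B).
Hypothesis kr : k = r.*2.
Hypothesis r_gt0 : (0 < r)%N.
Hypothesis hbool : infinitesimally_boolean E E' S.
Hypothesis etaE : forall c, eta c = E (a i0 * iota c * a i0).
Hypothesis eta'E : forall c, eta' c = E' (a i0 * iota c * a i0).

(** Unlike in [law_letter], the last letter too carries its coefficient, as each Bernoulli factor is
    [eta (b l.*2.+1) * b l.*2.+2]. *)
Definition scaled_letter (l : 'I_k) (i : nat) : A := a i * iota (b l.+1).
Let W := position_word scaled_letter.
Let MomB (f : 'I_k -> nat) : B := E (\prod_l scaled_letter l (f l)).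
Let MomB' (f : 'I_k -> nat) : B := E' (\prod_l scaled_letter l (f l)).

Lemma centered_scaled_letter l : centered_family iota E E' a S i0 (scaled_letter l).
Proof. exact: centered_scaled_gen. Qed.

Lemma even_lt l : (l < r)%N -> (l.*2 < k)%N. Proof. by rewrite kr ltn_double. Qed.
Lemma odd_lt l : (l < r)%N -> (l.*2.+1 < k)%N.
Proof. by rewrite kr -doubleS => lr; rewrite ltn_Sdouble. Qed.
Lemma half_lt (i : 'I_k) : (i./2 < r)%N.
Proof. by rewrite ltn_half_double -kr. Qed.

Definition even_ord (l : 'I_r) : 'I_k := Ordinal (even_lt (ltn_ord l)).
Definition odd_ord (l : 'I_r) : 'I_k := Ordinal (odd_lt (ltn_ord l)).
Definition half_ord (i : 'I_k) : 'I_r := Ordinal (half_lt i).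

Lemma half_even l : half_ord (even_ord l) = l.
Proof. by apply: val_inj; rewrite /= doubleK. Qed.
Lemma half_odd l : half_ord (odd_ord l) = l.
Proof. by apply: val_inj; rewrite /= uphalf_double. Qed.

Lemma even_or_odd i : i = even_ord (half_ord i) \/ i = odd_ord (half_ord i).
Proof.
have := odd_double_half i; case: (odd i) => /= e; [right|left]; apply: val_inj;
  by rewrite /= -[LHS]e.
Qed.

Definition matched (g : {ffun 'I_k -> 'I_r}) : bool :=
  [forall l, g (even_ord l) == g (odd_ord l)].

Definition spread_perm (h : {ffun 'I_r -> 'I_r}) : {ffun 'I_k -> 'I_r} :=
  [ffun i => h (half_ord i)].

(** A matched map factors through [half_ord], and it is two-to-one exactly when the induced map on
    ['I_r] is a permutation. *)
Lemma card_matched :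
  #|[set g : {ffun 'I_k -> 'I_r} | two_to_one g && matched g]| = r`!.
Proof.
have sp_inj : injective spread_perm.
  move=> h h' /ffunP e; apply/ffunP => l.
  by have := e (even_ord l); rewrite !ffunE half_even.
rewrite -[r in RHS]card_ord -ffactnn -card_inj_ffuns -(card_imset _ sp_inj).
apply: eq_card => g; rewrite inE; apply/andP/imsetP => [[tg mg]|[h]].
  pose h := [ffun l => g (even_ord l)].
  have gE : g = spread_perm h.
    apply/ffunP => i; rewrite !ffunE; have [{1}->|{1}->] // := even_or_odd i.
    by rewrite -(eqP (forallP mg _)).
  exists h => //; rewrite inE; apply/injectiveP.
  (* Every fibre of [g] is nonempty, so [h] is onto, hence injective by cardinality. *)
  have hT : [set h l | l : 'I_r] = [set: 'I_r].
    apply/finset.setP => y; rewrite inE.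
    have : (0 < #|[set x | g x == y]|)%N by rewrite (eqP (forallP tg y)).
    case/card_gt0P=> x; rewrite inE => /eqP <-.
    by rewrite gE ffunE; exact: imset_f.
  have /imset_injP hi : #|[set h l | l : 'I_r]| == #|'I_r| by rewrite hT cardsT.
  by move=> l l'; exact: hi.
rewrite inE => /injectiveP hi ->; split; last first.
  by apply/forallP => l; rewrite !ffunE half_even half_odd.
apply/forallP => y; have -> : y = h (invF hi y) by rewrite f_invF.
set l := invF hi y; have -> : [set x | spread_perm h x == h l] = [set even_ord l; odd_ord l].
  apply/finset.setP => i; rewrite !inE ffunE (inj_eq hi).
  apply/eqP/orP => [<-|[]/eqP->]; rewrite ?half_even ?half_odd //.
  by case: (even_or_odd i) => /eqP; [left|right].
by rewrite cards2 -val_eqE /= neq_ltn ltnSn.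
Qed.

Lemma two_to_one_paired (g : {ffun 'I_k -> 'I_r}) : two_to_one g ->
  paired (fun l => g l : nat) (enum 'I_k).
Proof. by move=> tg t _; rewrite (count_fibre g) (eqP (forallP tg _)). Qed.

Lemma nth_position_word z c l (lk : (l < k)%N) :
  nth z (position_word c) l = (Ordinal lk, c (Ordinal lk)).
Proof.
rewrite (nth_map (Ordinal lk)) ?size_enum_ord //.
have -> // : nth (Ordinal lk) (enum 'I_k) l = Ordinal lk.
by apply: val_inj; rewrite /= nth_enum_ord.
Qed.

Let valB : B := \prod_(l < r) (eta (b l.*2.+1) * b l.*2.+2).
Let valB' : B := \sum_(j < r) \prod_(l < r)
  ((if l == j :> nat then eta' else eta) (b l.*2.+1) * b l.*2.+2).

(** Both values are the components of a single product of dual pair means; its Leibniz expansion is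
    [valB']. *)
Lemma boolean_block_moment (g : {ffun 'I_k -> 'I_r}) : two_to_one g ->
  MomB (fun l => g l) = (if matched g then valB else 0) /\
  MomB' (fun l => g l) = (if matched g then valB' else 0).
Proof.
move=> tg; rewrite /MomB /MomB' -!ev_position_word -/W.
pose f (l : 'I_k) : nat := g l.
have cW : centered_word W by apply: position_word_centered => l; exact: centered_scaled_gen.
have sW : size W = r.*2 by rewrite size_map size_enum_ord.
have pW : paired f (labels W).
  by rewrite labels_position_word; exact: two_to_one_paired.
have nbE : neighbours f W r <-> matched g.
  split=> [nb|/forallP mg z l lr].
    apply/forallP => l; rewrite -val_eqE; apply/eqP.
    have := nb (even_ord l, a) l (ltn_ord l).
    by rewrite (nth_position_word _ _ (even_lt _)) (nth_position_word _ _ (odd_lt _)).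
  rewrite (nth_position_word _ _ (even_lt lr)) (nth_position_word _ _ (odd_lt lr)).
  have /eqP/(congr1 val) /= e := mg (Ordinal lr).
  by rewrite /f /= (bool_irrelevance (even_lt lr) (even_lt (ltn_ord (Ordinal lr))))
    (bool_irrelevance (odd_lt lr) (odd_lt (ltn_ord (Ordinal lr)))).
pose z : 'I_k * (nat -> A) := (even_ord (Ordinal r_gt0), a).
have [good bad] := boolean_pairs sp id_distr fam hbool z sW cW pW.
have pm (l : 'I_r) : pair_mean E E' i0 z W l =
    (eta (b l.*2.+1) * b l.*2.+2, eta' (b l.*2.+1) * b l.*2.+2).
  rewrite /pair_mean (nth_position_word _ _ (even_lt (ltn_ord l))).
  rewrite (nth_position_word _ _ (odd_lt (ltn_ord l))) /= /scaled_letter /=.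
  by rewrite !mulrA (iEr sp) (iE'r sp) -etaE -eta'E.
have both : Et (ev f (emb W)) = if matched g then (valB, valB') else 0.
  case: ifPn => mg; last first.
    have nn : ~ neighbours f W r by move=> /nbE; exact/negP.
    by rewrite (bad nn).
  have nb : neighbours f W r by exact/nbE.
  rewrite (good nb).
  rewrite (eq_bigr _ (fun l _ => pm l)) dual_prod; congr (_, _).
  apply: eq_bigr => j _; apply: eq_bigr => l _ /=.
  by rewrite val_eqE; case: ifP.
move: both; rewrite ev_emb /dual_E /= raddf0 add0r.
by case: ifP => _ [-> ->].
Qed.

Lemma boolean_singletons_vanish : singletons_vanish Et Ft 'I_k.
Proof.
apply: (boolean_singleton (dual_ncps sp id_distr fam)).
exact: boolean_dual_words.
Qed.

Lemma boolean_leading :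
  onto_sum MomB r = valB *+ r`! /\ onto_sum MomB' r = valB' *+ r`!.
Proof.
have sing f L (c1 : count (fun t => f t == L) (enum 'I_k) = 1%N) :=
  moments_singleton centered_scaled_letter boolean_singletons_vanish c1.
have sum M v : (forall g : {ffun 'I_k -> 'I_r}, two_to_one g ->
    M (fun l => g l : nat) = (if matched g then v else 0)) ->
    (forall f L, count (fun t => f t == L) (enum 'I_k) = 1%N -> M f = 0) ->
    onto_sum M r = v *+ r`! :> B.
  move=> Mv Ms; rewrite onto_sum_pairs // (eq_bigr _ Mv) -big_mkcondr /=.
  by rewrite sumr_const -card_matched; congr (_ *+ _); apply: eq_card => g; rewrite inE.
split; apply: sum => [g /boolean_block_moment[] //|f L /sing[] //].
Qed.
End Boolean.

End LeadingTerms.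

Lemma cvg_eventually (W : topologicalType) (u v : nat -> W) (l : W) N0 :
  (forall N, (N0 <= N)%N -> u N = v N) ->
  (u N @[N --> \oo] --> l)%classic -> (v N @[N --> \oo] --> l)%classic.
Proof.
move=> uv; apply: cvg_trans; apply: near_eq_cvg.
by exists N0 => // N /= /uv ->.
Qed.

(** * Limits of the normalized binomial coefficients *)

Section Limits.
Variables (K : numFieldType) (V : normedModType K) (t : nat -> K).
Hypothesis t_small : forall e : K, 0 < e -> exists N0, forall N, (N0 <= N)%N -> `|t N| < e.
Hypothesis t_sqr : forall N, t N ^+ 2 = N%:R^-1.

Lemma cvg_root : (t N @[N --> \oo] --> (0 : K))%classic.
Proof.
apply/cvgrPdist_lt => e e0; have [N0 tN] := t_small e0.
by exists N0 => // N /= /tN; rewrite sub0r normrN.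
Qed.

Lemma cvg_pow (u : nat -> K) (l : K) n : (u N @[N --> \oo] --> l)%classic ->
  ((u N) ^+ n @[N --> \oo] --> l ^+ n)%classic.
Proof.
move=> ul; elim: n => [|n IH].
  by under eq_fun do rewrite expr0; exact: cvg_cst.
by under eq_fun do rewrite exprS; rewrite exprS; exact: cvgM.
Qed.

(** The step multiplies by [(N - r) / N = 1 - r / N], legitimate once [N] exceeds [r]; that [1 / N]
    tends to zero comes from [t N ^+ 2]. *)
Lemma cvg_ffact r : ((N ^_ r)%:R * (N%:R^-1) ^+ r @[N --> \oo] --> (1 : K))%classic.
Proof.
elim: r => [|r IH].
  by under eq_fun do rewrite ffactn0 expr0 mulr1; exact: cvg_cst.
have lin : (1 - r%:R * (N%:R^-1 : K) @[N --> \oo] --> (1 : K))%classic.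
  have := cvg_pow (n := 2) cvg_root; rewrite expr0n /= => sq.
  have : (1 - r%:R * t N ^+ 2 @[N --> \oo] --> (1 - r%:R * 0 : K))%classic.
    by apply: cvgB; [exact: cvg_cst | apply: cvgM; [exact: cvg_cst | exact: sq]].
  by rewrite mulr0 subr0; under eq_fun do rewrite t_sqr.
have : ((N ^_ r)%:R * (N%:R^-1) ^+ r * (1 - r%:R * N%:R^-1) @[N --> \oo] -->
    (1 * 1 : K))%classic by exact: cvgM.
rewrite mulr1.
apply: (@cvg_eventually _ _ _ _ r.+1) => N rN.
have N0 : N%:R != 0 :> K by rewrite pnatr_eq0 -lt0n (leq_trans _ rN).
rewrite ffactnSr natrM natrB ?(ltnW rN) // exprSr.
rewrite mulrACA; congr (_ * _).
by rewrite mulrBl divff.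
Qed.

Lemma cvg_binomial r : ('C(N, r)%:R * (N%:R^-1) ^+ r @[N --> \oo] --> (r`!%:R^-1 : K))%classic.
Proof.
have f0 : r`!%:R != 0 :> K by rewrite pnatr_eq0 -lt0n fact_gt0.
have : ((N ^_ r)%:R * (N%:R^-1) ^+ r * r`!%:R^-1 @[N --> \oo] -->
    (1 * r`!%:R^-1 : K))%classic by apply: cvgM; [exact: cvg_ffact | exact: cvg_cst].
rewrite mul1r.
apply: (@cvg_eventually _ _ _ _ 0%N) => N _.
by rewrite -bin_ffact natrM mulrAC mulfK.
Qed.

Lemma cvg_coefficient k r : (r.*2 <= k)%N ->
  (t N ^+ k * 'C(N, r)%:R @[N --> \oo] -->
    (if k == r.*2 then r`!%:R^-1 else 0 : K))%classic.
Proof.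
move=> rk.
(* As [0 ^+ 0 = 1], one formula covers both cases, and the limit becomes that of a product. *)
have -> : (if k == r.*2 then r`!%:R^-1 else 0 : K) = 0 ^+ (k - r.*2) * r`!%:R^-1.
  rewrite expr0n subn_eq0 eqn_leq rk andbT.
  by case: (k <= r.*2)%N; rewrite ?mul1r ?mul0r.
have : (t N ^+ (k - r.*2) * ('C(N, r)%:R * (N%:R^-1) ^+ r) @[N --> \oo] -->
    (0 ^+ (k - r.*2) * r`!%:R^-1 : K))%classic.
  by apply: cvgM; [apply: cvg_pow; exact: cvg_root | exact: cvg_binomial].
apply: (@cvg_eventually _ _ _ _ 0%N) => N _.
rewrite mulrCA mulrC; congr (_ * _).
by rewrite -t_sqr -exprM mul2n -exprD subnK.
Qed.

Lemma cvg_moments k (c : nat -> V) :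
  (forall r, (k < r.*2)%N -> c r = 0) ->
  (t N ^+ k *: (\sum_(r < k.+1) c r *+ 'C(N, r)) @[N --> \oo] -->
    (if odd k then 0 else ((k./2)`!%:R^-1 *: c k./2)))%classic.
Proof.
move=> c0.
pose l r : K := if k == r.*2 then r`!%:R^-1 else 0.
have lim : (if odd k then 0 else ((k./2)`!%:R^-1 *: c k./2)) = \sum_(r < k.+1) l r *: c r.
  case: ifPn => ok; last first.
    have h : (k./2 < k.+1)%N by rewrite ltnS -leq_double even_halfK // -addnn leq_addr.
    rewrite (bigD1 (Ordinal h)) //= /l even_halfK // eqxx big1 ?addr0 // => r nr.
    case: eqP => [kr|_]; last by rewrite scale0r.
    have e : k./2 = r by rewrite [X in X./2]kr doubleK.
    by move: nr; rewrite -val_eqE /= e eqxx.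
  rewrite big1 // => r _; rewrite /l; case: eqP => [kr|_]; last by rewrite scale0r.
  by have := odd_double r; rewrite -kr ok.
rewrite lim; have -> : (fun N => t N ^+ k *: (\sum_(r < k.+1) c r *+ 'C(N, r))) =
    (fun N => \sum_(r < k.+1) (t N ^+ k * 'C(N, r)%:R) *: c r).
  apply: funext => N; rewrite scaler_sumr; apply: eq_bigr => r _.
  by rewrite -scaler_nat scalerA.
elim: (index_enum _) => [|r s IH].
  by under eq_fun do rewrite big_nil; rewrite big_nil; exact: cvg_cst.
under eq_fun do rewrite big_cons; rewrite big_cons; apply: cvgD => //.
(* For [k < r.*2] the coefficient diverges, but there [c r] is zero. *)
have [rk|kr] := leqP r.*2 k; first by apply: cvgZr_tmp; exact: cvg_coefficient.
rewrite c0 // scaler0; under eq_fun do rewrite scaler0; exact: cvg_cst.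
Qed.

End Limits.

Section ComplexRoot.
Variable R : realType.
Local Notation C := R[i].

Lemma root_small (e : C) : 0 < e -> exists N0, forall N, (N0 <= N)%N ->
  `|(sqrtC (N%:R : C))^-1| < e.
Proof.
move=> e0; have e2 : 0 < e ^- 2 by rewrite invr_gt0 exprn_gt0.
(* The order of [R[i]] is partial. Positivity forces the imaginary part of [e ^- 2] to be zero, and
   the archimedean bound is that of its real part. *)
have [n en] : exists n : nat, e ^- 2 < n%:R.
  move: e2; case: (e ^- 2) => x y; rewrite ltcE /= => /andP[/eqP y0 x0].
  exists (Num.bound x); rewrite -(rmorph_nat (real_complex R)) ltcE /= y0 eqxx /=.
  exact: archi_boundP (ltW x0).
exists n.+1 => N nN; have N0 : 0 < N%:R :> C by rewrite ltr0n (leq_trans _ nN).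
rewrite ger0_norm ?invr_ge0 ?sqrtC_ge0 ?ler0n //.
rewrite -[e]invrK ltf_pV2 ?posrE ?invr_gt0 ?sqrtC_gt0 //.
rewrite -(ltr_pXn2r (n := 2)) ?nnegrE ?invr_ge0 ?(ltW e0) ?sqrtC_ge0 ?(ltW N0) //.
rewrite sqrtCK exprVn; apply: lt_le_trans en _.
by rewrite ler_nat ltnW.
Qed.

Lemma root_sqr N : (sqrtC (N%:R : C))^-1 ^+ 2 = N%:R^-1.
Proof. by rewrite exprVn sqrtCK. Qed.

End ComplexRoot.

Section Generated.
Variables (K : fieldType) (A B : algType K) (iota : {lrmorphism B -> A}) (a : nat -> A).

Lemma alg_gen_const i b : alg_gen iota (a i) (iota b).
Proof. by move=> D [[DB _ _] _]; exact: DB. Qed.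

Lemma alg_gen_family : algebra_family iota a (fun i => alg_gen iota (a i)).
Proof.
split=> [i|i x y xS yS|i x y xS yS|i b x b' xS] D [sD aD].
- exact: aD.
- case: (sD) => _ lin _; rewrite -[x]scale1r; apply: lin; [exact: xS | exact: yS].
- by case: (sD) => _ _; apply; [exact: xS | exact: yS].
- case: (sD) => DB _ mul; apply: (mul); last exact: DB.
  by apply: mul; [exact: DB | exact: xS].
Qed.

Lemma nonunital_alg_gen_family :
  algebra_family iota a (fun i => nonunital_alg_gen iota (a i)).
Proof.
split=> [i|i x y xS yS|i x y xS yS|i b x b' xS] D [sD aD].
- exact: aD.
- case: (sD) => _ lin _ _; rewrite -[x]scale1r; apply: lin; [exact: xS | exact: yS].
- by case: (sD) => _ _ mul _; apply: mul; [exact: xS | exact: yS].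
- by case: (sD) => _ _ _; apply; exact: xS.
Qed.

End Generated.

(** * Expanding the moments of a sum *)

Section Expansion.
Variables (K : fieldType) (A B : algType K) (iota : {lrmorphism B -> A}) (a : nat -> A).
Variable X : {linear A -> B}.
Hypothesis Xl : forall b x, X (iota b * x) = b * X x.
Hypothesis Xr : forall x b, X (x * iota b) = X x * b.

Lemma prod_scale n (t : K) (x : 'I_n -> A) : \prod_l (t *: x l) = t ^+ n *: \prod_l x l.
Proof.
elim: n x => [|n IH] x; first by rewrite !big_ord0 scale1r.
by rewrite !big_ord_recl IH -scalerAl -scalerAr scalerA exprS.
Qed.

Lemma sandwich_sum t N b0 bs :
  X (sandwich iota (t *: \sum_(i < N) a i) b0 bs) =
  t ^+ size bs *: (b0 * \sum_(f : {ffun 'I_(size bs) -> 'I_N})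
    X (\prod_l scaled_letter iota a (nth 0 (b0 :: bs)) l (f l))).
Proof.
rewrite /sandwich Xl (big_nth 0) big_mkord.
have -> : \prod_(l < size bs) ((t *: \sum_(i < N) a i) * iota (nth 0 bs l)) =
    \prod_(l < size bs) (t *: \sum_(i < N) scaled_letter iota a (nth 0 (b0 :: bs)) l i).
  by apply: eq_bigr => l _; rewrite -scalerAl mulr_suml.
rewrite prod_scale linearZ /= -scalerAr bigA_distr_bigA raddf_sum.
by [].
Qed.

(** The two kinds of letters differ only at the last position, whose [iota (b k)] leaves [X] on the
    right; the partitioned maps end with a bare [a]. *)
Lemma scaled_law_letter k (b : nat -> B) (f : 'I_k -> nat) : (0 < k)%N ->
  X (\prod_l scaled_letter iota a b l (f l)) =
  X (\prod_l law_letter iota a b l (f l)) * b k.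
Proof.
case: k f => // k f _; rewrite -Xr !big_ord_recr /= -mulrA; congr (X (_ * _)).
  apply: eq_bigr => l _; rewrite /law_letter /eta_args /scaled_letter /=.
  by rewrite eqSS ltn_eqF.
by rewrite /law_letter /eta_args /scaled_letter /= eqxx.
Qed.

Lemma onto_sum_scaled k (b : nat -> B) r : (0 < k)%N ->
  onto_sum (fun f : 'I_k -> nat => X (\prod_l scaled_letter iota a b l (f l))) r =
  onto_sum (fun f : 'I_k -> nat => X (\prod_l law_letter iota a b l (f l))) r * b k.
Proof.
by move=> k0; rewrite /onto_sum mulr_suml; apply: eq_bigr => g _; exact: scaled_law_letter.
Qed.

End Expansion.

(** * The free, monotone and Boolean limits *)

Section CentralLimitTheorem.
Variables (R : realType) (A B : banachAlgType R[i]).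
Variables (iota : {lrmorphism B -> A}) (E E' : {linear A -> B}).
Variables (a : nat -> A) (i0 : nat) (S : nat -> set A).
Hypothesis sp : infinitesimal_prob_space iota E E'.
Hypothesis Ea : forall i, E (a i) = 0.
Hypothesis E'a : forall i, E' (a i) = 0.
Hypothesis id_distr : identically_distributed iota E E' a.
Hypothesis fam : algebra_family iota a S.

Lemma moments_limit (X : {linear A -> B}) (b0 : B) (bs : seq B)
    (k := size bs) (b := nth 0 (b0 :: bs))
    (M := fun f : 'I_k -> nat => X (\prod_l scaled_letter iota a b l (f l))) (l : B) :
  (forall b x, X (iota b * x) = b * X x) ->
  (forall f g, same_order f g -> M f = M g) ->
  (forall f L, count (fun t => f t == L) (enum 'I_k) = 1%N -> M f = 0) ->
  l = (if odd k then 0 else (k./2)`!%:R^-1 *: (b0 * onto_sum M k./2)) ->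
  ((fun N => X (sandwich iota (normalized_sum a N) b0 bs)) @ \oo --> l)%classic.
Proof.
move=> Xl spr sing ->.
pose t (N : nat) : R[i] := (sqrtC N%:R)^-1.
have -> : (fun N => X (sandwich iota (normalized_sum a N) b0 bs)) =
    (fun N => t N ^+ k *: \sum_(r < k.+1) (b0 * onto_sum M r) *+ 'C(N, r)).
  apply: funext => N; rewrite /normalized_sum sandwich_sum // -/k -/b.
  rewrite (counting spr) mulr_sumr; congr (_ *: _); apply: eq_bigr => r _.
  by rewrite mulrnAr.
apply: (@cvg_moments _ _ t (@root_small R) (@root_sqr R) k (fun r => b0 * onto_sum M r)).
by move=> r kr; rewrite (onto_sum_small sing) ?mulr0.
Qed.

Let centered b k l := @centered_scaled_letter _ _ _ iota E E' a S i0 sp fam Ea E'a k b l.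

Lemma dual_limit (b0 : B) (bs : seq B) (k := size bs) (b := nth 0 (b0 :: bs))
    (M := fun f : 'I_k -> nat => E (\prod_l scaled_letter iota a b l (f l)))
    (M' := fun f : 'I_k -> nat => E' (\prod_l scaled_letter iota a b l (f l))) (l l' : B) :
  spreads_from (dual_E E E') (dual_family iota a S) (@same_order 'I_k) ->
  singletons_vanish (dual_E E E') (dual_family iota a S) 'I_k ->
  l = (if odd k then 0 else (k./2)`!%:R^-1 *: (b0 * onto_sum M k./2)) ->
  l' = (if odd k then 0 else (k./2)`!%:R^-1 *: (b0 * onto_sum M' k./2)) ->
  ((fun N => E (sandwich iota (normalized_sum a N) b0 bs)) @ \oo --> l)%classic /\
  ((fun N => E' (sandwich iota (normalized_sum a N) b0 bs)) @ \oo --> l')%classic.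
Proof.
move=> spr sing lE l'E; split; apply: moments_limit => //.
- exact: iEl sp.
- by move=> f g fg; have [] := moments_spread fam (centered b (k := k)) spr fg.
- by move=> f L c1; have [] := moments_singleton sp id_distr fam (centered b (k := k)) sing c1.
- exact: iE'l sp.
- by move=> f g fg; have [] := moments_spread fam (centered b (k := k)) spr fg.
- by move=> f L c1; have [] := moments_singleton sp id_distr fam (centered b (k := k)) sing c1.
Qed.

Lemma spread_same_order k :
  spreads_from (dual_E E E') (dual_family iota a S) (@same_kernel 'I_k) ->
  spreads_from (dual_E E E') (dual_family iota a S) (@same_order 'I_k).
Proof. by move=> spr f g w fg; apply: spr; exact: same_order_kernel. Qed.

(** For [k = 0] the moment does not depend on [N]. The case is treated apart because the leading
    terms are computed for [k > 0]. *)
Lemma trivial_limits (m m' : nat -> (nat -> B) -> B) b0 :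
  m 0%N (nth 0 [:: b0]) = b0 -> m' 0%N (nth 0 [:: b0]) = 0 ->
  ((fun N => E (sandwich iota (normalized_sum a N) b0 [::])) @ \oo -->
    m 0%N (nth 0 [:: b0]))%classic /\
  ((fun N => E' (sandwich iota (normalized_sum a N) b0 [::])) @ \oo -->
    m' 0%N (nth 0 [:: b0]))%classic.
Proof.
move=> -> ->; split; under eq_fun do rewrite /sandwich big_nil mulr1.
  by under eq_fun do rewrite (ips_unit sp); exact: cvg_cst.
by under eq_fun do rewrite (iE'u sp); exact: cvg_cst.
Qed.

Lemma limits_moments (m m' : nat -> (nat -> B) -> B) :
  moment_multilinear m -> moment_multilinear m' ->
  (forall b0 bs,
    ((fun N => E (sandwich iota (normalized_sum a N) b0 bs)) @ \oo -->
      m (size bs) (nth 0 (b0 :: bs)))%classic /\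
    ((fun N => E' (sandwich iota (normalized_sum a N) b0 bs)) @ \oo -->
      m' (size bs) (nth 0 (b0 :: bs)))%classic) ->
  moments_converge iota E (normalized_sum a) (law m) /\
  moments_converge iota E' (normalized_sum a) (law m').
Proof.
by move=> mm mm' lim; split=> b0 bs; rewrite law_sandwich //; have [] := lim b0 bs.
Qed.

Lemma NC2_0_empty pi : pi \in NC2 0 -> pi = finset.set0.
Proof.
rewrite inE => /and3P[/and3P[_ _ pi0] _ _]; apply/finset.setP => V; rewrite inE.
apply: contraNF pi0; have -> // : V = finset.set0.
by apply/finset.setP => -[].
Qed.

Lemma even_size (k : nat) : ~~ odd k -> (0 < k)%N -> exists r, k = r.+1.*2.
Proof.
move=> ok k0; exists k./2.-1; rewrite prednK ?even_halfK //.
by rewrite half_gt0; case: k ok k0 => [|[]].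
Qed.

Lemma fact_neq0 n : n`!%:R != 0 :> R[i].
Proof. by rewrite pnatr_eq0 -lt0n fact_gt0. Qed.

(** [w p] counts the contributing orders of the blocks of [p], and [c p] is their proportion among
    all [n!] orders. *)
Lemma normalize_sum (T : finType) (P : {set T}) (v : T -> B) (w : T -> nat)
    (c : T -> R[i]) n (b c0 : B) :
  (forall p, p \in P -> (n`!%:R^-1 : R[i]) * (w p)%:R = c p) ->
  \sum_(p in P) c p *: (b * v p * c0) =
  n`!%:R^-1 *: (b * ((\sum_(p in P) v p *+ w p) * c0)).
Proof.
move=> wc; rewrite mulr_suml mulr_sumr scaler_sumr; apply: eq_bigr => p pP.
by rewrite mulrnAl mulrnAr -[_ *+ w p](scaler_nat (w p)) scalerA wc // mulrA.
Qed.

Section Free.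
Hypothesis SB : forall i b, S i (iota b).
Hypothesis free : infinitesimally_free iota E E' S.

Lemma free_normalization (k r : nat) (b0 c0 : B) (v : {set {set 'I_k}} -> B) :
  \sum_(pi in NC2 k) b0 * v pi * c0 =
  (r.+1)`!%:R^-1 *: (b0 * ((\sum_(pi in NC2 k) v pi *+ (r.+1)`!) * c0)).
Proof.
rewrite -(@normalize_sum _ _ v (fun=> (r.+1)`!) (fun=> 1)) => [|pi _].
  by apply: eq_bigr => pi _; rewrite scale1r.
by rewrite mulVf ?fact_neq0.
Qed.

Lemma free_central_limit :
  moments_converge iota E (normalized_sum a) (semicircle_law iota E (a i0)) /\
  moments_converge iota E' (normalized_sum a) (inf_semicircle_law iota E E' (a i0)).
Proof.
apply: limits_moments.
- exact: semicircle_multilinear.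
- exact: inf_semicircle_multilinear.
move=> b0 [|b1 bs].
  apply: (trivial_limits (m := semicircle_moment iota E (a i0))
    (m' := inf_semicircle_moment iota E E' (a i0))) => //.
  rewrite /inf_semicircle_moment /= big1 // => pi /NC2_0_empty ->.
  by rewrite /deta_part /dE_part big_set0 mulr0 mul0r.
have k0 : (0 < size (b1 :: bs))%N by [].
move: (b1 :: bs) k0 => {b1}bs k0; set k := size bs in k0 *; set b := nth 0 _.
apply: dual_limit.
- apply: spread_same_order; apply: (free_spread (dual_ncps sp id_distr fam)).
    by move=> e c /andP[F1 F2]; apply/andP; split; exact: family_sub_const.
  exact: free_dual_words.
- exact: free_singletons_vanish.
- rewrite /semicircle_moment; case: ifPn => // ok; rewrite (negPf (lt0n_neq0 k0)).
  have [r kr] := even_size ok k0; have kh : k./2 = r.+1 by rewrite kr doubleK.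
  rewrite kh (onto_sum_scaled a (fun x c => iEr sp c x)) //.
  have [-> _] := free_leading i0 sp id_distr fam Ea E'a b kr SB free.
  exact: free_normalization.
- rewrite /inf_semicircle_moment; case: ifPn => // ok.
  have [r kr] := even_size ok k0; have kh : k./2 = r.+1 by rewrite kr doubleK.
  rewrite kh (onto_sum_scaled a (fun x c => iE'r sp c x)) //.
  have [_ ->] := free_leading i0 sp id_distr fam Ea E'a b kr SB free.
  exact: free_normalization.
Qed.

End Free.

Section Monotone.
Hypothesis mono : infinitesimally_monotone iota E E' S.

(** By the hook length formula [orders] times [tau_fact] is [(r.+1)!], so the proportion of
    admissible orders is the inverse of [tau_fact]. *)
Lemma monotone_normalization (k r : nat) (b0 c0 : B) (v : {set {set 'I_k}} -> B) :
  k = r.+1.*2 ->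
  \sum_(pi in NC2 k) (tau_fact pi)%:R^-1 *: (b0 * v pi * c0) =
  (r.+1)`!%:R^-1 *:
    (b0 * ((\sum_(pi in NC2 k) v pi *+ orders (@nested k) pi) * c0)).
Proof.
move=> kr; apply: normalize_sum => pi; rewrite NC2E => /andP[ppi nc].
have ot := orders_tau kr ppi nc.
have t0 : (tau_fact pi)%:R != 0 :> R[i].
  rewrite pnatr_eq0 -lt0n; have := fact_gt0 r.+1.
  by rewrite -ot muln_gt0 => /andP[].
apply: (mulIf t0); rewrite mulVf // -mulrA -natrM ot mulVf ?fact_neq0 //.
Qed.

Lemma monotone_central_limit :
  moments_converge iota E (normalized_sum a) (arcsine_law iota E (a i0)) /\
  moments_converge iota E' (normalized_sum a) (inf_arcsine_law iota E E' (a i0)).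
Proof.
apply: limits_moments.
- exact: arcsine_multilinear.
- exact: inf_arcsine_multilinear.
move=> b0 [|b1 bs].
  apply: (trivial_limits (m := arcsine_moment iota E (a i0))
    (m' := inf_arcsine_moment iota E E' (a i0))) => //.
  rewrite /inf_arcsine_moment /= big1 // => pi /NC2_0_empty ->.
  by rewrite /deta_part /dE_part big_set0 mulr0 mul0r scaler0.
have k0 : (0 < size (b1 :: bs))%N by [].
move: (b1 :: bs) k0 => {b1}bs k0; set k := size bs in k0 *; set b := nth 0 _.
apply: dual_limit.
- apply: (mono_spread (dual_ncps sp id_distr fam)).
  exact: monotone_dual_words.
- exact: mono_singletons_vanish.
- rewrite /arcsine_moment; case: ifPn => // ok; rewrite (negPf (lt0n_neq0 k0)).
  have [r kr] := even_size ok k0; have kh : k./2 = r.+1 by rewrite kr doubleK.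
  rewrite kh (onto_sum_scaled a (fun x c => iEr sp c x)) //.
  have [-> _] := mono_leading i0 sp id_distr fam Ea E'a b kr mono.
  exact: monotone_normalization.
- rewrite /inf_arcsine_moment; case: ifPn => // ok.
  have [r kr] := even_size ok k0; have kh : k./2 = r.+1 by rewrite kr doubleK.
  rewrite kh (onto_sum_scaled a (fun x c => iE'r sp c x)) //.
  have [_ ->] := mono_leading i0 sp id_distr fam Ea E'a b kr mono.
  exact: monotone_normalization.
Qed.

End Monotone.

Section Boolean.
Hypothesis hbool : infinitesimally_boolean E E' S.
Variables eta eta' : B -> B.
Hypothesis etaE : forall c, eta c = E (a i0 * iota c * a i0).
Hypothesis eta'E : forall c, eta' c = E' (a i0 * iota c * a i0).

Lemma eta_linear : linear eta /\ linear eta'.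
Proof.
by split=> t x y; rewrite ?etaE ?eta'E linearP mulrDr mulrDl -scalerAr -scalerAl linearP.
Qed.

Lemma boolean_normalization r (b0 v : B) : b0 * v = r`!%:R^-1 *: (b0 * (v *+ r`!)) :> B.
Proof. by rewrite mulrnAr -[b0 * v *+ _]scaler_nat scalerA mulVf ?fact_neq0 // scale1r. Qed.

Lemma boolean_central_limit :
  moments_converge iota E (normalized_sum a) (bernoulli_law eta) /\
  moments_converge iota E' (normalized_sum a) (inf_bernoulli_law eta eta').
Proof.
have [lin lin'] := eta_linear; apply: limits_moments.
- exact: bernoulli_multilinear.
- exact: inf_bernoulli_multilinear.
move=> b0 [|b1 bs].
  apply: (trivial_limits (m := bernoulli_moment eta)
    (m' := inf_bernoulli_moment eta eta')).
    by rewrite /bernoulli_moment /= big_ord0 mulr1.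
  by rewrite /inf_bernoulli_moment /= big_ord0.
have k0 : (0 < size (b1 :: bs))%N by [].
move: (b1 :: bs) k0 => {b1}bs k0; set k := size bs in k0 *; set b := nth 0 _.
apply: dual_limit.
- apply: spread_same_order; apply: (boolean_spread (dual_ncps sp id_distr fam)).
  exact: boolean_dual_words.
- exact: boolean_singletons_vanish.
- rewrite /bernoulli_moment; case: ifPn => // ok.
  have [r kr] := even_size ok k0; have kh : k./2 = r.+1 by rewrite kr doubleK.
  rewrite kh.
  have [-> _] := boolean_leading sp id_distr fam Ea E'a b kr isT hbool etaE eta'E.
  exact: boolean_normalization.
- rewrite /inf_bernoulli_moment; case: ifPn => // ok.
  have [r kr] := even_size ok k0; have kh : k./2 = r.+1 by rewrite kr doubleK.
  rewrite kh.
  have [_ ->] := boolean_leading sp id_distr fam Ea E'a b kr isT hbool etaE eta'E.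
  by rewrite -boolean_normalization mulr_sumr.
Qed.

End Boolean.
End CentralLimitTheorem.

Theorem theorem5p3 (R : realType) (A B : banachAlgType R[i])
    (iota : {lrmorphism B -> A}) (E E' : {linear A -> B})
    (a : nat -> A) (eta eta' : B -> B) (i0 : nat) :
  infinitesimal_prob_space iota E E' ->
  (forall i, E (a i) = 0) ->
  (forall i, E' (a i) = 0) ->
  identically_distributed iota E E' a ->
  (forall i b, eta b = E (a i * iota b * a i)) ->
  (forall i b, eta' b = E' (a i * iota b * a i)) ->
  [/\ infinitesimally_free iota E E' (fun i => alg_gen iota (a i)) ->
        moments_converge iota E (normalized_sum a)
          (semicircle_law iota E (a i0)) /\
        moments_converge iota E' (normalized_sum a)
          (inf_semicircle_law iota E E' (a i0)),
      infinitesimally_boolean E E' (fun i => alg_gen iota (a i)) \/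
      infinitesimally_boolean E E' (fun i => nonunital_alg_gen iota (a i)) ->
        moments_converge iota E (normalized_sum a) (bernoulli_law eta) /\
        moments_converge iota E' (normalized_sum a)
          (inf_bernoulli_law eta eta') &
      infinitesimally_monotone iota E E' (fun i => alg_gen iota (a i)) \/
      infinitesimally_monotone iota E E'
          (fun i => nonunital_alg_gen iota (a i)) ->
        moments_converge iota E (normalized_sum a)
          (arcsine_law iota E (a i0)) /\
        moments_converge iota E' (normalized_sum a)
          (inf_arcsine_law iota E E' (a i0))].
Proof.
move=> sp Ea E'a id_distr etaE eta'E; split.
- move=> free; apply: (free_central_limit i0 sp Ea E'a id_distr (alg_gen_family iota a)) => //.
  by move=> i; exact: alg_gen_const.
(* Either form of the hypothesis concerns an algebra family, so both are instances of one result for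
   different [S]. *)
- case=> hbool.
    exact: (boolean_central_limit sp Ea E'a id_distr (alg_gen_family iota a) hbool
      (etaE i0) (eta'E i0)).
  exact: (boolean_central_limit sp Ea E'a id_distr (nonunital_alg_gen_family iota a) hbool
    (etaE i0) (eta'E i0)).
- case=> mono.
    exact: (monotone_central_limit i0 sp Ea E'a id_distr (alg_gen_family iota a) mono).
  exact: (monotone_central_limit i0 sp Ea E'a id_distr (nonunital_alg_gen_family iota a) mono).
Qed.
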